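(* Let $T$ be injective, bisectorial of angle $\omega\in(0,\frac{\pi}{2})$, and have a bounded $H^\infty$-functional calculus. Let $P_\pm=\mathds{1}_\pm(T)$ be its spectral projectors. Then there holds a) $P_+^2=P_+$ and $P_-^2=P_-$, b) $P_+P_-=P_-P_+=0$, c) $P_++P_-=1$.
   Context: **Clifford algebra and modules.** Let $n\in\mathbb{N}$ and let $\mathbb{R}_n$ be the real Clifford algebra generated by $e_1,\dots,e_n$ with $e_i^2=-1$, $e_ie_j=-e_je_i$ for $i\neq j$. $\overline{\,\cdot\,}$ is Clifford conjugation (the real-linear anti-automorphism with $\overline{e_i}=-e_i$), $\operatorname{Sc}$ is the scalar part, $|\cdot|$ is the Euclidean norm. Paravectors: $\mathbb{R}^{n+1}=\{x_0+x_1e_1+\dots+x_ne_n\mid x_i\in\mathbb{R}\}$, with $s_0=\operatorname{Sc}(s)$. $\mathbb{S}=\{x_1e_1+\dots+x_ne_n\mid x_1^2+\dots+x_n^2=1\}$; for $J\in\mathbb{S}$, $\mathbb{C}_J=\{x+Jy\mid x,y\in\mathbb{R}\}$. $V$ is a right Hilbert module: a real vector space which is a right $\mathbb{R}_n$-module (extending real scalar multiplication), with an $\mathbb{R}$-bilinear form $\langle\cdot,\cdot\rangle:V\times V\to\mathbb{R}_n$ satisfying $\langle vs,w\rangle=\overline{s}\langle v,w\rangle$, $\langle v,ws\rangle=\langle v,w\rangle s$, $\overline{\langle v,w\rangle}=\langle w,v\rangle$, and such that $(V,\operatorname{Sc}\langle\cdot,\cdot\rangle)$ is a real Hilbert space;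 $\|v\|^2=\operatorname{Sc}\langle v,v\rangle$. **Operators and $S$-spectrum.** $T:\operatorname{dom}T\to V$ is right linear if $\operatorname{dom}T$ is a right submodule, $T$ is additive and $T(vs)=(Tv)s$ for $s\in\mathbb{R}_n$. $\mathcal{K}(V)$ is the set of closed right linear operators, $\mathcal{B}(V)$ the set of everywhere defined bounded right linear operators. For $s\in\mathbb{R}^{n+1}$: $Q_s[T]=T^2-2s_0T+|s|^2$ with domain $\operatorname{dom}T^2$; $\rho_S(T)=\{s\in\mathbb{R}^{n+1}\mid Q_s[T]^{-1}\in\mathcal{B}(V)\}$, $\sigma_S(T)=\mathbb{R}^{n+1}\setminus\rho_S(T)$. $\mathcal{I}^Rs:V\to V$ is right multiplication $v\mapsto vs$. One has $s\in\rho_S(T)$ iff $\mathcal{I}^Rs-T$ is bijective from $\operatorname{dom}T$ onto $V$. **Bisectorial operators.** $S_\omega=\{s\in\mathbb{R}^{n+1}\setminus\{0\}\mid|\operatorname{Arg}(s)|<\omega\}$, where $\operatorname{Arg}(s)=\arccos(s_0/|s|)$; $D_\omega=S_\omega\cup(-S_\omega)$ for $\omega\in(0,\frac{\pi}{2})$. $T\in\mathcal{K}(V)$ is bisectorial of angle $\omega\in(0,\frac{\pi}{2})$ if $\sigma_S(T)\subseteq\overline{D_\omega}$ and for every $\varphi\in(\omega,\frac{\pi}{2})$ there is $C_\varphi\ge0$ with $\|(\mathcal{I}^Rs-T)^{-1}\|\le C_\varphi/|s|$ for all $s\in\mathbb{R}^{n+1}\setminus(D_\varphi\cup\{0\})$.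 **Functions.** For $U\subseteq\mathbb{R}^{n+1}$ open and axially symmetric ($x+Jy\in U$ implies $x+Iy\in U$ for all $I\in\mathbb{S}$), $f:U\to\mathbb{R}^{n+1}$ is intrinsic if $f(x+Jy)=\alpha(x,y)+J\beta(x,y)$ with real-valued $\alpha,\beta$ independent of $J$, satisfying the Cauchy–Riemann equations, $\alpha$ even and $\beta$ odd in $y$. $\mathcal{N}^0(U)$: intrinsic $f$ with $|f(s)|\le C|s|^\alpha/(1+|s|^{2\alpha})$ for some $\alpha>0$, $C\ge0$. $\mathcal{N}^\infty(U)$: bounded intrinsic $f$, with $\|f\|_\infty=\sup_U|f|$. **Functional calculus.** Let $T$ be injective and bisectorial of angle $\omega$. For $f\in\mathcal{N}^0(D_\theta)$, $\theta\in(\omega,\frac{\pi}{2})$, $$f(T)v=\frac{1}{2\pi}\int_{\partial D_\varphi\cap\mathbb{C}_J}(\mathcal{I}^Rs-T)^{-1}vf(s)\,ds_J,$$ with $\varphi\in(\omega,\theta)$ and $J\in\mathbb{S}$ arbitrary, $ds_J=ds/J$, and the boundary oriented so that the double sector lies to its left. For $f\in\mathcal{N}^\infty(D_\theta)$, $f(T)=e(T)^{-1}(ef)(T)$ (with natural domain), where $e\in\mathcal{N}^0(D_\theta)$ is any function with $ef\in\mathcal{N}^0(D_\theta)$ and $e(T)$ injective, e.g. $e(s)=\frac{s}{1+s^2}$; $f(T)$ is independent of the choice of $e$. An injective bisectorial operator $T$ of angle $\omega$ has a bounded $H^\infty$-functional calculus if for every $\theta\in(\omega,\frac{\pi}{2})$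 there is $C_\theta\ge0$ such that $f(T)\in\mathcal{B}(V)$ and $\|f(T)\|\le C_\theta\|f\|_\infty$ for all $f\in\mathcal{N}^\infty(D_\theta)$. **Spectral projectors.** $\mathds{1}_+(s)=1$ if $\operatorname{Sc}(s)>0$ and $0$ if $\operatorname{Sc}(s)<0$; $\mathds{1}_-(s)=0$ if $\operatorname{Sc}(s)>0$ and $1$ if $\operatorname{Sc}(s)<0$ (functions in $\mathcal{N}^\infty(D_\theta)$). For $T$ injective, bisectorial with bounded $H^\infty$-functional calculus, $P_+=\mathds{1}_+(T)$ and $P_-=\mathds{1}_-(T)$; these lie in $\mathcal{B}(V)$. *)

(* Defs.v *)
From HB Require Import structures.
From mathcomp Require Import all_boot all_order all_algebra.
From mathcomp Require Import Rstruct.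
From Stdlib Require Import Reals.
From Coquelicot Require Import Coquelicot.
From mathcomp Require Import ring.

Set Implicit Arguments.
Unset Strict Implicit.
Unset Printing Implicit Defensive.

(* Stdlib and MathComp both claim the key %R; it is left to the Stdlib reals. *)
Delimit Scope ring_scope with ring.
Delimit Scope R_scope with R.

Section CliffordAlgebra.
Import GRing.Theory.
Local Open Scope ring_scope.

Variable n : nat.
Implicit Types A B C : {set 'I_n}.

(* An element s is the family of its coordinates on the basis (e_A), where
   e_A is the product of the e_i, i \in A, taken in increasing order. *)
Definition clifford := {ffun {set 'I_n} -> R}.

(* The pointwise product of {ffun _ -> R} is deliberately not inherited. *)
HB.instance Definition _ := GRing.Lmodule.copy clifford {ffun {set 'I_n} -> R^o}.

Implicit Types s t u : clifford.

Definition symdiff A B : {set 'I_n} := (A :\: B) :|: (B :\: A).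

(* e_A * e_B = csign A B *: e_(symdiff A B): moving b \in B to its place costs
   one sign for each a \in A with b < a, and one more if b \in A, since
   e_b ^+ 2 = -1. *)
Definition csign A B : R :=
  \prod_(a in A) \prod_(b in B) (if (b <= a)%nat then -1 else 1).

Definition cbasis A : clifford := [ffun B => (B == A)%:R].
Definition cgen (i : 'I_n) : clifford := cbasis [set i].
Definition cone : clifford := cbasis set0.
Definition cmul s t : clifford :=
  [ffun C => \sum_A csign A (symdiff A C) * s A * t (symdiff A C)].

Lemma in_symdiff A B i : (i \in symdiff A B) = (i \in A) (+) (i \in B).
Proof. by rewrite !inE; case: (i \in A); case: (i \in B). Qed.

Lemma symdiffA A B C : symdiff A (symdiff B C) = symdiff (symdiff A B) C.
Proof. by apply/setP=> i; rewrite !in_symdiff addbA. Qed.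

Lemma symdiffC A B : symdiff A B = symdiff B A.
Proof. by apply/setP=> i; rewrite !in_symdiff addbC. Qed.

Lemma symdiff0l A : symdiff set0 A = A.
Proof. by apply/setP=> i; rewrite in_symdiff inE. Qed.

Lemma symdiffxx A : symdiff A A = set0.
Proof. by apply/setP=> i; rewrite in_symdiff inE addbb. Qed.

Lemma symdiffK A B : symdiff A (symdiff A B) = B.
Proof. by rewrite symdiffA symdiffxx symdiff0l. Qed.

Lemma prod_symdiff (F : 'I_n -> R) A B : (forall i, F i * F i = 1) ->
  \prod_(i in symdiff A B) F i = (\prod_(i in A) F i) * (\prod_(i in B) F i).
Proof.
move=> FF; rewrite !(big_mkcond (fun i => i \in _)) /= -big_split /=.
apply: eq_bigr => i _; rewrite in_symdiff.
by case: (i \in A); case: (i \in B); rewrite /= ?FF ?mulr1 ?mul1r.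
Qed.

Lemma csign_symdiffl A B C : csign (symdiff A B) C = csign A C * csign B C.
Proof.
apply: prod_symdiff => a; rewrite -big_split /= big1 // => b _.
by case: ifP => _; rewrite ?mulrNN mulr1.
Qed.

Lemma csign_symdiffr A B C : csign A (symdiff B C) = csign A B * csign A C.
Proof.
rewrite /csign -big_split /=; apply: eq_bigr => a _; apply: prod_symdiff => b.
by case: ifP => _; rewrite ?mulrNN mulr1.
Qed.

Lemma csign0l A : csign set0 A = 1.
Proof. by rewrite /csign big_set0. Qed.

Lemma csign0r A : csign A set0 = 1.
Proof. by rewrite /csign big1 // => a _; rewrite big_set0. Qed.

Lemma symdiff_bij A : bijective (symdiff A).
Proof. by exists (symdiff A) => B; apply: symdiffK. Qed.

Lemma cmulA : associative cmul.
Proof.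
move=> s t u; apply/ffunP=> D; rewrite !ffunE.
under eq_bigr => A _ do rewrite ffunE big_distrr /=.
under [RHS]eq_bigr => A _ do rewrite ffunE big_distrr big_distrl /=.
rewrite [RHS]exchange_big /=; apply: eq_bigr => A _.
rewrite [RHS](reindex (symdiff A)) /=; last exact: onW_bij (symdiff_bij A).
apply: eq_bigr => B _; rewrite symdiffK -symdiffA [symdiff B (symdiff A D)]symdiffA.
rewrite [symdiff B A]symdiffC -symdiffA !(csign_symdiffl, csign_symdiffr).
have := csign_symdiffl A A B; rewrite symdiffxx csign0l => sqAB.
rewrite -[LHS]mul1r sqAB; ring.
Qed.

Lemma cmul1l : left_id cone cmul.
Proof.
move=> s; apply/ffunP=> C; rewrite ffunE (bigD1 set0) //= big1 ?addr0.
  by rewrite ffunE eqxx symdiff0l csign0l !mul1r.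
by move=> A /negPf A0; rewrite ffunE A0 mulr0 mul0r.
Qed.

Lemma cmul1r : right_id cone cmul.
Proof.
move=> s; apply/ffunP=> C; rewrite ffunE (bigD1 C) //= big1 ?addr0.
  by rewrite ffunE symdiffxx eqxx csign0r mulr1 mul1r.
move=> A nAC; rewrite ffunE; case: eqP => [AC0|_]; last by rewrite mulr0.
by case/eqP: nAC; rewrite -(symdiffK A C) AC0 symdiffC symdiff0l.
Qed.

Lemma cmulDl : left_distributive cmul +%R.
Proof.
move=> s t u; apply/ffunP=> C; rewrite !ffunE -big_split /=.
by apply: eq_bigr => A _; rewrite ffunE mulrDr mulrDl.
Qed.

Lemma cmulDr : right_distributive cmul +%R.
Proof.
move=> s t u; apply/ffunP=> C; rewrite !ffunE -big_split /=.
by apply: eq_bigr => A _; rewrite ffunE mulrDr.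
Qed.

Lemma cone_neq0 : cone != 0.
Proof.
by apply/eqP=> /ffunP/(_ set0); rewrite !ffunE eqxx; apply/eqP/oner_neq0.
Qed.

HB.instance Definition _ := GRing.Zmodule_isNzRing.Build clifford
  cmulA cmul1l cmul1r cmulDl cmulDr cone_neq0.

Lemma cscaleAl (a : R) s t : a *: (s * t) = (a *: s) * t.
Proof.
apply/ffunP=> C; rewrite !ffunE; rewrite /GRing.scale /= big_distrr /=.
by apply: eq_bigr => A _; rewrite ffunE; rewrite /GRing.scale /=; ring.
Qed.

HB.instance Definition _ := GRing.Lmodule_isLalgebra.Build R clifford cscaleAl.

Lemma cscaleAr (a : R) s t : a *: (s * t) = s * (a *: t).
Proof.
apply/ffunP=> C; rewrite !ffunE; rewrite /GRing.scale /= big_distrr /=.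
by apply: eq_bigr => A _; rewrite ffunE; rewrite /GRing.scale /=; ring.
Qed.

HB.instance Definition _ := GRing.Lalgebra_isAlgebra.Build R clifford cscaleAr.

Lemma cbasisM A B : cbasis A * cbasis B = csign A B *: cbasis (symdiff A B).
Proof.
apply/ffunP=> C; rewrite !ffunE (bigD1 A) //= big1 ?addr0 => [|D /negPf DA].
  rewrite !ffunE eqxx mulr1 -(inj_eq (bij_inj (symdiff_bij A))) symdiffK.
  by rewrite /GRing.scale /=; case: eqP => [->|_]; rewrite ?symdiffK ?mulr0.
by rewrite !ffunE DA mulr0 mul0r.
Qed.

Lemma csign11 (i j : 'I_n) :
  csign [set i] [set j] = if (j <= i)%nat then -1 else 1.
Proof. by rewrite /csign !big_set1. Qed.

Lemma cgen_sq i : cgen i * cgen i = -1.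
Proof. by rewrite cbasisM csign11 leqnn symdiffxx scaleN1r. Qed.

Lemma cgen_anticomm i j : i != j -> cgen i * cgen j = - (cgen j * cgen i).
Proof.
move=> nij; rewrite !cbasisM !csign11 symdiffC -scaleNr; congr (_ *: _).
by case: ltngtP nij => [||/val_inj ->]; rewrite ?eqxx ?opprK.
Qed.

(* conj e_A = csign A A *: e_A because conj e_A is the inverse of e_A and
   e_A ^+ 2 = csign A A. *)
Definition cconj s : clifford := [ffun A => csign A A * s A].

Lemma cconjM s t : cconj (s * t) = cconj t * cconj s.
Proof.
apply/ffunP=> C; rewrite !ffunE big_distrr /=.
rewrite [RHS](reindex (fun A => symdiff C A)) /=; last first.
  exact: onW_bij (symdiff_bij C).
apply: eq_bigr => A _; rewrite !ffunE [symdiff C A]symdiffC -symdiffA symdiffxx.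
rewrite [symdiff A set0]symdiffC symdiff0l !(csign_symdiffl, csign_symdiffr).
have sqr B D : csign B D * csign B D = 1.
  by rewrite -csign_symdiffl symdiffxx csign0l.
rewrite -[LHS]mulr1 -(sqr C A) -[LHS]mulr1 -(sqr A A); ring.
Qed.

Lemma cconj_gen i : cconj (cgen i) = - cgen i.
Proof.
apply/ffunP=> A; rewrite !ffunE; case: eqP => [->|_].
  by rewrite csign11 leqnn mulr1.
by rewrite mulr0 oppr0.
Qed.

Definition Sc s : R := s set0.
Definition cnorm s : R := sqrt (\sum_A s A ^+ 2).

Definition cvector (x : 'I_n -> R) : clifford := \sum_i x i *: cgen i.
Definition paravector s : Prop :=
  exists (x0 : R) (x : 'I_n -> R), s = x0%:A + cvector x.
Definition imag_unit (J : clifford) : Prop :=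
  exists x : 'I_n -> R, \sum_i x i ^+ 2 = 1 /\ J = cvector x.

Definition slice (J : clifford) (x y : R) : clifford := x%:A + y *: J.

End CliffordAlgebra.

Open Scope R_scope.

Record rightHilbertModule (n : nat) := RightHilbertModule {
  hm_space :> CompleteNormedModule R_AbsRing;
  ract : hm_space -> clifford n -> hm_space;
  ip : hm_space -> hm_space -> clifford n;
  ractDl : forall (v w : hm_space) s,
    ract (plus v w) s = plus (ract v s) (ract w s);
  ractDr : forall (v : hm_space) s t,
    ract v (s + t)%ring = plus (ract v s) (ract v t);
  ractM : forall (v : hm_space) s t, ract v (s * t)%ring = ract (ract v s) t;
  ract_real : forall (v : hm_space) (a : R), ract v (a%:A)%ring = scal a v;
  ipDl : forall u v w : hm_space, ip (plus u v) w = (ip u w + ip v w)%ring;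
  ipDr : forall u v w : hm_space, ip u (plus v w) = (ip u v + ip u w)%ring;
  ip_scall : forall (a : R) (v w : hm_space), ip (scal a v) w = (a *: ip v w)%ring;
  ip_scalr : forall (a : R) (v w : hm_space), ip v (scal a w) = (a *: ip v w)%ring;
  ip_ractl : forall (v w : hm_space) s, ip (ract v s) w = (cconj s * ip v w)%ring;
  ip_ractr : forall (v w : hm_space) s, ip v (ract w s) = (ip v w * s)%ring;
  ip_conj : forall v w : hm_space, cconj (ip v w) = ip w v;
  norm_sq : forall v : hm_space, norm v ^ 2 = Sc (ip v v)
}.

(* The values of app outside dom are irrelevant. *)
Record operator (V : CompleteNormedModule R_AbsRing) := Operator {
  dom : V -> Prop;
  app :> V -> V
}.

Section Operators.
Variable V : CompleteNormedModule R_AbsRing.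
Implicit Types A B : operator V.

Definition op_eq A B : Prop :=
  (forall v, dom A v <-> dom B v) /\ (forall v, dom A v -> A v = B v).
Definition op_zero : operator V := Operator (fun _ => True) (fun _ => zero).
Definition op_id : operator V := Operator (fun _ => True) (fun v => v).
Definition op_add A B : operator V :=
  Operator (fun v => dom A v /\ dom B v) (fun v => plus (A v) (B v)).
Definition op_sub A B : operator V :=
  Operator (fun v => dom A v /\ dom B v) (fun v => minus (A v) (B v)).
Definition op_scal (a : R) A : operator V :=
  Operator (dom A) (fun v => scal a (A v)).
Definition op_comp A B : operator V :=
  Operator (fun v => dom B v /\ dom A (B v)) (fun v => A (B v)).
Definition op_injective A : Prop :=
  forall v w, dom A v -> dom A w -> A v = A w -> v = w.
(* Only meaningful for injective A. *)
Definition op_inv A : operator V :=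
  Operator (fun w => exists v, dom A v /\ A v = w)
           (fun w => iota (fun v : V => dom A v /\ A v = w)).

Definition op_closed A : Prop :=
  closed (fun p : V * V => dom A (fst p) /\ A (fst p) = snd p).
Definition opnorm_le A (M : R) : Prop :=
  forall v, dom A v -> norm (A v) <= M * norm v.
End Operators.

Section FunctionalCalculus.
Variables (n : nat) (V : rightHilbertModule n).
Implicit Types (T A P : operator V) (s t J : clifford n).
Implicit Types (U : clifford n -> Prop) (f : clifford n -> clifford n).

Definition right_linear A : Prop :=
  dom A zero /\
  (forall v w, dom A v -> dom A w ->
     dom A (plus v w) /\ A (plus v w) = plus (A v) (A w)) /\
  (forall v s, dom A v -> dom A (ract v s) /\ A (ract v s) = ract (A v) s).

Definition closed_op A : Prop := right_linear A /\ op_closed A.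
Definition bounded_op A : Prop :=
  right_linear A /\ (forall v, dom A v) /\ (exists M, opnorm_le A M).

Definition op_Q T s : operator V :=
  op_add (op_sub (op_comp T T) (op_scal (2 * Sc s) T))
         (op_scal (cnorm s ^ 2) (op_id V)).
Definition rho_S T s : Prop :=
  paravector s /\ op_injective (op_Q T s) /\ bounded_op (op_inv (op_Q T s)).
Definition sigma_S T s : Prop := paravector s /\ ~ rho_S T s.

Definition op_IR s : operator V := Operator (fun _ => True) (fun v => ract v s).
Definition resolvent T s : operator V := op_inv (op_sub (op_IR s) T).

Definition Arg s : R := acos (Sc s / cnorm s).
Definition sector (omega : R) s : Prop :=
  paravector s /\ s <> 0%ring /\ Rabs (Arg s) < omega.
Definition double_sector (omega : R) s : Prop :=
  sector omega s \/ sector omega (- s)%ring.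
Definition pv_closure U s : Prop :=
  paravector s /\
  forall eps : R, 0 < eps -> exists t, U t /\ cnorm (s - t)%ring < eps.

Definition bisectorial T (omega : R) : Prop :=
  closed_op T /\
  (forall s, sigma_S T s -> pv_closure (double_sector omega) s) /\
  (forall phi, omega < phi < PI / 2 ->
     exists C : R, 0 <= C /\
       forall s, paravector s -> s <> 0%ring -> ~ double_sector phi s ->
         opnorm_le (resolvent T s) (C / cnorm s)).

(* Functions on U are total functions on R_n of which only the values on U
   matter. The derivatives of alpha and beta are continuous; by the
   Cauchy-Riemann equations they are given by just two functions. *)
Definition intrinsic U f : Prop :=
  exists alpha beta alpha_x alpha_y : R -> R -> R,
    forall x y : R, (forall J, imag_unit J -> U (slice J x y)) ->
      (forall J, imag_unit J ->
         f (slice J x y) = slice J (alpha x y) (beta x y)) /\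
      alpha x (- y) = alpha x y /\ beta x (- y) = - beta x y /\
      is_derive (fun t : R => alpha t y) x (alpha_x x y) /\
      is_derive (fun t : R => alpha x t) y (alpha_y x y) /\
      is_derive (fun t : R => beta t y) x (- alpha_y x y) /\
      is_derive (fun t : R => beta x t) y (alpha_x x y) /\
      continuity_2d_pt alpha_x x y /\ continuity_2d_pt alpha_y x y.

Definition N_zero U f : Prop :=
  intrinsic U f /\
  exists a C : R, 0 < a /\ 0 <= C /\
    forall s, U s ->
      cnorm (f s) <= C * Rpower (cnorm s) a / (1 + Rpower (cnorm s) (2 * a)).
Definition N_infty U f : Prop :=
  intrinsic U f /\ exists C : R, forall s, U s -> cnorm (f s) <= C.
Definition sup_norm U f : R :=
  real (Lub_Rbar (fun r => exists s, U s /\ r = cnorm (f s))).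

(* The integral along the ray s = r z, 0 < r < oo, where z is in C_J: there
   ds_J = ds / J = z (- J) dr, as J^-1 = - J. *)
Definition ray_integral T f J z (v : V) : V :=
  RInt_gen
    (fun r : R =>
       ract (resolvent T (r *: z)%ring v) (f (r *: z) * (z * - J))%ring)
    (at_right 0) (Rbar_locally p_infty).

(* With the double sector on its left, the boundary leaves 0 along the rays
   of directions exp(- J phi) and - exp(- J phi), and comes back to 0 along
   those of directions exp(J phi) and - exp(J phi). *)
Definition contour_op T f J (phi : R) : operator V :=
  let zp := slice J (cos phi) (sin phi) in
  let zm := slice J (cos phi) (- sin phi) in
  Operator (fun _ => True) (fun v =>
    scal (/ (2 * PI))
      (plus (minus (ray_integral T f J zm v) (ray_integral T f J zp v))
            (minus (ray_integral T f J (- zm)%ring v)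
                   (ray_integral T f J (- zp)%ring v)))).

(* A is f(T), for f in N^0(D_theta): phi and J are arbitrary. *)
Definition is_calculus_zero T (omega theta : R) f A : Prop :=
  N_zero (double_sector theta) f /\
  exists (phi : R) J, omega < phi < theta /\ imag_unit J /\
    op_eq A (contour_op T f J phi).

(* A is f(T), for f in N^oo(D_theta): e is any regularizer of f, E = e(T) and
   F = (e f)(T). *)
Definition is_calculus T (omega theta : R) f A : Prop :=
  N_infty (double_sector theta) f /\
  exists (e : clifford n -> clifford n) (E F : operator V),
    is_calculus_zero T omega theta e E /\
    is_calculus_zero T omega theta (fun s => e s * f s)%ring F /\
    op_injective E /\
    op_eq A (op_comp (op_inv E) F).

Definition bounded_Hinfty_calculus T (omega : R) : Prop :=
  forall theta, omega < theta < PI / 2 ->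
    exists C : R, 0 <= C /\
      forall f, N_infty (double_sector theta) f ->
        exists A, is_calculus T omega theta f A /\ bounded_op A /\
          opnorm_le A (C * sup_norm (double_sector theta) f).

Definition ind_plus s : clifford n :=
  if Rlt_dec 0 (Sc s) then 1%ring else 0%ring.
Definition ind_minus s : clifford n :=
  if Rlt_dec (Sc s) 0 then 1%ring else 0%ring.

(* P is chi(T), for chi = ind_plus or ind_minus; theta is arbitrary. *)
Definition is_spectral_projector T (omega : R) chi P : Prop :=
  exists theta, omega < theta < PI / 2 /\ is_calculus T omega theta chi P.

End FunctionalCalculus.

(* Main.v *)
(** For a fixed imaginary unit J, right multiplication by J makes V a complex
    Banach space on which T is complex linear, and (I^R s - T)^-1 for s in C_J is
    its ordinary resolvent. Pairing conjugate points of the contour shows that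
    f(T) does not depend on J. Cauchy's theorem between rays is obtained by
    differentiating the integral of F(r u) u over r in [x, y] with respect to the
    angle of u: the derivative is the boundary term i [r F(r u) u], which tends to
    0 as x -> 0 and y -> oo.

    Write e(T) = A + B with A and B the integrals over the boundaries of the right
    and the left sector; then (e 1_+)(T) = A and (e 1_-)(T) = B. All these
    operators commute, because bounded operators commute with the integrals and
    resolvents commute with each other. Moreover A B' = 0 for any two regularizers.
    This needs no Fubini theorem: R_l A v, with l on the left contour, equals the
    integral of (l - s)^-1 R_s v e(s), which is holomorphic in the left half-plane,
    so that integrating it over the boundary of the left sector gives 0. The
    equations e(T) P_+ = A and e(T) P_- = B with e(T) injective then give all the
    claims. *)
Require Import Defs.
From Stdlib Require Import Reals Lra Classical.
From Coquelicot Require Import Coquelicot.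
From mathcomp Require Import ssreflect.
Open Scope R_scope.

(** * Absolutely convergent integrals along rays *)

(** The angle [theta] and the regularizer behind [is_spectral_projector] are existential, so [P_+]
    and [P_-] come with unrelated data, and so does the bounded operator supplied by the bounded
    calculus. Independence of the regularizer and multiplicativity of the calculus are not
    established as such; instead commutation and orthogonality of the half integrals are proved for
    arbitrary pairs of regularizers, angles and contours, all transported to one fixed unit [J0].
    Injectivity of [e(T) = A + B] then means that a vector is determined by its images under [A] and
    [B], and each identity is checked on these images. That [P_+] and [P_-] are everywhere defined
    needs the same comparison, between their own regularizers and those of the bounded calculus. The
    analysis is reduced to real calculus: [V] stays a real space with a chosen complex structure,
    and Cauchy's theorem is proved after composition with real functionals, which separate points
    because inner products do. Holomorphy is always obtained from exact second-order expansions, so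
    that no integral with a vector parameter has to be differentiated. *)

Notation is_ray_int f l := (is_RInt_gen f (at_right 0) (Rbar_locally p_infty) l).

(* bump a r = r^a / (1 + r^a)^2 is comparable to r^a / (1 + r^(2a)), but
   bump a r / r has the explicit primitive - bump_prim a r / a. *)
Definition bump_prim (a r : R) : R := / (1 + Rpower r a).
Definition bump (a r : R) : R := bump_prim a r * (1 - bump_prim a r).

Lemma bump_prim_bounds a r : 0 < bump_prim a r < 1.
Proof.
have p : 0 < Rpower r a by apply: exp_pos.
split; first by apply: Rinv_0_lt_compat; lra.
rewrite -[X in _ < X]Rinv_1; apply: Rinv_lt_contravar; lra.
Qed.

Lemma bump_pos a r : 0 < bump a r.
Proof. have := bump_prim_bounds a r; rewrite /bump; nra. Qed.

Lemma bump_prim_derive a r : 0 < r ->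
  is_derive (bump_prim a) r (- (a * (/ r * bump a r))).
Proof.
move=> r0; rewrite /bump /bump_prim /Rpower.
have p := exp_pos (a * ln r).
by auto_derive; [lra | field; lra].
Qed.

Lemma bump_prim_lim0 a : 0 < a ->
  filterlim (bump_prim a) (at_right 0) (locally 1).
Proof.
move=> a0; rewrite -[1]Rinv_1 -[X in / X]Rplus_0_r.
have h : filterlim (fun r => 1 + Rpower r a) (at_right 0) (locally (1 + 0)).
  apply: (filterlim_comp_2 (G := locally 1) (H := locally 0)).
  - exact: filterlim_const.
  - apply: (filterlim_comp _ _ _ (fun r => a * ln r) exp _ (Rbar_locally m_infty)).
      apply: (filterlim_comp _ _ _ ln (Rmult a) _ _ _ is_lim_ln_0).
      have := filterlim_Rbar_mult_l a m_infty.
      rewrite /Rbar_mult /=; case: Rle_dec => [h|/Rnot_le_gt]; last lra.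
      by case: Rle_lt_or_eq_dec => //; lra.
    exact: is_lim_exp_m.
  - exact: filterlim_plus.
apply: (filterlim_comp _ _ _ _ Rinv _ _ _ h).
by apply: (filterlim_Rbar_inv (1 + 0)) => -[]; lra.
Qed.

Lemma bump_prim_lim_infty a : 0 < a ->
  filterlim (bump_prim a) (Rbar_locally p_infty) (locally 0).
Proof.
move=> a0.
have h : filterlim (fun r => 1 + Rpower r a) (Rbar_locally p_infty)
    (Rbar_locally p_infty).
  apply: (filterlim_comp_2 (G := locally 1) (H := Rbar_locally p_infty)).
  - exact: filterlim_const.
  - apply: (filterlim_comp _ _ _ (fun r => a * ln r) exp _ (Rbar_locally p_infty)).
      apply: (filterlim_comp _ _ _ ln (Rmult a) _ _ _ is_lim_ln_p).
      have := filterlim_Rbar_mult_l a p_infty.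
      rewrite /Rbar_mult /=; case: Rle_dec => [h|/Rnot_le_gt]; last lra.
      by case: Rle_lt_or_eq_dec => //; lra.
    exact: is_lim_exp_p.
  - exact: (filterlim_Rbar_plus 1 p_infty).
exact: (filterlim_comp _ _ _ _ Rinv _ _ _ h (filterlim_Rbar_inv p_infty _)).
Qed.

Lemma filter_ray : filter_prod (at_right 0) (Rbar_locally p_infty)
  (fun xy : R * R => 0 < fst xy < snd xy).
Proof.
apply: (Filter_prod _ _ _ (fun x => 0 < x < 1) (fun y => 1 < y)); last first.
- by move=> x y /= *; lra.
- by exists 1.
- have h1 : 0 < 1 by lra.
  by exists (mkposreal 1 h1) => y /=; rewrite /ball /= /AbsRing_ball /= /abs /minus /plus /opp /= => /Rabs_def2; lra.
Qed.

(** This neighbourhood serves twice: tails of dominated integrals are controlled by the oscillation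
    of [bump_prim], and [bump] is small wherever [bump_prim] is close to 0 or 1. *)
Lemma bump_prim_near a (d : posreal) : 0 < a ->
  filter_prod (at_right 0) (Rbar_locally p_infty) (fun xy : R * R =>
    ball 1 d (bump_prim a (fst xy)) /\ ball 0 d (bump_prim a (snd xy))).
Proof.
move=> a0.
have near0 : at_right 0 (fun x => ball 1 d (bump_prim a x)).
  exact: (proj1 (filterlim_locally _ _) (bump_prim_lim0 a a0)).
have nearoo : Rbar_locally p_infty (fun x => ball 0 d (bump_prim a x)).
  exact: (proj1 (filterlim_locally _ _) (bump_prim_lim_infty a a0)).
exact: (Filter_prod _ _ _ _ _ near0 nearoo (fun _ _ h1 h2 => conj h1 h2)).
Qed.

Lemma RInt_bump a x y : 0 < a -> 0 < x -> x <= y ->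
  is_RInt (fun r => / r * bump a r) x y (/ a * (bump_prim a x - bump_prim a y)).
Proof.
move=> a0 x0 xy.
have mi : Rmin x y = x by apply: Rmin_left.
have d z : Rmin x y <= z <= Rmax x y ->
    is_derive (fun r => - / a * bump_prim a r) z (/ z * bump a z).
  rewrite mi => -[xz _].
  have -> : / z * bump a z = - / a * - (a * (/ z * bump a z)) by field; lra.
  by apply: is_derive_scal; apply: bump_prim_derive; lra.
have -> : / a * (bump_prim a x - bump_prim a y)
  = minus (- / a * bump_prim a y) (- / a * bump_prim a x).
  by rewrite /minus /plus /opp /=; ring.
refine (is_RInt_derive _ _ _ _ d _) => z; rewrite mi => -[xz _].
apply: ex_derive_continuous; rewrite /bump; auto_derive.
have e : ex_derive (bump_prim a) z by eexists; apply: bump_prim_derive; lra.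
by repeat split => //; lra.
Qed.

Lemma is_ray_int_bump a : 0 < a -> is_ray_int (fun r => / r * bump a r) (/ a).
Proof.
move=> a0 P hP.
have lim : filterlim (fun xy : R * R => / a * (bump_prim a (fst xy) - bump_prim a (snd xy)))
    (filter_prod (at_right 0) (Rbar_locally p_infty)) (locally (/ a)).
  have {2}-> : / a = / a * (1 - 0) by ring.
  have h : filterlim (fun xy : R * R => bump_prim a (fst xy) - bump_prim a (snd xy))
      (filter_prod (at_right 0) (Rbar_locally p_infty)) (locally (1 - 0)).
    apply: (filterlim_comp_2 _ (fun xy => - bump_prim a (snd xy)) Rplus
      (G := locally 1) (H := locally (- 0))).
    - exact: (filterlim_comp _ _ _ _ _ _ _ _ filterlim_fst (bump_prim_lim0 a a0)).
    - apply: (filterlim_comp _ _ _ _ Ropp _ (locally 0)).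
        exact: (filterlim_comp _ _ _ _ _ _ _ _ filterlim_snd (bump_prim_lim_infty a a0)).
      exact: (filterlim_Rbar_opp 0).
    - exact: filterlim_plus.
  apply: (filterlim_comp _ _ _ _ (Rmult (/ a)) _ _ _ h).
  exact: (filterlim_Rbar_mult_l (/ a) (1 - 0)).
have h := lim P hP; rewrite /filtermap in h.
apply: filter_imp (filter_and _ _ filter_ray h) => -[x y] /= [[x0 xy] Pxy].
exists (/ a * (bump_prim a x - bump_prim a y)); split => //.
by have xy' := Rlt_le _ _ xy; exact: RInt_bump.
Qed.

Section Dominated.
Variable V : CompleteNormedModule R_AbsRing.
Variables (f : R -> V) (M a : R).
Hypothesis cont : forall r, 0 < r -> continuous f r.
Hypothesis a_gt0 : 0 < a.
Hypothesis dom : forall r, 0 < r -> norm (f r) <= M * (/ r * bump a r).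

Lemma dominated_ex_RInt x y : 0 < x -> 0 < y -> ex_RInt f x y.
Proof.
move=> x0 y0; apply: ex_RInt_continuous => z [hz _]; apply: cont.
by apply: Rlt_le_trans hz; apply: Rmin_pos.
Qed.

Lemma dominated_RInt x y : 0 < x -> x <= y ->
  norm (RInt f x y) <= M * (/ a * (bump_prim a x - bump_prim a y)).
Proof.
move=> x0 xy.
apply: (norm_RInt_le f (fun r => M * (/ r * bump a r)) x y) => //.
- by move=> z hz; apply: dom; lra.
- by apply: RInt_correct; apply: dominated_ex_RInt; lra.
- exact: (is_RInt_scal _ _ _ M _ (RInt_bump a x y a_gt0 x0 xy)).
Qed.

(** In the Cauchy criterion the endpoints of two truncations come in either order, hence the
    absolute value. *)
Lemma dominated_RInt_sym x y : 0 < x -> 0 < y ->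
  norm (RInt f x y) <= M * (/ a * Rabs (bump_prim a x - bump_prim a y)).
Proof.
move=> x0 y0.
(* The sign of [M] is read off the domination at [r = 1], where [bump] is positive. *)
have M0 : 0 <= M.
  have := bump_pos a 1; have := dom 1 Rlt_0_1; have := norm_ge_0 (f 1).
  by rewrite Rinv_1 => *; nra.
have ai : 0 < / a by apply: Rinv_0_lt_compat.
have le u v : 0 < u -> u <= v ->
    norm (RInt f u v) <= M * (/ a * Rabs (bump_prim a u - bump_prim a v)).
  move=> u0 uv; apply: Rle_trans (dominated_RInt u v u0 uv) _.
  apply: Rmult_le_compat_l => //; apply: Rmult_le_compat_l; first lra.
  exact: Rle_abs.
case: (Rle_lt_dec x y) => [xy|yx]; first exact: le.
rewrite -opp_RInt_swap; last exact: dominated_ex_RInt.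
by rewrite norm_opp -Rabs_Ropp Ropp_minus_distr; apply: le; lra.
Qed.

(** Two truncations differ by the integrals over two end pieces. Each is at most [M / a] times the
    oscillation of [bump_prim] there, which is small because [bump_prim] has limits at both ends. *)
Lemma dominated_is_ray_int : exists l, is_ray_int f l.
Proof.
pose F := filter_prod (at_right 0) (Rbar_locally p_infty).
have PF : ProperFilter F by apply: filter_prod_proper.
suff [l hl] : exists l : V, filterlim (fun xy => RInt f (fst xy) (snd xy)) F (locally l).
  exists l => P hP; have h := hl P hP; rewrite /filtermap in h.
  apply: filter_imp (filter_and _ _ filter_ray h) => -[x y] /= [[x0 xy] Pxy].
  exists (RInt f x y); split => //; apply: RInt_correct.
  by apply: dominated_ex_RInt; lra.
apply/filterlim_locally_cauchy => eps.
have M0 : 0 <= M.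
  have := bump_pos a 1; have := dom 1 Rlt_0_1; have := norm_ge_0 (f 1).
  by rewrite Rinv_1 => *; nra.
have ai : 0 < / a by apply: Rinv_0_lt_compat.
(* The summand 1 keeps [K] positive if [M = 0]; with [d = eps / (4 * K)] each end piece costs at
   most [M / a * (2 * d)]. *)
pose K := M * / a + 1.
have K0 : 0 < K by rewrite /K; nra.
have d0 : 0 < eps / (4 * K) by apply: Rdiv_lt_0_compat; [apply: cond_pos | lra].
pose d := mkposreal _ d0.
exists (fun xy => 0 < fst xy < snd xy /\
  (ball 1 d (bump_prim a (fst xy)) /\ ball 0 d (bump_prim a (snd xy)))); split.
  by apply: filter_and; [exact: filter_ray | exact: bump_prim_near].
move=> [x y] [x' y'] /=.
rewrite /ball /= /AbsRing_ball /= /abs /minus /plus /opp /=.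
move=> [[x0 xy] [/Rabs_def2 bx /Rabs_def2 by_]].
move=> [[x'0 xy'] [/Rabs_def2 bx' /Rabs_def2 by_']].
apply: norm_compat1.
have y0 : 0 < y by lra. have y'0 : 0 < y' by lra.
have e1 := RInt_Chasles f x' x y' (dominated_ex_RInt _ _ x'0 x0) (dominated_ex_RInt _ _ x0 y'0).
have e2 := RInt_Chasles f x y y' (dominated_ex_RInt _ _ x0 y0) (dominated_ex_RInt _ _ y0 y'0).
have -> : minus (RInt f x' y') (RInt f x y) = plus (RInt f x' x) (RInt f y y').
  rewrite -e1 -e2 /minus (plus_comm (RInt f x y)) -!plus_assoc plus_opp_r plus_zero_r.
  by [].
apply: Rle_lt_trans (norm_triangle _ _) _.
have b1 := dominated_RInt_sym x' x x'0 x0.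
have b2 := dominated_RInt_sym y y' y0 y'0.
have a1 : Rabs (bump_prim a x' - bump_prim a x) <= 2 * d by apply: Rabs_le; simpl in *; lra.
have a2 : Rabs (bump_prim a y - bump_prim a y') <= 2 * d by apply: Rabs_le; simpl in *; lra.
have a1' := Rabs_pos (bump_prim a x' - bump_prim a x).
have a2' := Rabs_pos (bump_prim a y - bump_prim a y').
have Kd : K * (4 * d) = eps by rewrite /=; field; lra.
have dp : 0 < d by [].
have Ma : 0 <= M * / a by nra.
rewrite -Rmult_assoc in b1; rewrite -Rmult_assoc in b2.
have b1' : M * / a * Rabs (bump_prim a x' - bump_prim a x) <= M * / a * (2 * d).
  exact: Rmult_le_compat_l.
have b2' : M * / a * Rabs (bump_prim a y - bump_prim a y') <= M * / a * (2 * d).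
  exact: Rmult_le_compat_l.
rewrite -Kd /K; lra.
Qed.

Lemma dominated_ray_int_norm l : is_ray_int f l -> norm l <= M * / a.
Proof.
move=> hl; apply: (RInt_gen_norm (Fa := at_right 0) (Fb := Rbar_locally p_infty) f
  (fun r => M * (/ r * bump a r)) l (M * / a)) => //.
- by apply: filter_imp filter_ray => xy; lra.
- by apply: filter_imp filter_ray => xy h x hx; apply: dom; lra.
- exact: (is_RInt_gen_scal _ M _ (is_ray_int_bump a a_gt0)).
Qed.

End Dominated.

Section LinearMap.
Variables U V : NormedModule R_AbsRing.

Lemma Riemann_sum_linear (L : U -> V) (f : R -> U) ptd : is_linear L ->
  Riemann_sum (fun r => L (f r)) ptd = L (Riemann_sum f ptd).
Proof.
move=> hL; move: ptd; apply: SF_cons_ind => [x0|h0 ptd IH].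
  by rewrite /Riemann_sum /= linear_zero.
by rewrite !Riemann_sum_cons IH (linear_plus _ hL) (linear_scal _ hL).
Qed.

Lemma is_RInt_linear (L : U -> V) (f : R -> U) x y l : is_linear L ->
  is_RInt f x y l -> is_RInt (fun r => L (f r)) x y (L l).
Proof.
move=> hL hf; rewrite /is_RInt.
apply: (filterlim_ext (fun ptd => L (scal (sign (y - x)) (Riemann_sum f ptd)))).
  by move=> ptd; rewrite Riemann_sum_linear // (linear_scal _ hL).
exact: (filterlim_comp _ _ _ _ _ _ _ _ hf (linear_cont L l hL)).
Qed.

Lemma is_ray_int_linear (L : U -> V) (f : R -> U) l : is_linear L ->
  is_ray_int f l -> is_ray_int (fun r => L (f r)) (L l).
Proof.
move=> hL hf P hP; have h := hf _ (linear_cont L l hL P hP); rewrite /filtermapi in h *.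
refine (filter_imp _ _ _ h) => -[x y] /= [v [hv Pv]]; exists (L v); split => //.
exact: is_RInt_linear.
Qed.

Lemma is_ray_int_ext (f g : R -> U) l : (forall r, 0 < r -> f r = g r) ->
  is_ray_int f l -> is_ray_int g l.
Proof.
move=> fg; move=> h; refine (is_RInt_gen_ext _ _ _ _ h).
apply: filter_imp filter_ray => -[x y] /= [x0 xy] z [hz _]; apply: fg.
by apply: Rlt_trans hz; apply: Rmin_pos; lra.
Qed.

Lemma is_ray_int_plus (f g : R -> U) l m : is_ray_int f l -> is_ray_int g m ->
  is_ray_int (fun r => plus (f r) (g r)) (plus l m).
Proof. exact: is_RInt_gen_plus. Qed.

Lemma is_ray_int_minus (f g : R -> U) l m : is_ray_int f l -> is_ray_int g m ->
  is_ray_int (fun r => minus (f r) (g r)) (minus l m).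
Proof. exact: is_RInt_gen_minus. Qed.

End LinearMap.

Lemma RInt_gen_ray (V : CompleteNormedModule R_AbsRing) (f : R -> V) l :
  is_ray_int f l -> RInt_gen f (at_right 0) (Rbar_locally p_infty) = l.
Proof. by move=> h; apply: (is_RInt_gen_unique f l h). Qed.

Lemma is_ray_int_unique (V : CompleteNormedModule R_AbsRing) (f : R -> V) l m :
  is_ray_int f l -> is_ray_int f m -> l = m.
Proof. by move=> /RInt_gen_ray <- /RInt_gen_ray. Qed.

(** * Complex structures and complex derivatives *)

Lemma plusACA (G : AbelianMonoid) (a b c d : G) :
  plus (plus a b) (plus c d) = plus (plus a c) (plus b d).
Proof. by rewrite -!plus_assoc (plus_assoc b) (plus_comm b) -plus_assoc. Qed.

(** Integrals and derivatives remain those of the real space; the imaginary unit is just an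
    operator. The structure is an explicit argument because the same [V] carries one for each
    imaginary unit of the Clifford algebra. *)
Record complex_structure (V : CompleteNormedModule R_AbsRing) := ComplexStructure {
  jay : V -> V;
  jayD : forall v w, jay (plus v w) = plus (jay v) (jay w);
  jayZ : forall (a : R) v, jay (scal a v) = scal a (jay v);
  jayK : forall v, jay (jay v) = opp v;
  jay_norm : forall (z : C) v,
    norm (plus (scal (fst z) v) (scal (snd z) (jay v))) = Cmod z * norm v
}.
Arguments jay {V} c v.

Section ComplexModule.
Variables (V : CompleteNormedModule R_AbsRing) (S : complex_structure V).
Implicit Types (v w : V) (z c : C).

Definition cact z v : V := plus (scal (fst z) v) (scal (snd z) (jay S v)).

Lemma norm_cact z v : norm (cact z v) = Cmod z * norm v.
Proof. exact: jay_norm. Qed.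

Lemma cactDr z v w : cact z (plus v w) = plus (cact z v) (cact z w).
Proof.
by rewrite /cact jayD !scal_distr_l plusACA.
Qed.

Lemma cactDl z c v : cact (z + c)%C v = plus (cact z v) (cact c v).
Proof.
by rewrite /cact /= !scal_distr_r plusACA.
Qed.

Lemma cact_real (a : R) v : cact (RtoC a) v = scal a v.
Proof. by rewrite /cact /= scal_zero_l plus_zero_r. Qed.

Lemma cactM z c v : cact (z * c)%C v = cact z (cact c v).
Proof.
rewrite /cact /= !(jayD, jayZ, jayK, scal_distr_l, scal_assoc, scal_opp_r).
rewrite -scal_opp_l /mult /= /opp /=.
have -> : fst z * fst c - snd z * snd c = fst z * fst c + (- (snd z * snd c)) by [].
rewrite !scal_distr_r -!plus_assoc; congr plus.
rewrite plus_comm -!plus_assoc; congr plus.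
Qed.

Lemma cact1 v : cact 1 v = v.
Proof. by rewrite cact_real scal_one. Qed.

Lemma cact0 v : cact 0 v = zero.
Proof. by rewrite cact_real scal_zero_l. Qed.

Lemma cact_opp z v : cact (- z)%C v = opp (cact z v).
Proof.
apply: (plus_reg_l (cact z v)); rewrite plus_opp_r -cactDl.
have -> : (z + - z = 0)%C by ring.
by rewrite cact0.
Qed.

Lemma is_linear_cact z : is_linear (cact z).
Proof.
split; first exact: cactDr.
  by move=> a v; rewrite -!cact_real -!cactM; congr cact; ring.
exists (Cmod z + 1); split; first by have := Cmod_ge_0 z; lra.
by move=> v; rewrite norm_cact; have := norm_ge_0 v; nra.
Qed.

Inductive vexpr := VZero | VAtom of nat | VPlus of vexpr & vexpr
  | VOpp of vexpr | VAct of C & vexpr.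

Fixpoint vcoef e i : C := match e with
  | VZero => 0
  | VAtom k => if Nat.eqb k i then 1 else 0
  | VPlus a b => vcoef a i + vcoef b i
  | VOpp a => - vcoef a i
  | VAct c a => c * vcoef a i
  end.

Fixpoint veval (l : list V) e : V := match e with
  | VZero => zero
  | VAtom k => List.nth k l zero
  | VPlus a b => plus (veval l a) (veval l b)
  | VOpp a => opp (veval l a)
  | VAct c a => cact c (veval l a)
  end.

Fixpoint lincomb (l : list V) (f : nat -> C) : V :=
  if l is cons v l' then plus (cact (f O) v) (lincomb l' (fun i => f (Datatypes.S i)))
  else zero.

Lemma lincombD l f g :
  lincomb l (fun i => f i + g i)%C = plus (lincomb l f) (lincomb l g).
Proof.
elim: l f g => [|v l IH] f g /=; first by rewrite plus_zero_l.
by rewrite IH cactDl plusACA.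
Qed.

Lemma lincombZ l c f : lincomb l (fun i => c * f i)%C = cact c (lincomb l f).
Proof.
elim: l f => [|v l IH] f /=; last by rewrite IH cactM cactDr.
by rewrite (linear_zero _ (is_linear_cact c)).
Qed.

Lemma lincomb_ext l f g : (forall i, f i = g i) -> lincomb l f = lincomb l g.
Proof. by elim: l f g => //= v l IH f g fg; rewrite fg; congr plus; apply: IH. Qed.

Lemma lincomb0 l : lincomb l (fun _ => 0%C) = zero.
Proof. by elim: l => //= v l ->; rewrite cact0 plus_zero_l. Qed.

Lemma veval_lincomb l e : veval l e = lincomb l (vcoef e).
Proof.
elim: e => [|k|a IHa b IHb|a IHa|c a IHa] /=; rewrite ?IHa ?IHb; last 1 first.
- by rewrite lincombZ.
- by rewrite lincomb0.
- elim: l k => [|v l IH] [|k] //=; first by rewrite cact1 lincomb0 plus_zero_r.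
  by rewrite cact0 plus_zero_l.
- by rewrite lincombD.
- rewrite -[in LHS](cact1 (lincomb l _)) -cact_opp -lincombZ; apply: lincomb_ext => i; ring.
Qed.

Fixpoint coef_eq n (f g : nat -> C) : Prop :=
  if n is Datatypes.S m then f O = g O /\
    coef_eq m (fun i => f (Datatypes.S i)) (fun i => g (Datatypes.S i))
  else True.

Lemma veval_eq l a b : coef_eq (length l) (vcoef a) (vcoef b) ->
  veval l a = veval l b.
Proof.
rewrite !veval_lincomb; elim: l (vcoef a) (vcoef b) => //= v l IH f g [-> h].
by rewrite (IH _ _ h).
Qed.

End ComplexModule.
Arguments cact {V} S z v.
Arguments is_linear_cact {V} S z.
Arguments norm_cact {V} S z v.

Ltac vlookup v l :=
  lazymatch l with
  | cons v _ => constr:(O)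
  | cons _ ?l' => let k := vlookup v l' in constr:(Datatypes.S k)
  end.
Ltac vinsert v l :=
  lazymatch l with
  | context [cons v _] => l
  | _ => constr:(cons v l)
  end.
Ltac vatoms e l :=
  lazymatch e with
  | plus ?a ?b => let l' := vatoms a l in vatoms b l'
  | minus ?a ?b => let l' := vatoms a l in vatoms b l'
  | opp ?a => vatoms a l
  | zero => l
  | cact _ _ ?a => vatoms a l
  | _ => vinsert e l
  end.
Ltac vreify e l :=
  lazymatch e with
  | plus ?a ?b => let x := vreify a l in let y := vreify b l in constr:(VPlus x y)
  | minus ?a ?b => let x := vreify a l in let y := vreify b l in constr:(VPlus x (VOpp y))
  | opp ?a => let x := vreify a l in constr:(VOpp x)
  | zero => constr:(VZero)
  | cact _ ?c ?a => let x := vreify a l in constr:(VAct c x)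
  | _ => let k := vlookup e l in constr:(VAtom k)
  end.
(* Reduces an equation between linear combinations of vectors to the equations
   between their complex coefficients. *)
Ltac vector_eq S :=
  rewrite -?(cact_real _ S);
  lazymatch goal with
  | |- @eq ?T ?a ?b =>
    let nl := constr:(@nil T) in
    let l0 := vatoms a nl in
    let l := vatoms b l0 in
    let x := vreify a l in
    let y := vreify b l in
    let h := fresh in
    assert (h := veval_eq _ S l x y);
    cbv [veval List.nth] in h;
    unfold minus; refine (h _); clear h;
    cbv [length coef_eq vcoef Nat.eqb]; repeat split
  end.
Ltac vring S := vector_eq S; try ring.

Lemma continuous_pair (T U W : UniformSpace) (f : T -> U) (g : T -> W) x :
  continuous f x -> continuous g x -> continuous (fun t => (f t, g t)) x.
Proof.
move=> c1 c2; apply/filterlim_locally => eps.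
apply: filter_imp (filter_and _ _ (proj1 (filterlim_locally _ _) c1 eps)
  (proj1 (filterlim_locally _ _) c2 eps)) => y [b1 b2].
by split.
Qed.

Lemma Cmod_ball (z : C) (d : R) : 0 < d ->
  locally (T := C_UniformSpace) z (fun z' : C => Cmod (z' - z) < d).
Proof.
(* The uniform structure of [C] is that of the maximum norm, and [Cmod] is at most [sqrt 2 < 2]
   times that norm. *)
move=> d0; have e0 : 0 < d / 2 by lra.
exists (mkposreal _ e0) => z' [] /=.
rewrite /ball /= /AbsRing_ball /= /abs /minus /plus /opp /= => h1 h2.
apply: Rle_lt_trans (Cmod_2Rmax _) _ => /=.
have s2 : sqrt 2 < 2.
  by rewrite -{2}(sqrt_Rsqr 2); [apply: sqrt_lt_1; rewrite /Rsqr; lra | lra].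
have s0 := sqrt_pos 2.
have := Rmax_lub_lt _ _ _ h1 h2; rewrite /Rminus.
have := Rle_trans _ _ _ (Rabs_pos (fst z' + - fst z)) (Rmax_l _ (Rabs (snd z' + - snd z))).
by nra.
Qed.

Lemma lipschitz_continuous (W : NormedModule R_AbsRing) (Y : C -> W) (z : C) : (exists K d, 0 < d /\ forall z', Cmod (z' - z) < d ->
    norm (minus (Y z') (Y z)) <= K * Cmod (z' - z)) -> continuous Y z.
Proof.
move=> [K [d [d0 h]]]; apply/filterlim_locally => eps.
(* [K] carries no sign, so [Rabs K + 1] serves as a positive bound. *)
have K1 : 0 < Rabs K + 1 by have := Rabs_pos K; lra.
have e0 : 0 < Rmin d (eps / (Rabs K + 1)).
  by apply: Rmin_pos => //; apply: Rdiv_lt_0_compat => //; apply: cond_pos.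
apply: filter_imp (Cmod_ball z _ e0) => z' hz'.
have hd := Rlt_le_trans _ _ _ hz' (Rmin_l _ _).
have he := Rlt_le_trans _ _ _ hz' (Rmin_r _ _).
apply: norm_compat1; apply: Rle_lt_trans (h z' hd) _.
have c0 := Cmod_ge_0 (z' - z).
have := Rle_abs K; set m := Cmod _ in he c0 *; move=> hK.
have : (Rabs K + 1) * m < eps.
  have := Rmult_lt_compat_l _ _ _ K1 he.
  by have -> : (Rabs K + 1) * (eps / (Rabs K + 1)) = eps by field; lra.
by nra.
Qed.

(** * Differentiability of vector-valued functions of a complex variable *)

Section Holomorphy.
Variables (V : CompleteNormedModule R_AbsRing) (S : complex_structure V).
Implicit Types (Y : C -> V) (z c : C).

Lemma continuous_cact (T : UniformSpace) (h : T -> C) (f : T -> V) x :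
  continuous h x -> continuous f x -> continuous (fun t => cact S (h t) (f t)) x.
Proof.
move=> hh hf; apply: (continuous_plus (V := V)).
  by apply: continuous_scal => //; apply: (continuous_comp h fst) => //; apply: continuous_fst.
apply: continuous_scal.
  by apply: (continuous_comp h snd) => //; apply: continuous_snd.
apply: (continuous_comp f (jay S)) => //.
have L : is_linear (jay S).
  apply: (is_linear_ext (cact S Ci)); last exact: is_linear_cact.
  by move=> v; rewrite /cact /= scal_zero_l plus_zero_l scal_one.
exact: (linear_cont (jay S) (f x) L).
Qed.

(** Real Fréchet differentiability whose differential is a complex multiple of [l]; this form
    encodes the Cauchy-Riemann equations. *)
Definition cdiff Y z (l : V) : Prop :=
  filterdiff (U := C_R_NormedModule) Y (locally z) (fun dz : C => cact S dz l).

Lemma is_linear_cact_l (l : V) : is_linear (U := C_R_NormedModule) (fun dz : C => cact S dz l).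
Proof.
split; first by move=> x y; rewrite -cactDl.
  move=> a x; rewrite -(cact_real _ S) -cactM; congr cact.
  by rewrite /scal /= /prod_scal /Cmult /= /scal /= /mult /=; congr pair; ring.
exists (norm l + 1); split; first by have := norm_ge_0 l; lra.
move=> x; rewrite norm_cact Cmod_norm.
by rewrite Rmult_comm; apply: Rmult_le_compat_r; [apply: norm_ge_0 | lra].
Qed.

Lemma quadratic_cdiff Y z l : (exists K d, 0 < d /\ forall z', Cmod (z' - z) < d ->
    norm (minus (minus (Y z') (Y z)) (cact S (z' - z)%C l)) <= K * Cmod (z' - z) ^ 2) ->
  cdiff Y z l.
Proof.
move=> [K [d [d0 h]]]; split; first exact: is_linear_cact_l.
move=> x /is_filter_lim_locally_unique <- eps.
have K1 : 0 < Rabs K + 1 by have := Rabs_pos K; lra.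
have e0 : 0 < Rmin d (eps / (Rabs K + 1)).
  by apply: Rmin_pos => //; apply: Rdiv_lt_0_compat => //; apply: cond_pos.
apply: filter_imp (Cmod_ball z _ e0) => z' hz'.
have hd := Rlt_le_trans _ _ _ hz' (Rmin_l _ _).
have he := Rlt_le_trans _ _ _ hz' (Rmin_r _ _).
apply: Rle_trans (h z' hd) _; rewrite -Cmod_norm.
have c0 := Cmod_ge_0 (z' - z).
have := Rle_abs K; set m := Cmod _ in he c0 *; move=> hK.
have : (Rabs K + 1) * m <= eps.
  have := Rmult_le_compat_l _ _ _ (Rlt_le _ _ K1) (Rlt_le _ _ he).
  by have -> : (Rabs K + 1) * (eps / (Rabs K + 1)) = eps by field; lra.
move=> hm.
by nra.
Qed.

(* A locally uniform quadratic Taylor estimate makes the derivative locally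
   Lipschitz, because the roles of the two points can be exchanged. *)
Definition qdiff Y (Y' : C -> V) z : Prop :=
  exists K d, 0 < d /\ forall z1 z2, Cmod (z1 - z) < d -> Cmod (z2 - z) < d ->
    norm (minus (minus (Y z2) (Y z1)) (cact S (z2 - z1)%C (Y' z1)))
      <= K * Cmod (z2 - z1) ^ 2.

Lemma Cmod_subxx z : Cmod (z - z) = 0.
Proof. by rewrite -Cmod_0; congr Cmod; ring. Qed.

Lemma qdiff_cdiff Y Y' z : qdiff Y Y' z -> cdiff Y z (Y' z).
Proof.
move=> [K [d [d0 h]]]; apply: quadratic_cdiff; exists K, d; split => // z' hz'.
by apply: h => //; rewrite Cmod_subxx.
Qed.

Lemma qdiff_continuous Y Y' z : qdiff Y Y' z -> continuous Y' z.
Proof.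
move=> [K [d [d0 h]]]; apply: lipschitz_continuous.
exists (2 * K), d; split => // z' hz'.
suff G : norm (minus (Y' z') (Y' z)) <= 2 * K * Cmod (z' - z) by exact: G.
have zz : Cmod (z - z) < d by rewrite Cmod_subxx.
have h1 := h z z' zz hz'; have h2 := h z' z hz' zz.
have e : Cmod (z - z') = Cmod (z' - z).
  by rewrite -Cmod_opp; congr Cmod; ring.
rewrite e in h2.
case: (Req_dec (Cmod (z' - z)) 0) => [m0|mn0].
  have ez : z' = z.
    by transitivity ((z' - z) + z)%C; [ring | rewrite (Cmod_eq_0 _ m0); ring].
  by rewrite ez /minus plus_opp_r norm_zero Cmod_subxx; lra.
have mp : 0 < Cmod (z' - z) by have := Cmod_ge_0 (z' - z); lra.
(* Adding the estimates from [z] to [z'] and from [z'] to [z] cancels the values of [Y]. What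
   remains is [z' - z] acting on the difference of the derivatives, and one factor [Cmod (z' - z)]
   is divided out. *)
have := norm_triangle (minus (minus (Y z') (Y z)) (cact S (z' - z)%C (Y' z)))
  (minus (minus (Y z) (Y z')) (cact S (z - z')%C (Y' z'))).
have -> : plus (minus (minus (Y z') (Y z)) (cact S (z' - z)%C (Y' z)))
  (minus (minus (Y z) (Y z')) (cact S (z - z')%C (Y' z'))) =
  cact S (z' - z)%C (minus (Y' z') (Y' z)).
  by vring S.
rewrite norm_cact => h3.
apply: (Rmult_le_reg_l _ _ _ mp); nra.
Qed.

Lemma cdiff_continuous Y z l : cdiff Y z l -> continuous Y z.
Proof.
move=> h; apply: (filterdiff_continuous (U := C_R_NormedModule)).
by exists (fun dz : C => cact S dz l).
Qed.

Lemma cdiff_path Y (x y : R -> R) t x' y' l : cdiff Y (x t, y t) l ->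
  is_derive x t x' -> is_derive y t y' ->
  is_derive (fun t => Y (x t, y t)) t (cact S (x', y') l).
Proof.
move=> hY hx hy; rewrite /is_derive.
have h := filterdiff_comp'_2 x y (fun a b => Y (a, b)) t _ _
  (fun a b => cact S (a, b) l) hx hy.
apply: (filterdiff_ext_lin _ (fun s : R => cact S (scal s x', scal s y') l)); last first.
  move=> s; rewrite -(cact_real _ S) -cactM; congr cact.
  by rewrite /Cmult /= /scal /= /mult /=; congr pair; ring.
apply: h; apply: (filterdiff_ext (U := C_R_NormedModule) Y).
  by case.
by apply: (filterdiff_ext_lin _ _ _ hY); case.
Qed.

(** Scalar analogue of [cdiff], split into real and imaginary parts so that the product rule for
    real scalars applies in [cdiff_mul]. *)
Definition hdiff (h : C -> C) z (l : C) : Prop :=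
  filterdiff (U := C_R_NormedModule) (fun z => fst (h z)) (locally z) (fun dz : C => fst (dz * l)%C)
  /\ filterdiff (U := C_R_NormedModule) (fun z => snd (h z)) (locally z) (fun dz : C => snd (dz * l)%C).

Lemma cdiff_mul (h : C -> C) Y z h' l : hdiff h z h' -> cdiff Y z l ->
  cdiff (fun z => cact S (h z) (Y z)) z (plus (cact S h' (Y z)) (cact S (h z) l)).
Proof.
move=> [h1 h2] hY.
have jL : is_linear (jay S).
  apply: (is_linear_ext (cact S Ci)); last exact: is_linear_cact.
  by move=> v; rewrite /cact /= scal_zero_l plus_zero_l scal_one.
have hjY : filterdiff (U := C_R_NormedModule) (fun z => jay S (Y z)) (locally z)
    (fun dz : C => jay S (cact S dz l)).
  exact: (filterdiff_comp' (U := C_R_NormedModule) Y (jay S) z _ _ hY (filterdiff_linear _ jL)).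
have k1 := filterdiff_scal_fct (U := C_R_NormedModule) z _ Y _ _ Rmult_comm h1 hY.
have k2 := filterdiff_scal_fct (U := C_R_NormedModule) z _ _ _ _ Rmult_comm h2 hjY.
have k := filterdiff_plus_fct _ _ _ _ k1 k2.
refine (filterdiff_ext_lin (U := C_R_NormedModule) _ _ _ (k (filter_filter (T := C_UniformSpace))) _) => dz.
have jE v : jay S v = cact S Ci v by rewrite /cact /= scal_zero_l plus_zero_l scal_one.
by rewrite !jE; vector_eq S; rewrite /Cmult /Cplus /RtoC /Ci /=; congr pair; ring.
Qed.

Lemma hdiff_continuous h z l : hdiff h z l -> continuous h z.
Proof.
move=> [h1 h2].
have c1 : continuous (T := C_UniformSpace) (U := R_UniformSpace) (fun z => fst (h z)) z.
  by apply: (filterdiff_continuous (U := C_R_NormedModule)); eexists; exact: h1.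
have c2 : continuous (T := C_UniformSpace) (U := R_UniformSpace) (fun z => snd (h z)) z.
  by apply: (filterdiff_continuous (U := C_R_NormedModule)); eexists; exact: h2.
have c3 := continuous_pair C_UniformSpace R_UniformSpace R_UniformSpace _ _ _ c1 c2.
apply: (continuous_ext _ _ _ _ c3) => x; by case: (h x).
Qed.
End Holomorphy.

(** * Cauchy's theorem between two rays *)

(** The sign [e] is 1 or -1: [dir (-1) psi] is opposite to [dir 1 psi], so the left sector is
    parametrized by the same angles around 0 as the right one. *)
Definition dir (e psi : R) : C := (e * cos psi, e * sin psi).

Lemma dir_scale e psi r : (RtoC r * dir e psi)%C = (r * (e * cos psi), r * (e * sin psi)).
Proof. by rewrite /Cmult /dir /RtoC /=; congr pair; ring. Qed.

Lemma continuous_scale_dir e psi r : continuous (fun t => (RtoC t * dir e psi)%C) r.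
Proof.
apply: (continuous_ext (fun t => (t * (e * cos psi), t * (e * sin psi)) : C)).
  by move=> t; rewrite dir_scale.
by apply: continuous_pair; apply: (continuous_mult (K := R_AbsRing));
  [apply: continuous_id | apply: continuous_const | apply: continuous_id | apply: continuous_const].
Qed.

Section Cauchy.
Variables (V : CompleteNormedModule R_AbsRing) (S : complex_structure V).
Hypothesis separating :
  forall v : V, (forall l : V -> R, is_linear l -> l v = 0) -> v = zero.
Variables (G G' : C -> V) (e p1 p2 M a : R).
Hypothesis G_diff : forall r psi, 0 < r -> p1 < psi < p2 ->
  cdiff V S G (RtoC r * dir e psi)%C (G' (RtoC r * dir e psi)%C).
Hypothesis G'_cont : forall r psi, 0 < r -> p1 < psi < p2 ->
  continuous G' (RtoC r * dir e psi)%C.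
Hypothesis a_gt0 : 0 < a.
Hypothesis G_bound : forall r psi, 0 < r -> p1 < psi < p2 ->
  norm (G (RtoC r * dir e psi)%C) <= M * bump a r.

Section Functional.
Variable l : V -> R.
Hypothesis l_lin : is_linear l.

(** [A] is the integrand on the ray of angle [psi] and [B] the boundary term. [D] is both the
    angular derivative of [A] and the radial derivative of [B]: the Cauchy-Riemann equation in polar
    coordinates. The functional [l] makes them real functions, to which differentiation under the
    integral and the mean value theorem apply. *)
Let A psi r : R := / r * l (G (RtoC r * dir e psi)%C).
Let B psi r : R := l (cact S Ci (G (RtoC r * dir e psi)%C)).
Let D psi r : R := l (cact S (Ci * dir e psi)%C (G' (RtoC r * dir e psi)%C)).

Lemma is_derive_functional (f : R -> V) x f' :
  is_derive f x f' -> is_derive (fun t => l (f t)) x (l f').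
Proof.
move=> h; have k := filterdiff_comp' f l x _ _ h (filterdiff_linear l l_lin).
apply: (filterdiff_ext_lin _ _ _ k) => y.
by rewrite (linear_scal l l_lin).
Qed.

Lemma derive_angle psi r : 0 < r -> p1 < psi < p2 ->
  is_derive (fun t => A t r) psi (D psi r).
Proof.
move=> r0 hp; have h := G_diff r psi r0 hp; rewrite !dir_scale in h.
have dx : is_derive (fun t => r * (e * cos t)) psi (- (r * (e * sin psi))).
  by auto_derive => //; ring.
have dy : is_derive (fun t => r * (e * sin t)) psi (r * (e * cos psi)).
  by auto_derive => //; ring.
have d := is_derive_scal _ _ (/ r) _ (is_derive_functional _ _ _ (cdiff_path V S _ _ _ _ _ _ _ h dx dy)).
have -> : D psi r = / r * l (cact S (- (r * (e * sin psi)), r * (e * cos psi)) (G' (r * (e * cos psi), r * (e * sin psi)))).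
  rewrite /D dir_scale.
  rewrite -[RHS](linear_scal l l_lin (/ r)); congr l.
  rewrite -(cact_real _ S) -cactM; congr cact.
  by rewrite /Cmult /dir /RtoC /Ci /=; congr pair; field; lra.
by apply: (is_derive_ext _ _ _ _ _ d) => t; rewrite /A dir_scale.
Qed.

Lemma derive_radius psi r : 0 < r -> p1 < psi < p2 ->
  is_derive (fun t => B psi t) r (D psi r).
Proof.
move=> r0 hp; have h := G_diff r psi r0 hp; rewrite !dir_scale in h.
have dx : is_derive (fun t => t * (e * cos psi)) r (e * cos psi).
  by auto_derive => //; ring.
have dy : is_derive (fun t => t * (e * sin psi)) r (e * sin psi).
  by auto_derive => //; ring.
have d0 := cdiff_path V S _ _ _ _ _ _ _ h dx dy.
have d1 : is_derive (fun t => cact S Ci (G (t * (e * cos psi), t * (e * sin psi)))) r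
    (cact S Ci (cact S (e * cos psi, e * sin psi) (G' (r * (e * cos psi), r * (e * sin psi))))).
  have k := filterdiff_comp' _ (cact S Ci) r _ _ d0 (filterdiff_linear _ (is_linear_cact S Ci)).
  apply: (filterdiff_ext_lin _ _ _ k) => y.
  by rewrite (linear_scal _ (is_linear_cact S Ci)).
have d := is_derive_functional _ _ _ d1.
rewrite /D cactM dir_scale.
by apply: (is_derive_ext _ _ _ _ _ d) => t; rewrite /B dir_scale.
Qed.

Lemma cont_D psi r : 0 < r -> p1 < psi < p2 ->
  continuous (fun z : R * R => D (fst z) (snd z)) (psi, r).
Proof.
move=> r0 hp; rewrite /D.
have cf : continuous (fun z : R * R => fst z) (psi, r) by apply: continuous_fst.
have cs : continuous (fun z : R * R => snd z) (psi, r) by apply: continuous_snd.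
have ccos : continuous (fun z : R * R => e * cos (fst z)) (psi, r).
  apply: (continuous_mult (K := R_AbsRing)); first exact: continuous_const.
  by apply: (continuous_comp fst cos) => //; apply: continuous_cos.
have csin : continuous (fun z : R * R => e * sin (fst z)) (psi, r).
  apply: (continuous_mult (K := R_AbsRing)); first exact: continuous_const.
  by apply: (continuous_comp fst sin) => //; apply: continuous_sin.
apply: (continuous_comp _ l); last exact: linear_cont.
apply: continuous_cact.
  apply: (continuous_ext (fun z : R * R => (- (e * sin (fst z)), e * cos (fst z)))).
    by move=> z; rewrite /Cmult /dir /Ci /=; congr pair; ring.
  by apply: continuous_pair => //; apply: (continuous_opp (V := R_NormedModule)).
apply: (continuous_ext (fun z : R * R => G' (snd z * (e * cos (fst z)), snd z * (e * sin (fst z))))).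
  by move=> z; rewrite dir_scale.
apply: (continuous_comp (fun z : R * R => (snd z * (e * cos (fst z)), snd z * (e * sin (fst z))) : C) G').
  by apply: continuous_pair; apply: (continuous_mult (K := R_AbsRing)).
by rewrite -dir_scale; apply: G'_cont.
Qed.

Lemma cont_A psi r : 0 < r -> p1 < psi < p2 -> continuous (A psi) r.
Proof.
move=> r0 hp.
have h : ex_derive (fun t => B psi t) r by eexists; apply: derive_radius.
have cG : continuous (fun t => G (RtoC t * dir e psi)%C) r.
  apply: (continuous_comp (fun t => (RtoC t * dir e psi)%C) G).
    exact: continuous_scale_dir.
  exact: (cdiff_continuous _ _ _ _ _ (G_diff r psi r0 hp)).
apply: (continuous_mult (K := R_AbsRing)).
  by apply: continuous_Rinv; lra.
by apply: (continuous_comp _ l) => //; apply: linear_cont.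
Qed.

Lemma ex_RInt_A psi x y : 0 < x -> 0 < y -> p1 < psi < p2 -> ex_RInt (A psi) x y.
Proof.
move=> x0 y0 hp; apply: (ex_RInt_continuous (V := R_CompleteNormedModule)) => z [hz _].
by apply: cont_A => //; apply: Rlt_le_trans hz; apply: Rmin_pos.
Qed.

Lemma derive_segment x y psi : 0 < x -> x <= y -> p1 < psi < p2 ->
  is_derive (fun t => RInt (A t) x y) psi (B psi y - B psi x).
Proof.
move=> x0 xy hp.
have mi : Rmin x y = x by apply: Rmin_left.
have nb : locally psi (fun t => p1 < t < p2).
  by apply: (locally_interval _ psi p1 p2) => /=; [case: hp | case: hp | move=> t].
have -> : B psi y - B psi x = RInt (fun t => Derive (fun u => A u t) psi) x y.
  rewrite (RInt_ext _ (D psi)); last first.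
    move=> t; rewrite mi => -[xt _]; apply: is_derive_unique.
    by apply: derive_angle => //; lra.
  symmetry; apply: is_RInt_unique.
  refine (is_RInt_derive (fun t => B psi t) (D psi) x y _ _) => t; rewrite mi => -[xt _].
    by apply: derive_radius => //; lra.
  have t0 : 0 < t by lra.
  apply: (continuous_comp (fun t => (psi, t)) (fun z => D (fst z) (snd z))).
    by apply: continuous_pair; [apply: continuous_const | apply: continuous_id].
  exact: cont_D.
apply: is_derive_RInt_param.
- apply: filter_imp nb => s hs t; rewrite mi => -[xt _].
  by eexists; apply: derive_angle => //; lra.
- move=> t; rewrite mi => -[xt _]; have t0 : 0 < t by lra.
  apply: (continuity_2d_pt_ext_loc D); last first.
    by apply/continuity_2d_pt_filterlim; apply: (cont_D psi t t0 hp).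
  (* Within this radius the angle stays in [(p1, p2)] and the distance to 0 stays positive. *)
  have d0 : 0 < Rmin t (Rmin (psi - p1) (p2 - psi)) by repeat apply: Rmin_pos; lra.
  exists (mkposreal _ d0) => u v /= hu hv; symmetry; apply: is_derive_unique.
  have m1 := Rmin_l t (Rmin (psi - p1) (p2 - psi)).
  have m2 := Rmin_r t (Rmin (psi - p1) (p2 - psi)).
  have m3 := Rmin_l (psi - p1) (p2 - psi).
  have m4 := Rmin_r (psi - p1) (p2 - psi).
  by move/Rabs_def2: hu; move/Rabs_def2: hv => *; apply: derive_angle; lra.
- by apply: filter_imp nb => s hs; apply: ex_RInt_A => //; lra.
Qed.

(** By the mean value theorem in the angle, the integrals over [[x, y]] along the two rays differ by
    at most [Q * (bump a x + bump a y)], which vanishes in the limit. *)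
Lemma functional_rays psi1 psi2 l1 l2 : p1 < psi1 -> psi1 <= psi2 -> psi2 < p2 ->
  is_ray_int (A psi1) l1 -> is_ray_int (A psi2) l2 -> l1 = l2.
Proof.
move=> h1 h12 h2 I1 I2.
have [K [K0 hK]] := linear_norm l l_lin.
pose Q := (psi2 - psi1) * (K * Rabs M).
have Q0 : 0 <= Q.
  by apply: Rmult_le_pos; [lra | apply: Rmult_le_pos; [lra | apply: Rabs_pos]].
have boundB psi r : 0 < r -> p1 < psi < p2 -> Rabs (B psi r) <= K * Rabs M * bump a r.
  move=> r0 hp; apply: Rle_trans (hK _) _; rewrite norm_cact Cmod_Ci Rmult_1_l.
  rewrite Rmult_assoc; apply: Rmult_le_compat_l; first lra.
  apply: Rle_trans (G_bound r psi r0 hp) _; apply: Rmult_le_compat_r.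
    by apply: Rlt_le; apply: bump_pos.
  exact: Rle_abs.
have segment x y : 0 < x -> x <= y ->
    Rabs (RInt (A psi2) x y - RInt (A psi1) x y) <= Q * (bump a x + bump a y).
  move=> x0 xy.
  have [||c [hc ->]] := MVT_gen (fun t => RInt (A t) x y) psi1 psi2
      (fun t => B t y - B t x).
  - move=> t; rewrite Rmin_left // Rmax_right // => ht.
    by apply: derive_segment => //; lra.
  - move=> t; rewrite Rmin_left // Rmax_right // => ht.
    have ex : ex_derive (fun t => RInt (A t) x y) t.
      by eexists; apply: derive_segment => //; lra.
    by apply/continuity_pt_filterlim; exact: (ex_derive_continuous _ _ ex).
  rewrite Rmin_left // Rmax_right // in hc.
  rewrite Rabs_mult (Rabs_pos_eq (psi2 - psi1)); last lra.
  rewrite /Q Rmult_comm Rmult_assoc; apply: Rmult_le_compat_l; first lra.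
  apply: Rle_trans (Rabs_triang _ _) _; rewrite Rabs_Ropp.
  have y0 : 0 < y by lra.
  have hc' : p1 < c < p2 by lra.
  by have := boundB c y y0 hc'; have := boundB c x x0 hc'; lra.
apply: cond_eq => eps eps0.
(* The error is [d] for each of the two limits and [Q * (2 * d)] for the boundary terms, which stays
   below [2 * (Q + 2) * d = eps]. *)
have d0 : 0 < eps / (2 * (Q + 2)) by apply: Rdiv_lt_0_compat; lra.
pose d := mkposreal _ d0.
have near := bump_prim_near a d a_gt0.
have n1 := I1 _ (locally_ball l1 d); have n2 := I2 _ (locally_ball l2 d).
rewrite /filtermapi in n1 n2.
have [[x y] /=] := filter_ex _ (filter_and _ _ (filter_and _ _ n1 n2) (filter_and _ _ near filter_ray)).
move=> [[[v1 [i1 b1]] [v2 [i2 b2]]] [[bx by_] [x0 xy]]].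
have := segment x y x0 (Rlt_le _ _ xy).
rewrite (is_RInt_unique _ _ _ _ i1) (is_RInt_unique _ _ _ _ i2).
move: b1 b2 bx by_; rewrite /ball /= /AbsRing_ball /= /abs /minus /plus /opp /=.
move=> /Rabs_def2 b1 /Rabs_def2 b2 /Rabs_def2 bx /Rabs_def2 by_ hv.
have qx := bump_prim_bounds a x; have qy := bump_prim_bounds a y.
set dd := eps / _ in b1 b2 bx by_; have dd0 : 0 < dd := d0.
have bmx : bump a x <= dd by rewrite /bump; nra.
have bmy : bump a y <= dd by rewrite /bump; nra.
have : Q * (bump a x + bump a y) <= Q * (2 * dd) by apply: Rmult_le_compat_l; lra.
have -> : eps = 2 * (Q + 2) * dd by rewrite /dd; field; lra.
have [hv1 hv2] := proj1 (Rabs_le_between _ _) hv.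
by move=> hQ; apply: Rabs_def1; lra.
Qed.

End Functional.

Lemma cauchy_rays psi1 psi2 l1 l2 : p1 < psi1 -> psi1 <= psi2 -> psi2 < p2 ->
  is_ray_int (fun r => scal (/ r) (G (RtoC r * dir e psi1)%C)) l1 ->
  is_ray_int (fun r => scal (/ r) (G (RtoC r * dir e psi2)%C)) l2 -> l1 = l2.
Proof.
move=> h1 h12 h2 I1 I2.
suff h : minus l1 l2 = zero.
  by apply: (plus_reg_r (opp l2)); rewrite plus_opp_r.
apply: separating => l hl; rewrite (linear_minus l _ _ hl).
suff -> : l l1 = l l2 by apply: minus_eq_zero.
apply: (functional_rays l hl psi1 psi2) => //.
  have k := is_ray_int_linear V R_NormedModule l _ _ hl I1.
  by apply: (is_ray_int_ext _ _ _ _ _ k) => r _; rewrite (linear_scal l hl).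
have k := is_ray_int_linear V R_NormedModule l _ _ hl I2.
by apply: (is_ray_int_ext _ _ _ _ _ k) => r _; rewrite (linear_scal l hl).
Qed.

End Cauchy.

(** * Sector integrals of a pseudo-resolvent *)

Lemma Cmod_dir e psi : e * e = 1 -> Cmod (dir e psi) = 1.
Proof.
move=> ee; rewrite /Cmod /dir /=.
have -> : e * cos psi * (e * cos psi * 1) + e * sin psi * (e * sin psi * 1) = 1.
  have := sin2_cos2 psi; rewrite /Rsqr => sc.
  have -> : e * cos psi * (e * cos psi * 1) + e * sin psi * (e * sin psi * 1)
    = e * e * (sin psi * sin psi + cos psi * cos psi) by ring.
  by rewrite ee sc; ring.
exact: sqrt_1.
Qed.

Lemma Cmod_scale_dir e psi r : e * e = 1 -> 0 < r -> Cmod (RtoC r * dir e psi)%C = r.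
Proof.
by move=> ee r0; rewrite Cmod_mult Cmod_dir // Cmod_R Rabs_pos_eq; lra.
Qed.

Lemma Re_scale_dir e psi r : e * e = 1 -> e * fst (RtoC r * dir e psi)%C = r * cos psi.
Proof. by move=> ee; rewrite dir_scale /= -{2}(Rmult_1_l (cos psi)) -ee; ring. Qed.

Section Rays.
Variables (V : CompleteNormedModule R_AbsRing) (S : complex_structure V).
Hypothesis separating :
  forall v : V, (forall l : V -> R, is_linear l -> l v = 0) -> v = zero.
Implicit Types (h : C -> C) (Y : C -> V).

(** The inequality describes the open sector of half-angle [theta] around the direction [e] without
    an argument function; it excludes 0. *)
Definition sector_fun (e theta : R) h : Prop :=
  exists (h' : C -> C) (a M : R), 0 < a /\ 0 <= M /\
    forall z, cos theta * Cmod z < e * fst z ->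
      hdiff h z (h' z) /\ continuous h' z /\ Cmod (h z) <= M * bump a (Cmod z).

(** On the ray [z = r u] the factor [- Ci * z] is [r] times [u / i], the density of [ds / i]. The
    extra [r] makes [ray_fun] of the size of [bump] when [Y] is of size [1 / r], as Cauchy's theorem
    requires; [ray_integrand] divides it out. *)
Definition ray_fun h Y (z : C) : V := cact S (- Ci * z)%C (cact S (h z) (Y z)).
Definition ray_integrand h Y (u : C) (r : R) : V :=
  scal (/ r) (ray_fun h Y (RtoC r * u)%C).
Definition ray_int h Y (u : C) : V :=
  RInt_gen (ray_integrand h Y u) (at_right 0) (Rbar_locally p_infty).
Definition sec_int h Y (e phi : R) : V :=
  minus (ray_int h Y (dir e (- phi))) (ray_int h Y (dir e phi)).

Definition ray_bounded Y (u : C) (K : R) : Prop := forall r, 0 < r ->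
  continuous Y (RtoC r * u)%C /\ norm (Y (RtoC r * u)%C) <= K / r.
Definition rays_bounded Y e phi K : Prop :=
  ray_bounded Y (dir e (- phi)) K /\ ray_bounded Y (dir e phi) K.

Lemma ray_int_correct h Y u l : is_ray_int (ray_integrand h Y u) l -> ray_int h Y u = l.
Proof. exact: RInt_gen_ray. Qed.

Section OneFunction.
Variables (e theta : R) (h : C -> C).
Hypothesis ee : e * e = 1.
Hypothesis hh : sector_fun e theta h.

Lemma ray_fun_bound psi Y K (M a : R) r : 0 < r ->
  Cmod (h (RtoC r * dir e psi)%C) <= M * bump a r -> 0 <= M ->
  norm (Y (RtoC r * dir e psi)%C) <= K / r ->
  norm (ray_fun h Y (RtoC r * dir e psi)%C) <= K * M * bump a r.
Proof.
move=> r0 hb M0 Yb; rewrite /ray_fun !norm_cact Cmod_mult Cmod_opp Cmod_Ci Rmult_1_l.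
rewrite Cmod_scale_dir //.
have b0 := bump_pos a r.
have := norm_ge_0 (Y (RtoC r * dir e psi)%C).
have := Cmod_ge_0 (h (RtoC r * dir e psi)%C).
set x := Cmod _ in hb *; set y := norm _ in Yb *; move=> x0 y0.
have ry : r * y <= K.
  have := Rmult_le_compat_l _ _ _ (Rlt_le _ _ r0) Yb.
  by have -> : r * (K / r) = K by field; lra.
have : (r * y) * x <= K * (M * bump a r).
  by apply: Rmult_le_compat => //; apply: Rmult_le_pos; lra.
by lra.
Qed.

(** [Ch] depends on [h] alone. This uniformity gives the boundedness of [calc] and controls Taylor
    remainders of integrals that depend on a parameter. *)
Lemma is_ray_int_ex : exists Ch, 0 <= Ch /\ forall psi Y K,
  cos theta < cos psi -> ray_bounded Y (dir e psi) K ->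
  is_ray_int (ray_integrand h Y (dir e psi)) (ray_int h Y (dir e psi)) /\
  norm (ray_int h Y (dir e psi)) <= Ch * K.
Proof.
have [h' [a [M [a0 [M0 H]]]]] := hh.
exists (M * / a); split.
  by apply: Rmult_le_pos => //; apply: Rlt_le; apply: Rinv_0_lt_compat.
move=> psi Y K hpsi hY.
have inS r : 0 < r -> cos theta * Cmod (RtoC r * dir e psi)%C < e * fst (RtoC r * dir e psi)%C.
  by move=> r0; rewrite Cmod_scale_dir // Re_scale_dir // Rmult_comm; apply: Rmult_lt_compat_l.
have dom r : 0 < r -> norm (ray_integrand h Y (dir e psi) r) <= K * M * (/ r * bump a r).
  move=> r0; have [_ [_ hb]] := H _ (inS r r0); have [_ Yb] := hY r r0.
  rewrite Cmod_scale_dir // in hb.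
  have ir : 0 < / r by apply: Rinv_0_lt_compat.
  rewrite /ray_integrand -(cact_real _ S) norm_cact Cmod_R Rabs_pos_eq; last lra.
  have := ray_fun_bound psi Y K M a r r0 hb M0 Yb.
  by move=> /(Rmult_le_compat_l _ _ _ (Rlt_le _ _ ir)); lra.
have cont r : 0 < r -> continuous (ray_integrand h Y (dir e psi)) r.
  move=> r0; have [hd _] := H _ (inS r r0); have [Yc _] := hY r r0.
  have cu := continuous_scale_dir e psi r.
  apply: (continuous_scal (V := V)); first by apply: continuous_Rinv; lra.
  apply: continuous_cact.
    apply: (continuous_ext (fun t => (t * (e * sin psi), - (t * (e * cos psi))) : C)).
      by move=> t; rewrite dir_scale /Cmult /Ci /=; congr pair; ring.
    apply: continuous_pair; last apply: (continuous_opp (V := R_NormedModule)).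
      by apply: (continuous_mult (K := R_AbsRing)); [apply: continuous_id | apply: continuous_const].
    by apply: (continuous_mult (K := R_AbsRing)); [apply: continuous_id | apply: continuous_const].
  apply: continuous_cact.
    apply: (continuous_comp (fun t => (RtoC t * dir e psi)%C) h) => //.
    exact: hdiff_continuous hd.
  exact: (continuous_comp (fun t => (RtoC t * dir e psi)%C) Y).
have [l hl] := dominated_is_ray_int V _ _ _ cont a0 dom.
rewrite (ray_int_correct _ _ _ _ hl); split => //.
have := dominated_ray_int_norm V _ _ _ a0 dom l hl.
by have -> : K * M * / a = M * / a * K by ring.
Qed.

Lemma is_ray_intP psi Y K : cos theta < cos psi -> ray_bounded Y (dir e psi) K ->
  is_ray_int (ray_integrand h Y (dir e psi)) (ray_int h Y (dir e psi)).
Proof.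
have [Ch [_ H]] := is_ray_int_ex => hpsi hY.
by have [] := H psi Y K hpsi hY.
Qed.

Lemma ray_int_ext psi Y1 Y2 K : cos theta < cos psi -> ray_bounded Y1 (dir e psi) K ->
  (forall r, 0 < r -> Y1 (RtoC r * dir e psi)%C = Y2 (RtoC r * dir e psi)%C) ->
  ray_int h Y1 (dir e psi) = ray_int h Y2 (dir e psi).
Proof.
move=> hpsi hY E; symmetry; apply: ray_int_correct.
refine (is_ray_int_ext V _ _ _ _ (is_ray_intP _ _ _ hpsi hY)) => r r0.
by rewrite /ray_integrand /ray_fun E.
Qed.

Lemma ray_int_plus psi Y1 Y2 K1 K2 : cos theta < cos psi ->
  ray_bounded Y1 (dir e psi) K1 -> ray_bounded Y2 (dir e psi) K2 ->
  ray_int h (fun z => plus (Y1 z) (Y2 z)) (dir e psi) =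
  plus (ray_int h Y1 (dir e psi)) (ray_int h Y2 (dir e psi)).
Proof.
move=> hpsi h1 h2; apply: ray_int_correct.
have k := is_ray_int_plus _ _ _ _ _ (is_ray_intP _ _ _ hpsi h1) (is_ray_intP _ _ _ hpsi h2).
refine (is_ray_int_ext V _ _ _ _ k) => r r0.
by rewrite /ray_integrand /ray_fun; vring S.
Qed.

Lemma ray_int_linear psi Y K (L : V -> V) : cos theta < cos psi ->
  is_linear L -> (forall c v, L (cact S c v) = cact S c (L v)) ->
  ray_bounded Y (dir e psi) K ->
  ray_int h (fun z => L (Y z)) (dir e psi) = L (ray_int h Y (dir e psi)).
Proof.
move=> hpsi hL LC hY; apply: ray_int_correct.
have k := is_ray_int_linear _ _ L _ _ hL (is_ray_intP _ _ _ hpsi hY).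
refine (is_ray_int_ext V _ _ _ _ k) => r r0.
by rewrite /ray_integrand /ray_fun (linear_scal L hL) !LC.
Qed.

Lemma hdiff_mulCi z : hdiff (fun z => - Ci * z)%C z (- Ci)%C.
Proof.
split.
  apply: (filterdiff_ext_lin (U := C_R_NormedModule) _ (fun dz : C => snd dz)).
    apply: (filterdiff_ext (U := C_R_NormedModule) (fun z : C => snd z)).
      by move=> x; rewrite /=; ring.
    exact: (filterdiff_linear (U := C_R_NormedModule) (fun z : C => snd z) is_linear_snd).
  by move=> x; rewrite /=; ring.
apply: (filterdiff_ext_lin (U := C_R_NormedModule) _ (fun dz : C => opp (fst dz))).
  apply: (filterdiff_ext (U := C_R_NormedModule) (fun z : C => opp (fst z))).
    by move=> x; rewrite /opp /=; ring.
  apply: (filterdiff_linear (U := C_R_NormedModule) (fun z : C => opp (fst z))).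
  exact: (is_linear_comp (U := C_R_NormedModule) (fun z : C => fst z) opp is_linear_fst is_linear_opp).
by move=> x; rewrite /opp /=; ring.
Qed.

(* Cauchy's theorem between two rays of the sector. *)
Lemma ray_int_rotate Y Y' p1 p2 K psi1 psi2 :
  p1 < psi1 -> psi1 <= psi2 -> psi2 < p2 ->
  (forall psi, p1 < psi < p2 -> cos theta < cos psi) ->
  (forall r psi, 0 < r -> p1 < psi < p2 ->
     qdiff V S Y Y' (RtoC r * dir e psi)%C /\ norm (Y (RtoC r * dir e psi)%C) <= K / r) ->
  ray_int h Y (dir e psi1) = ray_int h Y (dir e psi2).
Proof.
move=> h1 h12 h2 hcos hY.
have bdd psi : p1 < psi < p2 -> ray_bounded Y (dir e psi) K.
  move=> hp r r0; have [q b] := hY r psi r0 hp; split => //.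
  exact: cdiff_continuous (qdiff_cdiff _ _ _ _ _ q).
have hp1 : p1 < psi1 < p2 by lra.
have hp2 : p1 < psi2 < p2 by lra.
have I1 := is_ray_intP _ _ _ (hcos _ hp1) (bdd _ hp1).
have I2 := is_ray_intP _ _ _ (hcos _ hp2) (bdd _ hp2).
have [h' [a [M [a0 [M0 H]]]]] := hh.
have inS r psi : 0 < r -> p1 < psi < p2 ->
    cos theta * Cmod (RtoC r * dir e psi)%C < e * fst (RtoC r * dir e psi)%C.
  move=> r0 hp; rewrite Cmod_scale_dir // Re_scale_dir // Rmult_comm.
  by apply: Rmult_lt_compat_l => //; apply: hcos.
pose G' z := plus (cact S (- Ci)%C (cact S (h z) (Y z)))
  (cact S (- Ci * z)%C (plus (cact S (h' z) (Y z)) (cact S (h z) (Y' z)))).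
apply: (cauchy_rays V S separating (ray_fun h Y) G' e p1 p2 (K * M) a _ _ a0 _ psi1 psi2) => //.
- move=> r psi r0 hp; have [hd _] := H _ (inS r psi r0 hp); have [q _] := hY r psi r0 hp.
  have d := cdiff_mul _ _ _ _ _ _ _ hd (qdiff_cdiff _ _ _ _ _ q).
  exact: (cdiff_mul _ _ _ _ _ _ _ (hdiff_mulCi _) d).
- move=> r psi r0 hp; have [hd [hc _]] := H _ (inS r psi r0 hp); have [q _] := hY r psi r0 hp.
  have Yc := cdiff_continuous _ _ _ _ _ (qdiff_cdiff _ _ _ _ _ q).
  have Y'c := qdiff_continuous _ _ _ _ _ q.
  have hcont := hdiff_continuous _ _ _ hd.
  apply: (continuous_plus (V := V)); apply: continuous_cact.
  + exact: continuous_const.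
  + exact: continuous_cact.
  + exact: hdiff_continuous (hdiff_mulCi _).
  + by apply: (continuous_plus (V := V)); apply: continuous_cact.
- move=> r psi r0 hp; have [_ [_ hb]] := H _ (inS r psi r0 hp); have [_ b] := hY r psi r0 hp.
  by rewrite Cmod_scale_dir // in hb; apply: ray_fun_bound.
Qed.

Section Sector.
Variable phi : R.
Hypothesis hphi : cos theta < cos phi.

Let hphiN : cos theta < cos (- phi).
Proof. by rewrite cos_neg. Qed.

Lemma sec_int_norm : exists Ch, 0 <= Ch /\ forall Y K,
  rays_bounded Y e phi K -> norm (sec_int h Y e phi) <= Ch * K.
Proof.
have [Ch [C0 H]] := is_ray_int_ex.
exists (2 * Ch); split; first lra.
move=> Y K [b1 b2]; have [_ n1] := H _ _ _ hphiN b1; have [_ n2] := H _ _ _ hphi b2.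
apply: Rle_trans (norm_triangle _ _) _; rewrite norm_opp; lra.
Qed.

Lemma is_ray_int_sec Y K : rays_bounded Y e phi K ->
  is_ray_int (fun r => minus (ray_integrand h Y (dir e (- phi)) r)
    (ray_integrand h Y (dir e phi) r)) (sec_int h Y e phi).
Proof.
by move=> [b1 b2]; apply: is_ray_int_minus; apply: is_ray_intP; eassumption.
Qed.

Lemma sec_int_ext Y1 Y2 K : rays_bounded Y1 e phi K ->
  (forall r, 0 < r -> Y1 (RtoC r * dir e (- phi))%C = Y2 (RtoC r * dir e (- phi))%C) ->
  (forall r, 0 < r -> Y1 (RtoC r * dir e phi)%C = Y2 (RtoC r * dir e phi)%C) ->
  sec_int h Y1 e phi = sec_int h Y2 e phi.
Proof.
move=> [b1 b2] E1 E2; rewrite /sec_int.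
by rewrite (ray_int_ext _ _ _ _ hphiN b1 E1) (ray_int_ext _ _ _ _ hphi b2 E2).
Qed.

Lemma sec_int_plus Y1 Y2 K1 K2 : rays_bounded Y1 e phi K1 -> rays_bounded Y2 e phi K2 ->
  sec_int h (fun z => plus (Y1 z) (Y2 z)) e phi =
  plus (sec_int h Y1 e phi) (sec_int h Y2 e phi).
Proof.
move=> [b1 b2] [c1 c2]; rewrite /sec_int.
rewrite (ray_int_plus _ _ _ _ _ hphiN b1 c1) (ray_int_plus _ _ _ _ _ hphi b2 c2).
by vring S.
Qed.

Lemma sec_int_linear Y K (L : V -> V) : is_linear L ->
  (forall c v, L (cact S c v) = cact S c (L v)) -> rays_bounded Y e phi K ->
  sec_int h (fun z => L (Y z)) e phi = L (sec_int h Y e phi).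
Proof.
move=> hL LC [b1 b2]; rewrite /sec_int.
rewrite (ray_int_linear _ _ _ _ hphiN hL LC b1) (ray_int_linear _ _ _ _ hphi hL LC b2).
by rewrite (linear_minus L).
Qed.

End Sector.
End OneFunction.
End Rays.

Lemma Cmod_sub_sym (z w : C) : Cmod (z - w) = Cmod (w - z).
Proof. by rewrite -Cmod_opp; congr Cmod; ring. Qed.

Lemma Csub_neq0 (z w : C) : 0 < Cmod (z - w) -> (z - w)%C <> 0%C.
Proof. by move=> h e; rewrite e Cmod_0 in h; lra. Qed.

Lemma continuous_Cinv_sub (l s : C) : l <> s -> continuous (fun t => / (l - t))%C s.
Proof.
move=> ls.
have d0 : 0 < Cmod (l - s).
  by apply/Cmod_gt_0 => e; apply: ls; transitivity ((l - s) + s)%C; [ring | rewrite e; ring].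
apply: (lipschitz_continuous C_R_NormedModule).
exists (2 / (Cmod (l - s) * Cmod (l - s))), (Cmod (l - s) / 2); split; first lra.
(* If [t] is closer to [s] than half of [Cmod (l - s)], then [l] keeps at least that half distance
   from [t]; hence the factor 2. *)
move=> t ht; have ht' : Cmod (l - s) / 2 < Cmod (l - t).
  have := Cmod_triangle (l - t) (t - s).
  have -> : (l - t + (t - s) = l - s)%C by ring.
  by lra.
have n1 : (l - s)%C <> 0%C by apply: Csub_neq0.
have n2 : (l - t)%C <> 0%C by apply: Csub_neq0; lra.
have -> : norm (V := C_R_NormedModule) (minus (/ (l - t))%C (/ (l - s))%C) = Cmod ((t - s) * (/ (l - t) * / (l - s)))%C.
  by rewrite -Cmod_norm; congr Cmod; rewrite /minus /plus /opp /= -/(Copp _) -/(Cplus _ _); field.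
rewrite !Cmod_mult !Cmod_inv //.
rewrite (Rmult_comm (2 / _)); apply: Rmult_le_compat_l; first exact: Cmod_ge_0.
have -> : 2 / (Cmod (l - s) * Cmod (l - s)) = / (Cmod (l - s) / 2) * / Cmod (l - s) by field; lra.
apply: Rmult_le_compat_r; first by apply: Rlt_le; apply: Rinv_0_lt_compat.
by apply: Rinv_le_contravar; lra.
Qed.

Lemma Cmod_sub_ge (l s : C) : fst s - fst l <= Cmod (l - s).
Proof.
have := re_le_Cmod (l - s); rewrite /Re /= => h.
by have := Rle_abs (- (fst l + - fst s)); rewrite Rabs_Ropp; lra.
Qed.

(** * Sector integrals against the Cauchy kernel *)

Section Kernel.
Variables (V : CompleteNormedModule R_AbsRing) (S : complex_structure V).
Hypothesis separating :
  forall v : V, (forall l : V -> R, is_linear l -> l v = 0) -> v = zero.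

(** Iteration differentiates: [kernel l (kernel l Y)] is minus the derivative of [kernel l Y] in [l]
    and, for constant [Y], its derivative in [s]. *)
Definition kernel (l : C) (Y : C -> V) (s : C) : V := cact S (/ (l - s))%C (Y s).

Variables (theta : R) (g : C -> C).
Hypothesis htheta : 0 < theta < PI / 2.
Hypothesis hg : sector_fun 1 theta g.

Let cos_theta : 0 < cos theta.
Proof. by apply: cos_gt_0; lra. Qed.
Let ee : 1 * 1 = 1. Proof. ring. Qed.

(** The rays lie in the right half-plane, so their points have distance at least [- fst l] from
    [l]. *)
Lemma rays_bounded_kernel l Y phi K : fst l < 0 -> 0 < cos phi ->
  rays_bounded V Y 1 phi K -> rays_bounded V (kernel l Y) 1 phi (K / - fst l).
Proof.
move=> l0 hphi.
have aux psi : cos psi = cos phi -> ray_bounded V Y (dir 1 psi) K ->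
    ray_bounded V (kernel l Y) (dir 1 psi) (K / - fst l).
  move=> hpsi hY r r0; have [c b] := hY r r0.
  set s := (RtoC r * dir 1 psi)%C in c b *.
  have s0 : 0 < fst s.
    have := Re_scale_dir 1 psi r ee; rewrite -/s hpsi => e.
    by have := Rmult_lt_0_compat _ _ r0 hphi; lra.
  have ls := Cmod_sub_ge l s.
  have lsn : (l - s)%C <> 0%C by apply: Csub_neq0; lra.
  split.
    apply: continuous_cact => //; apply: continuous_Cinv_sub => e.
    by apply: lsn; rewrite e; ring.
  rewrite /kernel norm_cact Cmod_inv //.
  have -> : K / - fst l / r = / - fst l * (K / r) by rewrite /Rdiv; ring.
  apply: Rmult_le_compat => //; first by apply: Rlt_le; apply: Rinv_0_lt_compat; lra.
    exact: norm_ge_0.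
  by apply: Rinv_le_contravar; lra.
by move=> [b1 b2]; split; apply: aux => //; rewrite cos_neg.
Qed.

Lemma rays_bounded_plus (Y1 Y2 : C -> V) phi K1 K2 :
  rays_bounded V Y1 1 phi K1 -> rays_bounded V Y2 1 phi K2 ->
  rays_bounded V (fun s => plus (Y1 s) (Y2 s)) 1 phi (K1 + K2).
Proof.
have aux u : ray_bounded V Y1 u K1 -> ray_bounded V Y2 u K2 ->
    ray_bounded V (fun s => plus (Y1 s) (Y2 s)) u (K1 + K2).
  move=> hz1 hz2 r r0; have [c1 n1] := hz1 r r0; have [c2 n2] := hz2 r r0; split.
    exact: (continuous_plus (V := V)).
  apply: Rle_trans (norm_triangle _ _) _; rewrite /Rdiv Rmult_plus_distr_r.
  by rewrite /Rdiv in n1 n2; lra.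
by move=> [z1 z2] [z3 z4]; split; apply: aux.
Qed.

Lemma norm_kernel_const l x0 s : fst l < 0 -> 0 < fst s ->
  norm (kernel l (fun _ => x0) s) <= / fst s * norm x0.
Proof.
move=> l0 s0; have ls := Cmod_sub_ge l s.
have lsn : (l - s)%C <> 0%C by apply: Csub_neq0; lra.
rewrite /kernel norm_cact Cmod_inv //.
apply: Rmult_le_compat_r; first exact: norm_ge_0.
by apply: Rinv_le_contravar; lra.
Qed.

(** The remainder is exactly [(s2 - s1)^2 / ((l - s2) (l - s1)^2)] times [x0]; the radius [fst s]
    keeps both points in the right half-plane, at distance at least [- fst l] from [l]. *)
Lemma kernel_qdiff_const l (x0 : V) s : fst l < 0 -> 0 < fst s ->
  qdiff V S (kernel l (fun _ => x0)) (kernel l (kernel l (fun _ => x0))) s.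
Proof.
move=> l0 s0.
exists (/ - fst l * (/ - fst l * / - fst l) * norm x0), (fst s); split => // s1 s2 h1 h2.
have ls z : Cmod (z - s) < fst s -> - fst l <= Cmod (l - z).
  move=> hz; have := Cmod_sub_ge l z; have := re_le_Cmod (z - s); rewrite /Re /= => h.
  by have := Rle_abs (- (fst z + - fst s)); rewrite Rabs_Ropp; lra.
have k1 := ls _ h1; have k2 := ls _ h2.
have n1 : (l - s1)%C <> 0%C by apply: Csub_neq0; lra.
have n2 : (l - s2)%C <> 0%C by apply: Csub_neq0; lra.
have -> : minus (minus (kernel l (fun _ => x0) s2) (kernel l (fun _ => x0) s1))
   (cact S (s2 - s1)%C (kernel l (kernel l (fun _ => x0)) s1)) =
   cact S ((s2 - s1) * (s2 - s1) * (/ (l - s2) * (/ (l - s1) * / (l - s1))))%C x0.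
  by rewrite /kernel; vector_eq S; field.
rewrite norm_cact !Cmod_mult !Cmod_inv //.
have i0 : 0 < / - fst l by apply: Rinv_0_lt_compat; lra.
have i1 : 0 <= / Cmod (l - s1) <= / - fst l.
  by split; [apply: Rlt_le; apply: Rinv_0_lt_compat; lra | apply: Rinv_le_contravar; lra].
have i2 : 0 <= / Cmod (l - s2) <= / - fst l.
  by split; [apply: Rlt_le; apply: Rinv_0_lt_compat; lra | apply: Rinv_le_contravar; lra].
have x0n := norm_ge_0 x0.
have -> : / - fst l * (/ - fst l * / - fst l) * norm x0 * Cmod (s2 - s1) ^ 2 =
  Cmod (s2 - s1) * Cmod (s2 - s1) * (/ - fst l * (/ - fst l * / - fst l)) * norm x0 by ring.
apply: Rmult_le_compat_r => //; apply: Rmult_le_compat_l.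
  by apply: Rmult_le_pos; apply: Cmod_ge_0.
apply: Rmult_le_compat; try lra; first by apply: Rmult_le_pos; lra.
by apply: Rmult_le_compat; lra.
Qed.

(** Here the decay in [r] comes from the kernel itself, through
    [Cmod (l - s) >= fst s = r * cos phi]. *)
Lemma rays_bounded_kernel_const l (x0 : V) phi : fst l < 0 -> 0 < cos phi ->
  rays_bounded V (kernel l (fun _ => x0)) 1 phi (norm x0 / cos phi).
Proof.
move=> l0 hphi.
have aux psi : cos psi = cos phi -> ray_bounded V (kernel l (fun _ => x0)) (dir 1 psi) (norm x0 / cos phi).
  move=> hpsi r r0; have re := Re_scale_dir 1 psi r ee; rewrite Rmult_1_l hpsi in re.
  have rc := Rmult_lt_0_compat _ _ r0 hphi.
  have s0 : 0 < fst (RtoC r * dir 1 psi)%C by rewrite re.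
  split; first exact: cdiff_continuous (qdiff_cdiff _ _ _ _ _ (kernel_qdiff_const l x0 _ l0 s0)).
  apply: Rle_trans (norm_kernel_const l x0 _ l0 s0) _; rewrite re.
  by right; field; lra.
by split; apply: aux => //; rewrite cos_neg.
Qed.

(* Cauchy's theorem in the right half-plane, where 1 / (l - s) has no pole. *)
Lemma sec_int_kernel_const l x0 phi : fst l < 0 -> 0 < phi < theta ->
  sec_int V S g (kernel l (fun _ => x0)) 1 phi = zero.
Proof.
move=> l0 hphi.
rewrite /sec_int; suff -> : ray_int V S g (kernel l (fun _ => x0)) (dir 1 (- phi)) =
    ray_int V S g (kernel l (fun _ => x0)) (dir 1 phi) by apply: minus_eq_zero.
have hcos psi : - theta < psi < theta -> cos theta < cos psi.
  move=> hp; case: (Rle_lt_dec 0 psi) => h; first by apply: cos_decreasing_1; lra.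
  by rewrite -(cos_neg psi); apply: cos_decreasing_1; lra.
apply: (ray_int_rotate V S separating 1 theta g ee hg _ (kernel l (kernel l (fun _ => x0)))
  (- theta) theta (norm x0 / cos theta)) => //; try lra.
move=> r psi r0 hp.
have cp := hcos _ hp.
have s0 : r * cos theta < fst (RtoC r * dir 1 psi)%C.
  have := Re_scale_dir 1 psi r ee; rewrite Rmult_1_l => ->.
  exact: Rmult_lt_compat_l.
have rc := Rmult_lt_0_compat _ _ r0 cos_theta.
split; first by apply: kernel_qdiff_const => //; lra.
apply: Rle_trans (norm_kernel_const l x0 _ l0 _) _; first lra.
have -> : norm x0 / cos theta / r = / (r * cos theta) * norm x0 by field; lra.
apply: Rmult_le_compat_r; first exact: norm_ge_0.
by apply: Rinv_le_contravar; lra.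
Qed.

(** The kernel has an exact expansion in [l] whose remainder is [(l2 - l1)^2] times a triple kernel.
    It is integrated term by term, and [sec_int_norm] bounds the integral of the remainder. *)
Lemma kernel_sec_qdiff Y phi K l : 0 < cos phi -> cos theta < cos phi ->
  rays_bounded V Y 1 phi K -> fst l < 0 ->
  qdiff V S (fun l => sec_int V S g (kernel l Y) 1 phi)
    (fun l => opp (sec_int V S g (kernel l (kernel l Y)) 1 phi)) l.
Proof.
move=> hp0 hp hY l0.
have [Ch [Ch0 H]] := sec_int_norm V S 1 theta g ee hg phi hp.
(* Half the distance from [l] to the imaginary axis: parameters this close to [l] keep at least
   distance [d] from the axis. *)
pose d := - fst l / 2.
have d0 : 0 < d by rewrite /d; lra.
have K0 : 0 <= K.
  have [_ b] := hY; have [_ h] := b 1 Rlt_0_1.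
  by have := norm_ge_0 (Y (1 * dir 1 phi)%C); lra.
exists (Ch * (K / d / d / d)), d; split => // l1 l2 h1 h2.
have ld z : Cmod (z - l) < d -> d <= - fst z.
  move=> hz; have := re_le_Cmod (z - l); rewrite /Re /= => h.
  by have := Rle_abs (fst z + - fst l); rewrite /d in hz *; lra.
have k1 := ld _ h1; have k2 := ld _ h2.
have l10 : fst l1 < 0 by lra.
have l20 : fst l2 < 0 by lra.
have b1 := rays_bounded_kernel l1 Y phi K l10 hp0 hY.
have b11 := rays_bounded_kernel l1 _ phi _ l10 hp0 b1.
have b211 := rays_bounded_kernel l2 _ phi _ l20 hp0 b11.
have b2 := rays_bounded_kernel l2 Y phi K l20 hp0 hY.
have scaled c (Z : C -> V) KZ : rays_bounded V Z 1 phi KZ ->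
    rays_bounded V (fun s => cact S c (Z s)) 1 phi (Cmod c * KZ).
  have aux u : ray_bounded V Z u KZ -> ray_bounded V (fun s => cact S c (Z s)) u (Cmod c * KZ).
    move=> hZ r r0; have [cc bb] := hZ r r0; split.
      by apply: continuous_cact => //; apply: continuous_const.
    rewrite norm_cact /Rdiv Rmult_assoc; apply: Rmult_le_compat_l => //; exact: Cmod_ge_0.
  by move=> [z1 z2]; split; apply: aux.
have s11 := scaled (- (l2 - l1))%C _ _ b11.
have s211 := scaled ((l2 - l1) * (l2 - l1))%C _ _ b211.
have a1 := rays_bounded_plus _ _ _ _ _ b1 s11.
have CC c c' v : cact S c (cact S c' v) = cact S c' (cact S c v) by vring S.
have key z : 0 < fst z -> kernel l2 Y z =
    plus (plus (kernel l1 Y z) (cact S (- (l2 - l1))%C (kernel l1 (kernel l1 Y) z)))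
      (cact S ((l2 - l1) * (l2 - l1))%C (kernel l2 (kernel l1 (kernel l1 Y)) z)).
  move=> z0; have m1 := Cmod_sub_ge l1 z; have m2 := Cmod_sub_ge l2 z.
  have n1 : (l1 - z)%C <> 0%C by apply: Csub_neq0; lra.
  have n2 : (l2 - z)%C <> 0%C by apply: Csub_neq0; lra.
  by rewrite /kernel; vector_eq S; field.
have pos psi r : cos psi = cos phi -> 0 < r -> 0 < fst (RtoC r * dir 1 psi)%C.
  move=> hpsi r0; have := Re_scale_dir 1 psi r ee; rewrite hpsi => e.
  by have := Rmult_lt_0_compat _ _ r0 hp0; lra.
have E := sec_int_ext V S 1 theta g ee hg phi hp (kernel l2 Y)
  (fun z => plus (plus (kernel l1 Y z) (cact S (- (l2 - l1))%C (kernel l1 (kernel l1 Y) z)))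
    (cact S ((l2 - l1) * (l2 - l1))%C (kernel l2 (kernel l1 (kernel l1 Y)) z))) _ b2
  (fun r r0 => key _ (pos (- phi) r (cos_neg phi) r0))
  (fun r r0 => key _ (pos phi r (eq_refl (cos phi)) r0)).
cbv beta; rewrite E.
rewrite (sec_int_plus V S 1 theta g ee hg phi hp _ _ _ _ a1 s211).
rewrite (sec_int_plus V S 1 theta g ee hg phi hp _ _ _ _ b1 s11).
rewrite (sec_int_linear V S 1 theta g ee hg phi hp _ _ (cact S (- (l2 - l1))%C) (is_linear_cact _ _) (CC _) b11).
rewrite (sec_int_linear V S 1 theta g ee hg phi hp _ _ (cact S ((l2 - l1) * (l2 - l1))%C) (is_linear_cact _ _) (CC _) b211).
set A := sec_int _ _ _ _ _ _; set B := sec_int _ _ _ _ _ _; set D := sec_int _ _ _ _ _ _.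
have -> : minus (minus (plus (plus A (cact S (- (l2 - l1))%C B)) (cact S ((l2 - l1) * (l2 - l1))%C D)) A)
   (cact S (l2 - l1)%C (opp B)) = cact S ((l2 - l1) * (l2 - l1))%C D by vring S.
rewrite norm_cact Cmod_mult.
have -> : Ch * (K / d / d / d) * Cmod (l2 - l1) ^ 2 = Cmod (l2 - l1) * Cmod (l2 - l1) * (Ch * (K / d / d / d)) by ring.
apply: Rmult_le_compat_l; first by apply: Rmult_le_pos; apply: Cmod_ge_0.
apply: Rle_trans (H _ _ b211) _; apply: Rmult_le_compat_l => //.
have step x y z : 0 <= x -> x <= y -> d <= z -> 0 <= x / z <= y / d.
  move=> x0 xy dz; have iz : 0 < / z by apply: Rinv_0_lt_compat; lra.
  split; first by apply: Rmult_le_pos; lra.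
  by apply: Rmult_le_compat; [lra | lra | lra | apply: Rinv_le_contravar].
have [u0 u1] := step K K (- fst l1) K0 (Rle_refl _) k1.
have [w0 w1] := step _ _ (- fst l1) u0 u1 k1.
exact: (proj2 (step _ _ (- fst l2) w0 w1 k2)).
Qed.

End Kernel.

(** * Pseudo-resolvents and their sector integrals *)

Section Resolvent.
Variables (V : CompleteNormedModule R_AbsRing) (S : complex_structure V).
Hypothesis separating :
  forall v : V, (forall l : V -> R, is_linear l -> l v = 0) -> v = zero.

Definition complex_linear (L : V -> V) : Prop :=
  is_linear L /\ forall c v, L (cact S c v) = cact S c (L v).

(* The complement of the closed double sector of half-angle omega; it does not
   contain 0. *)
Definition outside (omega : R) (z : C) : Prop := Rabs (fst z) < cos omega * Cmod z.

(** This is all that the contour arguments use of [T] in one slice. The bound is stated with a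
    non-strict inequality because the contour runs along the boundary rays of angle [phi]. *)
Record pseudo_resolvent (omega : R) (res : C -> V -> V) : Prop := {
  res_linear : forall z, outside omega z -> complex_linear (res z);
  res_eq : forall z w v, outside omega z -> outside omega w ->
    minus (res z v) (res w v) = cact S (w - z)%C (res z (res w v));
  res_bound : forall phi, omega < phi < PI / 2 -> exists K, 0 <= K /\
    forall z v, 0 < Cmod z -> Rabs (fst z) <= cos phi * Cmod z ->
      norm (res z v) <= K / Cmod z * norm v
}.

Variables (omega : R) (res : C -> V -> V).
Hypothesis homega : 0 < omega < PI / 2.
Hypothesis hres : pseudo_resolvent omega res.

Lemma outside_neq0 z : outside omega z -> 0 < Cmod z.
Proof.
rewrite /outside => h; have := Cmod_ge_0 z; have := Rabs_pos (fst z).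
by case: (Req_dec (Cmod z) 0) => [e|] *; [rewrite e in h; lra | lra].
Qed.

(** Exchanging [z] and [w] in the resolvent identity changes the sign of the left side and of the
    factor [w - z]. *)
Lemma res_comm z w v : outside omega z -> outside omega w ->
  res z (res w v) = res w (res z v).
Proof.
move=> hz hw.
case: (Req_dec (Cmod (w - z)) 0) => [e|ne].
  have -> : w = z by transitivity ((w - z) + z)%C; [ring | rewrite (Cmod_eq_0 _ e); ring].
  by [].
have n : (w - z)%C <> 0%C by apply: Csub_neq0; have := Cmod_ge_0 (w - z); lra.
have e1 := res_eq _ _ hres _ _ v hz hw; have e2 := res_eq _ _ hres _ _ v hw hz.
have -> : res z (res w v) = cact S (/ (w - z))%C (cact S (w - z)%C (res z (res w v))).
  by vector_eq S; field.
rewrite -e1.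
have -> : minus (res z v) (res w v) = opp (minus (res w v) (res z v)) by vring S.
by rewrite e2; vector_eq S; field.
Qed.

Lemma cos_angle phi : omega < phi < PI / 2 -> 0 < cos phi < cos omega.
Proof. by move=> h; split; [apply: cos_gt_0; lra | apply: cos_decreasing_1; lra]. Qed.

(** [res_bound] needs an angle strictly above [omega]. The inequality in [outside] is strict, which
    leaves room for the arc cosine of a midpoint. *)
Lemma outside_angle z : outside omega z ->
  exists phi, omega < phi < PI / 2 /\ Rabs (fst z) < cos phi * Cmod z.
Proof.
move=> hz; have z0 := outside_neq0 z hz; rewrite /outside in hz.
have cw : 0 < cos omega < 1.
  split; first by apply: cos_gt_0; lra.
  by rewrite -cos_0; apply: cos_decreasing_1; lra.
pose c := (Rabs (fst z) / Cmod z + cos omega) / 2.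
have q0 : 0 <= Rabs (fst z) / Cmod z < cos omega.
  split; first by apply: Rmult_le_pos; [apply: Rabs_pos | apply: Rlt_le; apply: Rinv_0_lt_compat].
  by apply: (Rmult_lt_reg_r (Cmod z)) => //; field_simplify; lra.
have c0 : 0 < c < cos omega by rewrite /c; lra.
have ca : cos (acos c) = c by apply: cos_acos; lra.
have ab := acos_bound c.
exists (acos c); split.
  by split; apply: cos_decreasing_0; rewrite ?cos_PI2; lra.
have -> : Rabs (fst z) = Rabs (fst z) / Cmod z * Cmod z by field; lra.
by rewrite ca; apply: Rmult_lt_compat_r => //; rewrite /c; lra.
Qed.

Lemma res_local_bound z : outside omega z -> exists d K, 0 < d /\ 0 <= K /\
  forall z', Cmod (z' - z) < d -> outside omega z' /\ forall v, norm (res z' v) <= K * norm v.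
Proof.
move=> hz; have z0 := outside_neq0 z hz; have [phi [hphi qc]] := outside_angle z hz.
have [K [K0 H]] := res_bound _ _ hres _ hphi.
have c0 : 0 < cos phi < cos omega by apply: cos_angle.
set c := cos phi in qc H c0.
(* The first term keeps the modulus above half of [Cmod z]; the second pays for the changes of
   [Rabs (fst z)] and of [c * Cmod z], each at most [d]. *)
pose d := Rmin (Cmod z / 2) ((c * Cmod z - Rabs (fst z)) / 2).
have d0 : 0 < d by apply: Rmin_pos; lra.
exists d, (K / (Cmod z / 2)); split => //; split.
  by apply: Rmult_le_pos => //; apply: Rlt_le; apply: Rinv_0_lt_compat; lra.
move=> z' hz'.
have d1 := Rmin_l (Cmod z / 2) ((c * Cmod z - Rabs (fst z)) / 2).
have d2 := Rmin_r (Cmod z / 2) ((c * Cmod z - Rabs (fst z)) / 2).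
rewrite -/d in d1 d2.
have t1 := Cmod_triangle z' (z - z'); rewrite (Cmod_sub_sym z) in t1.
have ez : (z' + (z - z') = z)%C by ring.
rewrite ez in t1.
have t2 := re_le_Cmod (z' - z); rewrite /Re /= in t2.
have t3 := Rabs_triang (fst z) (fst z' + - fst z).
have ef : fst z + (fst z' + - fst z) = fst z' by ring.
rewrite ef in t3.
have m' : Cmod z - d < Cmod z' by lra.
have c1 : c <= 1 by have := COS_bound phi; rewrite /c; lra.
have key : Rabs (fst z') <= c * Cmod z' by nra.
have z'0 : 0 < Cmod z' by lra.
split; first by rewrite /outside; nra.
move=> v; apply: Rle_trans (H z' v z'0 key) _.
apply: Rmult_le_compat_r; first exact: norm_ge_0.
by apply: Rmult_le_compat_l => //; apply: Rinv_le_contravar; lra.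
Qed.

(** Two uses of the resolvent identity give the remainder exactly, as [(z2 - z1)^2] times a product
    of three resolvents, each bounded near [z]. *)
Lemma res_qdiff v z : outside omega z ->
  qdiff V S (fun z => res z v) (fun z => opp (res z (res z v))) z.
Proof.
move=> hz; have [d [K [d0 [K0 H]]]] := res_local_bound z hz.
exists (K * (K * (K * norm v))), d; split => // z1 z2 h1 h2.
have [o1 b1] := H _ h1; have [o2 b2] := H _ h2.
have [l1 C1] := res_linear _ _ hres _ o1; have [l2 C2] := res_linear _ _ hres _ o2.
have e1 := res_eq _ _ hres _ _ v o2 o1.
have e2 := res_eq _ _ hres _ _ (res z1 v) o2 o1.
have -> : minus (minus (res z2 v) (res z1 v)) (cact S (z2 - z1)%C (opp (res z1 (res z1 v)))) =
   cact S ((z2 - z1) * (z2 - z1))%C (res z2 (res z1 (res z1 v))).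
  rewrite e1.
  have -> : res z2 (res z1 v) = plus (res z1 (res z1 v)) (minus (res z2 (res z1 v)) (res z1 (res z1 v))) by vring S.
  by rewrite e2; vring S.
rewrite norm_cact Cmod_mult.
have -> : K * (K * (K * norm v)) * Cmod (z2 - z1) ^ 2 =
  Cmod (z2 - z1) * Cmod (z2 - z1) * (K * (K * (K * norm v))) by ring.
apply: Rmult_le_compat_l; first by apply: Rmult_le_pos; apply: Cmod_ge_0.
apply: Rle_trans (b2 _) _; apply: Rmult_le_compat_l => //.
apply: Rle_trans (b1 _) _; apply: Rmult_le_compat_l => //; exact: b1.
Qed.

Section OneSide.
Variable e : R.
Hypothesis ee : e * e = 1.

Lemma outside_dir r psi : 0 < r -> Rabs (cos psi) < cos omega ->
  outside omega (RtoC r * dir e psi)%C.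
Proof.
move=> r0 h; rewrite /outside Cmod_scale_dir //.
have e1 : Rabs e = 1.
  have := Rabs_mult e e; rewrite ee Rabs_R1; have := Rabs_pos e; nra.
have -> : fst (RtoC r * dir e psi)%C = r * (e * cos psi) by rewrite dir_scale.
by rewrite !Rabs_mult e1 (Rabs_pos_eq r); [nra | lra].
Qed.

Lemma on_rays phi (P : C -> Prop) : omega < phi < PI / 2 ->
  (forall z, outside omega z -> P z) ->
  (forall r, 0 < r -> P (RtoC r * dir e (- phi))%C) /\
  (forall r, 0 < r -> P (RtoC r * dir e phi)%C).
Proof.
move=> hphi; have [c0 c1] := cos_angle phi hphi.
move=> H; split=> r r0; apply: H; apply: outside_dir => //;
  rewrite ?cos_neg Rabs_pos_eq; lra.
Qed.

Lemma res_ray_bound phi : omega < phi < PI / 2 -> exists K, 0 <= K /\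
  forall psi r v, 0 < r -> Rabs (cos psi) <= cos phi ->
    norm (res (RtoC r * dir e psi)%C v) <= K * norm v / r.
Proof.
move=> hphi; have [K [K0 H]] := res_bound _ _ hres _ hphi.
exists K; split => // psi r v r0 hp.
have := H (RtoC r * dir e psi)%C v; rewrite Cmod_scale_dir // => h.
have -> : K * norm v / r = K / r * norm v by rewrite /Rdiv; ring.
apply: h => //.
have e1 : Rabs e = 1.
  have := Rabs_mult e e; rewrite ee Rabs_R1; have := Rabs_pos e; nra.
have -> : fst (RtoC r * dir e psi)%C = r * (e * cos psi) by rewrite dir_scale.
by rewrite !Rabs_mult e1 (Rabs_pos_eq r); [nra | lra].
Qed.

Lemma res_rays_bounded phi : omega < phi < PI / 2 -> exists K, 0 <= K /\
  forall v, rays_bounded V (fun z => res z v) e phi (K * norm v).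
Proof.
move=> hphi; have [K [K0 H]] := res_ray_bound phi hphi.
have [c0 c1] := cos_angle phi hphi.
exists K; split => // v; split=> r r0.
  split; last by apply: H => //; rewrite cos_neg Rabs_pos_eq; lra.
  apply: cdiff_continuous (qdiff_cdiff _ _ _ _ _ (res_qdiff v _ _)).
  by apply: outside_dir => //; rewrite cos_neg Rabs_pos_eq; lra.
split; last by apply: H => //; rewrite Rabs_pos_eq; lra.
apply: cdiff_continuous (qdiff_cdiff _ _ _ _ _ (res_qdiff v _ _)).
by apply: outside_dir => //; rewrite Rabs_pos_eq; lra.
Qed.

Variables (theta : R) (h : C -> C).
Hypothesis htheta : omega < theta < PI / 2.
Hypothesis hh : sector_fun e theta h.

Definition calc phi v : V := sec_int V S h (fun z => res z v) e phi.

Lemma calc_angle phi1 phi2 v : omega < phi1 -> phi1 <= phi2 -> phi2 < theta ->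
  calc phi1 v = calc phi2 v.
Proof.
move=> h1 h12 h2.
(* An angle strictly between [omega] and [phi1] leaves room for the open range of angles needed by
   [ray_int_rotate], with one resolvent bound on all of it. *)
pose p := (omega + phi1) / 2.
have hp : omega < p < PI / 2 by rewrite /p; lra.
have [K [K0 H]] := res_ray_bound p hp.
have [cp0 cp1] := cos_angle p hp.
have c0 : 0 < cos theta by apply: cos_gt_0; lra.
rewrite /calc /sec_int; congr minus.
- symmetry; apply: (ray_int_rotate V S separating e theta h ee hh _
    (fun z => opp (res z (res z v))) (- theta) (- p) (K * norm v)); rewrite /p; try lra.
    by move=> psi hpsi; rewrite -(cos_neg psi); apply: cos_decreasing_1; lra.
  move=> r psi r0 hpsi.
  have b : Rabs (cos psi) <= cos p.
    rewrite -(cos_neg psi) Rabs_pos_eq; last by apply: cos_ge_0; lra.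
    by apply: cos_decr_1; rewrite /p; lra.
  split; last exact: H.
  by apply: res_qdiff; apply: outside_dir => //; lra.
- apply: (ray_int_rotate V S separating e theta h ee hh _
    (fun z => opp (res z (res z v))) p theta (K * norm v)); rewrite /p; try lra.
    by move=> psi hpsi; apply: cos_decreasing_1; lra.
  move=> r psi r0 hpsi.
  have b : Rabs (cos psi) <= cos p.
    rewrite Rabs_pos_eq; last by apply: cos_ge_0; lra.
    by apply: cos_decr_1; rewrite /p; lra.
  split; last exact: H.
  by apply: res_qdiff; apply: outside_dir => //; lra.
Qed.

Variable phi : R.
Hypothesis hphi : omega < phi < theta.

Let hphi' : omega < phi < PI / 2. Proof. lra. Qed.
Let hcos : cos theta < cos phi. Proof. by apply: cos_decreasing_1; lra. Qed.

Lemma calc_linear : complex_linear (calc phi).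
Proof.
have [K [K0 hK]] := res_rays_bounded phi hphi'.
have [Ch [Ch0 hC]] := sec_int_norm V S e theta h ee hh phi hcos.
have CC c c' v : cact S c (cact S c' v) = cact S c' (cact S c v) by vring S.
have act c v : calc phi (cact S c v) = cact S c (calc phi v).
  have k := sec_int_linear V S e theta h ee hh phi hcos _ _ (cact S c)
    (is_linear_cact S c) (CC c) (hK v).
  rewrite /calc -k.
  have [E1 E2] := on_rays phi (fun z => res z (cact S c v) = cact S c (res z v)) hphi'
    (fun z hz => proj2 (res_linear _ _ hres z hz) c v).
  exact: (sec_int_ext V S e theta h ee hh phi hcos _ _ _ (hK _) E1 E2).
split => //; split.
- move=> v w.
  have k := sec_int_plus V S e theta h ee hh phi hcos _ _ _ _ (hK v) (hK w).
  rewrite /calc -k.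
  have [E1 E2] := on_rays phi (fun z => res z (plus v w) = plus (res z v) (res z w)) hphi'
    (fun z hz => linear_plus _ (proj1 (res_linear _ _ hres z hz)) v w).
  exact: (sec_int_ext V S e theta h ee hh phi hcos _ _ _ (hK _) E1 E2).
- by move=> a v; rewrite -!(cact_real _ S) act.
- exists (Ch * K + 1); split; first by have := Rmult_le_pos _ _ Ch0 K0; lra.
  move=> v; apply: Rle_trans (hC _ _ (hK v)) _.
  by have := norm_ge_0 v; nra.
Qed.

Lemma calc_commute (L : V -> V) : complex_linear L ->
  (forall z v, outside omega z -> L (res z v) = res z (L v)) ->
  forall v, calc phi (L v) = L (calc phi v).
Proof.
move=> [hL LC] hcomm v.
have [K [K0 hK]] := res_rays_bounded phi hphi'.
have k := sec_int_linear V S e theta h ee hh phi hcos _ _ L hL LC (hK v).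
rewrite /calc -k; symmetry.
have [E1 E2] := on_rays phi (fun z => res z (L v) = L (res z v)) hphi' (fun z hz => eq_sym (hcomm z v hz)).
symmetry; exact: (sec_int_ext V S e theta h ee hh phi hcos _ _ _ (hK _) E1 E2).
Qed.

Lemma calc_res z v : outside omega z -> calc phi (res z v) = res z (calc phi v).
Proof.
move=> hz; apply: calc_commute; first exact: (res_linear _ _ hres).
by move=> w u hw; apply: res_comm.
Qed.

End OneSide.

Lemma calc_comm e1 e2 theta1 theta2 h1 h2 phi1 phi2 v :
  e1 * e1 = 1 -> e2 * e2 = 1 ->
  omega < theta1 < PI / 2 -> omega < theta2 < PI / 2 ->
  sector_fun e1 theta1 h1 -> sector_fun e2 theta2 h2 ->
  omega < phi1 < theta1 -> omega < phi2 < theta2 ->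
  calc e1 h1 phi1 (calc e2 h2 phi2 v) = calc e2 h2 phi2 (calc e1 h1 phi1 v).
Proof.
move=> ee1 ee2 t1 t2 s1 s2 p1 p2.
apply: (calc_commute e1 ee1 theta1 h1 t1 s1 phi1 p1); first exact: calc_linear s2 _ p2.
by move=> z u hz; apply: calc_res s2 _ p2 _ _ hz.
Qed.

(* The product vanishes because res l (calc 1 g phi v), which only makes sense
   outside the double sector, extends holomorphically in l to the left
   half-plane as the integral of g(s) (l - s)^-1 res s v. *)
Lemma calc_ortho theta1 theta2 h g phi1 phi2 v :
  omega < theta1 < PI / 2 -> omega < theta2 < PI / 2 ->
  sector_fun (-1) theta1 h -> sector_fun 1 theta2 g ->
  omega < phi1 < theta1 -> omega < phi2 < theta2 ->
  calc (-1) h phi1 (calc 1 g phi2 v) = zero.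
Proof.
move=> t1 t2 hh hg p1 p2.
have ee1 : 1 * 1 = 1 by ring.
have eem : (-1) * (-1) = 1 by ring.
have t2' : 0 < theta2 < PI / 2 by lra.
have p2' : omega < phi2 < PI / 2 by lra.
have p1' : omega < phi1 < PI / 2 by lra.
have p2'' : 0 < phi2 < theta2 by lra.
have hcos1 : cos theta1 < cos phi1 by apply: cos_decreasing_1; lra.
have hcos2 : cos theta2 < cos phi2 by apply: cos_decreasing_1; lra.
have [cphi2 cphi2'] := cos_angle phi2 p2'.
have [cphi1 cphi1'] := cos_angle phi1 p1'.
have ct1 : 0 < cos theta1 by apply: cos_gt_0; lra.
have [K [K0 hK]] := res_rays_bounded 1 ee1 phi2 p2'.
pose H l := sec_int V S g (kernel V S l (fun z => res z v)) 1 phi2.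
have resH l : outside omega l -> fst l < 0 -> res l (calc 1 g phi2 v) = H l.
  move=> hl l0; have [Ll LC] := res_linear _ _ hres l hl.
  rewrite -(sec_int_linear V S 1 theta2 g ee1 hg phi2 hcos2 _ _ (res l) Ll LC (hK v)).
  have b1 := rays_bounded_kernel V S l _ phi2 _ l0 cphi2 (hK v).
  have b2 := rays_bounded_kernel_const V S l (opp (res l v)) phi2 l0 cphi2.
  have sum := sec_int_plus V S 1 theta2 g ee1 hg phi2 hcos2 _ _ _ _ b1 b2.
  rewrite (sec_int_kernel_const V S separating theta2 g t2' hg l _ phi2 l0 p2'') plus_zero_r in sum.
  rewrite /H -sum.
  (* The resolvent identity splits the product into two kernels; the one with the constant vector
     [opp (res l v)] integrates to 0 by Cauchy's theorem in the right half-plane. *)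
  have key z : outside omega z -> 0 < fst z -> res l (res z v) =
      plus (kernel V S l (fun z => res z v) z) (kernel V S l (fun _ => opp (res l v)) z).
    move=> hz z0; have m := Cmod_sub_ge l z.
    have n : (l - z)%C <> 0%C by apply: Csub_neq0; lra.
    have e := res_eq _ _ hres _ _ v hl hz.
    have -> : res l (res z v) = cact S (/ (l - z))%C (opp (cact S (z - l)%C (res l (res z v)))).
      by vector_eq S; field.
    by rewrite -e /kernel; vring S.
  (* The seemingly void factor 1 produces the shape that [Re_scale_dir] rewrites. *)
  have [s1 s2] := on_rays 1 ee1 phi2 (fun z => fst z = 1 * fst z /\ outside omega z) p2'
    (fun z hz => conj (eq_sym (Rmult_1_l _)) hz).
  symmetry; apply: (sec_int_ext V S 1 theta2 g ee1 hg phi2 hcos2 _ _ (K * norm v / - fst l + norm (opp (res l v)) / cos phi2)).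
    exact: rays_bounded_plus.
  - move=> r r0; have [e o] := s1 r r0; symmetry; apply: key => //.
    by rewrite e Re_scale_dir // cos_neg; apply: Rmult_lt_0_compat.
  - move=> r r0; have [e o] := s2 r r0; symmetry; apply: key => //.
    by rewrite e Re_scale_dir //; apply: Rmult_lt_0_compat.
have [K1 [K10 hK1]] := res_rays_bounded (-1) eem phi1 p1'.
have [Ch [Ch0 hC]] := sec_int_norm V S 1 theta2 g ee1 hg phi2 hcos2.
have left_dir r psi : fst (RtoC r * dir (-1) psi)%C = - (r * cos psi).
  by have := Re_scale_dir (-1) psi r eem; lra.
have [o1 o2] := on_rays (-1) eem phi1 (outside omega) p1' (fun z hz => hz).
have E : calc (-1) h phi1 (calc 1 g phi2 v) = sec_int V S h H (-1) phi1.
  apply: (sec_int_ext V S (-1) theta1 h eem hh phi1 hcos1 _ _ _ (hK1 _)) => r r0.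
    apply: resH; [exact: o1 | rewrite left_dir cos_neg].
    by have := Rmult_lt_0_compat _ _ r0 cphi1; lra.
  apply: resH; [exact: o2 | rewrite left_dir].
  by have := Rmult_lt_0_compat _ _ r0 cphi1; lra.
rewrite E /sec_int.
have hcos psi : - theta1 < psi < theta1 -> cos theta1 < cos psi.
  move=> hp; case: (Rle_lt_dec 0 psi) => hs; first by apply: cos_decreasing_1; lra.
  by rewrite -(cos_neg psi); apply: cos_decreasing_1; lra.
suff -> : ray_int V S h H (dir (-1) (- phi1)) = ray_int V S h H (dir (-1) phi1).
  exact: minus_eq_zero.
(* The rotation crosses the negative real axis, where only [H] and not the resolvent is available.
   The bound of order [1 / r] holds because [- fst l >= r * cos theta1] on these rays. *)
apply: (ray_int_rotate V S separating (-1) theta1 h eem hh _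
  (fun l => opp (sec_int V S g (kernel V S l (kernel V S l (fun z => res z v))) 1 phi2))
  (- theta1) theta1 (Ch * (K * norm v) / cos theta1)) => //; try lra.
move=> r psi r0 hpsi; have cp := hcos psi hpsi.
have rc := Rmult_lt_compat_l _ _ _ r0 cp.
have rc0 := Rmult_lt_0_compat _ _ r0 ct1.
have neg : fst (RtoC r * dir (-1) psi)%C < 0 by rewrite left_dir; lra.
have q := kernel_sec_qdiff V S theta2 g hg _ phi2 _ _ cphi2 hcos2 (hK v) neg.
split; first exact: q.
apply: Rle_trans (hC _ _ (rays_bounded_kernel V S _ _ phi2 _ neg cphi2 (hK v))) _.
have -> : Ch * (K * norm v) / cos theta1 / r = Ch * (K * norm v) * / (r * cos theta1) by field; lra.
rewrite /Rdiv -Rmult_assoc; apply: Rmult_le_compat_l.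
  by have := norm_ge_0 v => nv; apply: Rmult_le_pos => //; apply: Rmult_le_pos.
by rewrite left_dir Ropp_involutive; apply: Rinv_le_contravar; lra.
Qed.

End Resolvent.

(** * Clifford algebra *)

(** [p] stands for an inner product, [a] and [b] for norms. The choice [x = b], [y = a] gives the
    bound after division by [a * b]; the two other choices refute [p > 0] when [a] or [b] is 0. *)
Lemma cauchy_schwarz_real (a b p : R) : 0 <= a -> 0 <= b ->
  (forall x y, 0 <= x * x * (a * a) - 2 * (x * y * p) + y * y * (b * b)) -> p <= a * b.
Proof.
move=> a0 b0 quad.
case: (Rle_lt_dec p 0) => [p0|p0]; first by have := Rmult_le_pos _ _ a0 b0; lra.
have ha := quad ((b * b + 1) / p) 1; have hb := quad 1 ((a * a + 1) / p).
have e1 : (b * b + 1) / p * 1 * p = b * b + 1 by field; lra.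
have e2 : 1 * ((a * a + 1) / p) * p = a * a + 1 by field; lra.
rewrite e1 in ha; rewrite e2 in hb.
case: (Req_dec a 0) => [za|na]; first by rewrite za in ha *; nra.
case: (Req_dec b 0) => [zb|nb]; first by rewrite zb in hb *; nra.
have ab : 0 < a * b by apply: Rmult_lt_0_compat; lra.
have q := quad b a.
by apply: (Rmult_le_reg_l _ _ _ ab); nra.
Qed.

Module CliffordFacts.
From mathcomp Require Import all_boot all_algebra Rstruct ring.
Import GRing.Theory Num.Theory.
Local Open Scope ring_scope.

Section Facts.
Variable n : nat.
Implicit Types s t J : clifford n.

(** The scalar part is a trace: only pairs of equal basis elements contribute, with the sign
    [csign A A] in either order. *)
Lemma Sc_mulC s t : Sc (s * t) = Sc (t * s).
Proof.
rewrite /Sc !ffunE; apply: eq_bigr => A _.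
by rewrite symdiffC symdiff0l; ring.
Qed.

Lemma cconjD s t : cconj (s + t) = cconj s + cconj t.
Proof. by apply/ffunP => A; rewrite !ffunE mulrDr. Qed.

Lemma cconjZ (a : R) s : cconj (a *: s) = a *: cconj s.
Proof.
apply/ffunP => A; rewrite !ffunE; rewrite /GRing.scale /=; ring.
Qed.

Lemma cconj1 : cconj 1 = 1 :> clifford n.
Proof.
apply/ffunP => A; rewrite !ffunE; case: eqP => [->|_]; last by rewrite mulr0.
by rewrite csign0l mulr1.
Qed.

Lemma imag_unit_conj J : imag_unit J -> cconj J = - J.
Proof.
move=> [x [_ ->]]; rewrite /cvector.
have : cconj (0 : clifford n) = 0 by apply/ffunP => A; rewrite !ffunE mulr0.
move=> c0; rewrite (big_morph _ cconjD c0) -sumrN; apply: eq_bigr => i _.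
by rewrite cconjZ cconj_gen scalerN.
Qed.

Lemma imag_unit_sq J : imag_unit J -> J * J = -1.
Proof.
move=> [x [x1 ->]]; rewrite /cvector.
pose E := \sum_i \sum_j (x i * x j) *: (cgen i * cgen j).
have -> : (\sum_i x i *: cgen i) * (\sum_i x i *: cgen i) = E :> clifford n.
  rewrite mulr_suml; apply: eq_bigr => i _; rewrite mulr_sumr; apply: eq_bigr => j _.
  by rewrite -scalerAl -scalerAr scalerA.
(* In the sum of [E] and its copy with exchanged indices the mixed terms cancel by anticommutation,
   and each diagonal term contributes [-2 x_i^2]. *)
have E2 : E + E = -1 + -1.
  rewrite {2}/E exchange_big -big_split /=.
  under eq_bigr => i _ do rewrite -big_split /=.
  have -> : -1 + -1 = \sum_i (x i ^+ 2) *: ((-1 + -1) : clifford n).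
    by rewrite -scaler_suml x1 scale1r.
  apply: eq_bigr => i _; rewrite (bigD1 i) //= big1 ?addr0.
    by rewrite cgen_sq -scalerDr expr2.
  move=> j ji; rewrite (cgen_anticomm ji) scalerN [x j * _]mulrC addrN //.
apply/ffunP => A; move/ffunP/(_ A): E2; rewrite !ffunE => E2.
have half (a b : R) : a + a = b + b -> a = b.
  by move=> h; have : Rplus a a = Rplus b b := h; lra.
exact: half.
Qed.

Lemma imag_unit_Sc J : imag_unit J -> Sc J = 0.
Proof.
move=> [x [_ ->]]; rewrite /Sc /cvector sum_ffunE big1 // => i _.
rewrite !ffunE; case: eqP => [h|_]; last by rewrite scaler0.
by have := set11 i; rewrite -h inE.
Qed.

Lemma imag_unit_ex : (0 < n)%coq_nat -> exists J, @imag_unit n J.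
Proof.
move=> /ltP n0; pose i0 := Ordinal n0.
exists (cvector (fun i => (i == i0)%:R)), (fun i => (i == i0)%:R); split => //.
rewrite (bigD1 i0) // big1 => [|i /negPf ni]; last by rewrite ni expr0n.
cbv beta; rewrite eqxx expr1n; exact: addr0.
Qed.

Lemma slice_mul J a b c d : imag_unit J ->
  slice J a b * slice J c d = slice J (a * c - b * d) (a * d + b * c).
Proof.
move=> hJ; rewrite /slice mulrDl !mulrDr -!scalerAl -!scalerAr !mul1r !mulr1.
rewrite !scalerA (imag_unit_sq _ hJ).
apply/ffunP => A; rewrite !ffunE /GRing.scale /= RminusE RplusE !RmultE; case: (A == set0) => /=; ring.
Qed.

Lemma sliceN J a b : - slice J a b = slice J (- a) (- b).
Proof. by rewrite /slice !scaleNr opprD. Qed.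

Lemma sliceZ J r a b : r *: slice J a b = slice J (r * a) (r * b).
Proof. by rewrite /slice scalerDr !scalerA. Qed.

Lemma slice0 J : slice J 0 0 = 0.
Proof. by rewrite /slice !scale0r addr0. Qed.

Lemma oppJ_slice J : - J = slice J 0 (-1).
Proof. by rewrite /slice scale0r add0r scaleN1r. Qed.

Lemma slice_conj J a b : imag_unit J -> cconj (slice J a b) = slice J a (- b).
Proof.
move=> hJ; rewrite /slice cconjD !cconjZ cconj1 (imag_unit_conj _ hJ).
by rewrite scalerN scaleNr.
Qed.

Lemma Sc_D s t : Sc (s + t) = Sc s + Sc t.
Proof. by rewrite /Sc ffunE. Qed.

Lemma Sc_N s : Sc (- s) = - Sc s.
Proof. by rewrite /Sc ffunE. Qed.

Lemma Sc_Z (a : R) s : Sc (a *: s) = a * Sc s.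
Proof. by rewrite /Sc ffunE. Qed.

Lemma Sc_1 : Sc (1 : clifford n) = 1.
Proof. by rewrite /Sc ffunE eqxx. Qed.

Lemma Sc_slice J a b : imag_unit J -> Sc (slice J a b) = a.
Proof.
move=> hJ; rewrite /slice Sc_D !Sc_Z Sc_1 (imag_unit_Sc _ hJ).
by rewrite mulr1 mulr0 addr0.
Qed.

Lemma cnorm_conj s : cnorm s = sqrt (Sc (cconj s * s)).
Proof.
rewrite /cnorm; congr sqrt; rewrite /Sc ffunE; apply: eq_bigr => A _.
rewrite symdiffC symdiff0l ffunE.
have := csign_symdiffl A A A; rewrite symdiffxx csign0l => e.
by rewrite -[LHS]mul1r e; ring.
Qed.

Lemma cnorm_slice J a b : imag_unit J -> cnorm (slice J a b) = Cmod (a, b).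
Proof.
move=> hJ; rewrite cnorm_conj slice_conj // slice_mul // Sc_slice // /Cmod /=.
congr sqrt; rewrite !Rmult_1_r.
by change (a * a - - b * b = a * a + b * b); ring.
Qed.

Lemma paravector_slice J a b : imag_unit J -> paravector (slice J a b).
Proof.
move=> [x [_ ->]]; exists a, (fun i => b * x i).
by rewrite /slice /cvector scaler_sumr; congr (_ + _); apply: eq_bigr => i _; rewrite scalerA.
Qed.

Lemma cnorm_N s : cnorm (- s) = cnorm s.
Proof.
by rewrite /cnorm; congr sqrt; apply: eq_bigr => A _; rewrite ffunE sqrrN.
Qed.

Lemma paravector_N s : paravector s -> paravector (- s).
Proof.
move=> [a [x ->]]; exists (- a), (fun i => - x i).
rewrite opprD scaleNr /cvector -sumrN; congr (_ + _).
by apply: eq_bigr => i _; rewrite scaleNr.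
Qed.

Lemma sum_sq_ge0 s : Rle 0 (\sum_A s A ^+ 2).
Proof. by apply/RleP; apply: sumr_ge0 => A _; apply: sqr_ge0. Qed.

Lemma cnorm_ge0 s : Rle 0 (cnorm s).
Proof. exact: sqrt_pos. Qed.

Lemma cnorm_sq s : Rmult (cnorm s) (cnorm s) = \sum_A s A ^+ 2.
Proof. exact: sqrt_sqrt (sum_sq_ge0 s). Qed.

Lemma Sc_le_cnorm s : Rle (Rabs (Sc s)) (cnorm s).
Proof.
rewrite -sqrt_Rsqr_abs; apply: sqrt_le_1_alt; apply/RleP.
rewrite (bigD1 set0) //= /Rsqr /Sc -[X in X <= _]addr0 expr2; apply: lerD => //.
by apply: sumr_ge0 => A _; apply: sqr_ge0.
Qed.

Definition cdot s t : R := \sum_A s A * t A.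

Lemma cdot_le s t : Rle (cdot s t) (Rmult (cnorm s) (cnorm t)).
Proof.
apply: cauchy_schwarz_real; [exact: cnorm_ge0 | exact: cnorm_ge0 | move=> x y].
rewrite !cnorm_sq.
have -> : Rplus (Rminus (Rmult (Rmult x x) (\sum_A s A ^+ 2)) (Rmult 2 (Rmult (Rmult x y) (cdot s t))))
    (Rmult (Rmult y y) (\sum_A t A ^+ 2)) = \sum_A (x * s A - y * t A) ^+ 2.
  change (x * x * (\sum_A s A ^+ 2) - (1 + 1) * (x * y * (\sum_A s A * t A)) + y * y * (\sum_A t A ^+ 2) = \sum_A (x * s A - y * t A) ^+ 2).
  rewrite !mulr_sumr -sumrB -big_split /=; apply: eq_bigr => A _; ring.
by apply/RleP; apply: sumr_ge0 => A _; apply: sqr_ge0.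
Qed.

Lemma cnorm_triangle s t : Rle (cnorm (s + t)) (Rplus (cnorm s) (cnorm t)).
Proof.
have a0 := cnorm_ge0 s; have b0 := cnorm_ge0 t.
apply: Rsqr_incr_0_var; last by lra.
rewrite /Rsqr cnorm_sq.
have -> : \sum_A (s + t) A ^+ 2 = Rplus (Rplus (Rmult (cnorm s) (cnorm s)) (Rmult 2 (cdot s t))) (Rmult (cnorm t) (cnorm t)).
  rewrite !cnorm_sq /cdot.
  change (\sum_A (s + t) A ^+ 2 = \sum_A s A ^+ 2 + (1 + 1) * (\sum_A s A * t A) + \sum_A t A ^+ 2).
  by rewrite !mulr_sumr -!big_split /=; apply: eq_bigr => A _; rewrite ffunE; ring.
by have := cdot_le s t; lra.
Qed.

Lemma slice_right J a b : slice J a b = a%:A + J * b%:A.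
Proof. by rewrite /slice -scalerAr mulr1. Qed.

Lemma real_comm (a : R) s : a%:A * s = s * a%:A.
Proof. by rewrite -scalerAl -scalerAr mul1r mulr1. Qed.

Lemma mul_real (a : R) s : s * a%:A = a *: s.
Proof. by rewrite -scalerAr mulr1. Qed.

Lemma slice_real J a : slice J a 0 = a%:A.
Proof. by rewrite /slice scale0r addr0. Qed.

Lemma Nreal1 : (-1)%:A = -1 :> clifford n.
Proof. exact: scaleN1r. Qed.

Lemma Sc_conj s : Sc (cconj s) = Sc s.
Proof. by rewrite /Sc ffunE csign0l mul1r. Qed.

Lemma cmulrA s t u : s * (t * u) = s * t * u.
Proof. exact: mulrA. Qed.

Lemma cmulr1 s : s * 1 = s.
Proof. exact: mulr1. Qed.

Lemma cmulr0 s : s * 0 = 0.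
Proof. exact: mulr0. Qed.

Lemma csubK s t : s - t + t = s.
Proof. exact: subrK. Qed.

End Facts.
End CliffordFacts.

(** * Right Hilbert modules and S-resolvents *)

Import CliffordFacts.

Section HilbertModule.
Variables (n : nat) (V : rightHilbertModule n).
Implicit Types (v w : V) (J s t : clifford n).

Lemma ract_slice v J x y :
  ract v (slice J x y) = plus (scal x v) (scal y (ract v J)).
Proof. by rewrite slice_right ractDr ractM !ract_real. Qed.

Lemma ract_scal (a : R) v s : ract (scal a v) s = scal a (ract v s).
Proof. by rewrite -!ract_real -!ractM real_comm. Qed.

Lemma ract_imag v J : imag_unit J -> ract (ract v J) J = opp v.
Proof.
by move=> hJ; rewrite -ractM imag_unit_sq // -Nreal1 ract_real (scal_opp_one v).
Qed.

(** As the scalar part is cyclic, the squared norm of [v s] is the scalar part of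
    [ip v v * s * cconj s], and [s * cconj s] is the real number [|s|^2] for [s] in the plane of
    [J]. *)
Lemma norm_ract_slice v J x y : imag_unit J ->
  norm (ract v (slice J x y)) = Cmod (x, y) * norm v.
Proof.
move=> hJ; apply: Rsqr_inj.
- exact: norm_ge_0.
- by apply: Rmult_le_pos; [apply: Cmod_ge_0 | apply: norm_ge_0].
have sq (u : V) : Rsqr (norm u) = Sc (ip u u) by rewrite -norm_sq /Rsqr /=; ring.
rewrite Rsqr_mult !sq ip_ractl ip_ractr Sc_mulC -cmulrA slice_conj // slice_mul //.
have -> : x * - y + y * x = 0 by ring.
rewrite slice_real mul_real.
have e := Sc_Z n (x * x - y * - y) (ip v v); refine (eq_trans e _).
change ((x * x - y * - y) * Sc (ip v v) = Rsqr (Cmod (x, y)) * Sc (ip v v)).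
by rewrite /Rsqr /Cmod sqrt_sqrt /=; [ring | nra].
Qed.

Lemma jay_norm_proof J (hJ : imag_unit J) (z : C) v :
  norm (plus (scal (fst z) v) (scal (snd z) (ract v J))) = Cmod z * norm v.
Proof. by rewrite -ract_slice norm_ract_slice //; case: z. Qed.

Definition slice_structure J (hJ : imag_unit J) : complex_structure V :=
  ComplexStructure V (fun v => ract v J) (fun v w => ractDl v w J)
    (fun a v => ract_scal a v J) (fun v => ract_imag v J hJ) (jay_norm_proof J hJ).

Lemma cact_slice J (hJ : imag_unit J) (z : C) v :
  cact (slice_structure J hJ) z v = ract v (slice J (fst z) (snd z)).
Proof. by rewrite ract_slice. Qed.

Lemma Sc_ip_sym v w : Sc (ip v w) = Sc (ip w v).
Proof. by rewrite -ip_conj Sc_conj. Qed.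

Lemma Sc_ip_le v w : Sc (ip v w) <= norm v * norm w.
Proof.
apply: cauchy_schwarz_real; [exact: norm_ge_0 | exact: norm_ge_0 | move=> x y].
have sq (u : V) : Sc (ip u u) = norm u * norm u by rewrite -norm_sq /=; ring.
have := Rle_0_sqr (norm (plus (scal x v) (scal (- y) w))); rewrite /Rsqr -!sq.
rewrite ipDl !ipDr !ip_scall !ip_scalr !Sc_D !Sc_Z (Sc_ip_sym w v).
set a := Sc _; set b := Sc _; set c := Sc _ => h.
have : 0 <= x * (x * a) + x * (- y * b) + (- y * (x * b) + - y * (- y * c)) by [].
by rewrite /a /b /c; lra.
Qed.

Lemma is_linear_ip v : is_linear (fun w : V => Sc (ip v w)).
Proof.
split.
- by move=> x y; rewrite ipDr Sc_D.
- by move=> a x; rewrite ip_scalr Sc_Z.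
exists (norm v + 1); split; first by have := norm_ge_0 v; lra.
move=> x; have h1 := Sc_ip_le v x; have h2 := Sc_ip_le v (opp x).
have e : Sc (ip v (opp x)) = - Sc (ip v x).
  by rewrite -(scal_opp_one x) ip_scalr; refine (eq_trans (Sc_Z n _ _) _);
    change (- 1 * Sc (ip v x) = - Sc (ip v x)); ring.
rewrite e norm_opp in h2.
have nx := norm_ge_0 x.
by apply: Rabs_le; lra.
Qed.

(** The test functional is the inner product with [v] itself, bounded by Cauchy-Schwarz. *)
Lemma module_separating v : (forall l : V -> R, is_linear l -> l v = 0) -> v = zero.
Proof.
move=> h; apply: norm_eq_zero.
have := norm_sq v; rewrite (h _ (is_linear_ip v)) /=; have := norm_ge_0 v; nra.
Qed.

End HilbertModule.

From mathcomp Require Import nmodule ssralg Rstruct.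
Delimit Scope ring_scope with ring.
Delimit Scope R_scope with R.
Open Scope R_scope.

(** * Double sectors described by scalar part and norm *)

Section Sectors.
Variable n : nat.
Implicit Types (s J : clifford n).

Lemma Sc_cnorm_ratio s : 0 < cnorm s -> -1 <= Sc s / cnorm s <= 1.
Proof.
move=> s0; have := Sc_le_cnorm n s => /Rabs_le_between [h1 h2].
have i0 : 0 < / cnorm s by apply: Rinv_0_lt_compat.
have e : cnorm s * / cnorm s = 1 by apply: Rinv_r; lra.
by rewrite /Rdiv; split; nra.
Qed.

Lemma sector_Sc theta s : 0 < theta < PI / 2 -> sector theta s ->
  cos theta * cnorm s < Sc s.
Proof.
move=> ht [_ [_ hA]]; have s0 := cnorm_ge0 n s.
have [a0 api] := acos_bound (Sc s / cnorm s).
rewrite /Arg Rabs_pos_eq // in hA.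
(* If the norm is 0, then [Sc s = 0] and the quotient in [Arg] is 0, so [Arg s] takes the value
   [acos 0 = PI / 2], which exceeds [theta]. *)
case: (Rle_lt_or_eq_dec _ _ s0) => [sp|sz]; last first.
  have := Sc_le_cnorm n s; rewrite -sz => /Rabs_le_between hS.
  have S0 : Sc s = 0 by lra.
  by rewrite S0 /Rdiv Rmult_0_l acos_0 in hA; lra.
have hu := Sc_cnorm_ratio s sp.
have := cos_decreasing_1 (acos (Sc s / cnorm s)) theta.
rewrite cos_acos // => h.
have lt : cos theta < Sc s / cnorm s by apply: h; lra.
have -> : Sc s = Sc s / cnorm s * cnorm s by field; lra.
exact: Rmult_lt_compat_r.
Qed.

Lemma cnorm0 J : imag_unit J -> cnorm (0%ring : clifford n) = 0.
Proof. by move=> hJ; rewrite -(slice0 n J) cnorm_slice // Cmod_0. Qed.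

Lemma Sc_sector theta s J : imag_unit J -> 0 < theta < PI / 2 -> paravector s ->
  cos theta * cnorm s < Sc s -> sector theta s.
Proof.
move=> hJ ht ps h; have s0 := cnorm_ge0 n s.
have ct : 0 < cos theta by apply: cos_gt_0; lra.
have Sp : 0 < Sc s by have := Rmult_le_pos _ _ (Rlt_le _ _ ct) s0; lra.
have sp : 0 < cnorm s by have := Rle_trans _ _ _ (Rle_abs _) (Sc_le_cnorm n s); lra.
split => //; split; first by move=> e; rewrite e (cnorm0 J hJ) in sp; lra.
have hu := Sc_cnorm_ratio s sp.
have [a0 api] := acos_bound (Sc s / cnorm s).
rewrite /Arg Rabs_pos_eq //; apply: cos_decreasing_0; try lra.
rewrite cos_acos //.
apply: (Rmult_lt_reg_r (cnorm s)) => //.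
by have -> : Sc s / cnorm s * cnorm s = Sc s by field; lra.
Qed.

Lemma double_sector_Sc theta s : 0 < theta < PI / 2 -> double_sector theta s ->
  cos theta * cnorm s < Rabs (Sc s).
Proof.
move=> ht [] /(sector_Sc _ _ ht); first by have := Rle_abs (Sc s); lra.
rewrite cnorm_N Sc_N -Rabs_Ropp => h.
by have h' : cos theta * cnorm s < - Sc s := h; have := Rle_abs (- Sc s); lra.
Qed.

Lemma slice_double_sector theta e J (z : C) : imag_unit J -> 0 < theta < PI / 2 ->
  e = 1 \/ e = -1 -> cos theta * Cmod z < e * fst z ->
  double_sector theta (slice J (fst z) (snd z)).
Proof.
move=> hJ ht he h.
have ps : paravector (slice J (fst z) (snd z)) by apply: paravector_slice.
have nz : cnorm (slice J (fst z) (snd z)) = Cmod z by rewrite cnorm_slice //; case: z {h ps}.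
case: he h => ->; rewrite ?Rmult_1_l => h; [left | right].
  by apply: (Sc_sector _ _ J) => //; rewrite nz Sc_slice.
apply: (Sc_sector _ _ J) => //; first exact: paravector_N.
rewrite cnorm_N nz Sc_N Sc_slice //.
by change (cos theta * Cmod z < - fst z); lra.
Qed.

(** Both sides of the inequality are 1-Lipschitz in [s], so it passes to limits; half of a supposed
    violation serves as [eps]. *)
Lemma pv_closure_Sc theta s : 0 < theta < PI / 2 -> pv_closure (double_sector theta) s ->
  cos theta * cnorm s <= Rabs (Sc s).
Proof.
move=> ht [_ hc]; apply: Rnot_lt_le => h.
have ct : 0 < cos theta by apply: cos_gt_0; lra.
have ct1 : cos theta <= 1 by have := COS_bound theta; lra.
have e0 : 0 < (cos theta * cnorm s - Rabs (Sc s)) / 2 by lra.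
have [t [ht' hd]] := hc _ e0.
have hS := double_sector_Sc _ _ ht ht'.
have t1 := cnorm_triangle n (s - t)%ring t.
have t2 := Sc_le_cnorm n (s - t)%ring.
have eS : Sc (s - t)%ring = Sc s - Sc t by refine (eq_trans (Sc_D n s (- t)%ring) _); rewrite Sc_N.
have es : (s - t + t)%ring = s by apply: csubK.
rewrite es in t1; rewrite eS in t2.
have t3 := Rabs_triang_inv (Sc t) (Sc s).
rewrite Rabs_minus_sym in t2.
have : cos theta * cnorm s <= cos theta * cnorm (s - t)%ring + cos theta * cnorm t.
  by rewrite -Rmult_plus_distr_l; apply: Rmult_le_compat_l; lra.
have : cos theta * cnorm (s - t)%ring <= 1 * cnorm (s - t)%ring.
  by apply: Rmult_le_compat_r => //; apply: cnorm_ge0.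
by lra.
Qed.

End Sectors.

(** * The resolvent of [T] on one slice *)

Section Resolvent.
Variables (n : nat) (V : rightHilbertModule n) (T : operator V).
Implicit Types (v w : V).
Hypothesis Tlin : right_linear T.

Section Slice.
Variables (J : clifford n) (hJ : imag_unit J).
Let S := slice_structure n V J hJ.

Lemma T_cact (c : C) v : dom T v ->
  dom T (cact S c v) /\ T (cact S c v) = cact S c (T v).
Proof.
move=> dv; have [_ [_ h]] := Tlin; rewrite !cact_slice; exact: h.
Qed.

Lemma T_plus v w : dom T v -> dom T w ->
  dom T (plus v w) /\ T (plus v w) = plus (T v) (T w).
Proof. by move=> dv dw; have [_ [h _]] := Tlin; apply: h. Qed.

Lemma T_minus v w : dom T v -> dom T w ->
  dom T (minus v w) /\ T (minus v w) = minus (T v) (T w).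
Proof.
move=> dv dw; have [dw' e] := T_cact (- (1))%C w dw.
have en u : minus v u = plus v (cact S (- (1))%C u) by vring S.
rewrite en; have [d ->] := T_plus _ _ dv dw'; split => //.
by rewrite e; vring S.
Qed.

Definition res_at (z : C) v : V := resolvent T (slice J (fst z) (snd z)) v.

Variable z : C.
Let s := slice J (fst z) (snd z).
Hypothesis hs : rho_S T s.

Let cnorm_s : cnorm s = Cmod z.
Proof. by rewrite /s cnorm_slice //; case: (z). Qed.
Let Sc_s : Sc s = fst z.
Proof. by rewrite /s Sc_slice. Qed.

Lemma op_Q_ex v : exists w, (dom T w /\ dom T (T w)) /\
  plus (minus (T (T w)) (scal (2 * fst z) (T w))) (scal (Cmod z ^ 2) w) = v.
Proof.
have [_ [_ [_ [hd _]]]] := hs; have [w [hw e]] := hd v.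
rewrite /= Sc_s cnorm_s in e; move: hw => [[[d1 d2] _] _].
by exists w.
Qed.

Lemma op_Q_inj w : dom T w -> dom T (T w) ->
  plus (minus (T (T w)) (scal (2 * fst z) (T w))) (scal (Cmod z ^ 2) w) = zero ->
  w = zero.
Proof.
move=> d1 d2 e; have [_ [hi _]] := hs.
have d0 : dom T (@zero V) by have [] := Tlin.
have T0 : T (@zero V) = zero.
  have [_] := T_cact 0 zero d0.
  have -> : cact S 0 zero = zero by vring S.
  by move=> ->; vring S.
apply: hi => //=.
  by rewrite T0.
rewrite Sc_s cnorm_s e T0; change (T (@zero V)) with (T zero); rewrite T0.
by vring S.
Qed.

Lemma Cmod2E : RtoC (Cmod z ^ 2) = (z * Cconj z)%C.
Proof. by rewrite -Cmod2_conj RtoC_pow. Qed.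

Lemma Re2E : RtoC (2 * fst z) = (z + Cconj z)%C.
Proof. by rewrite /RtoC /Cplus /Cconj; case: (z) => x y /=; congr pair; ring. Qed.

(** In the plane of [J] the quadratic polynomial factors as [(z - T) (conj z - T)], so [(conj z - T)
    Q_s[T]^-1] is a right inverse of [z - T]. *)
Lemma res_at_explicit v w : dom T w -> dom T (T w) ->
  plus (minus (T (T w)) (scal (2 * fst z) (T w))) (scal (Cmod z ^ 2) w) = v ->
  dom T (minus (cact S (Cconj z) w) (T w)) /\
  minus (cact S z (minus (cact S (Cconj z) w) (T w))) (T (minus (cact S (Cconj z) w) (T w))) = v.
Proof.
move=> d1 d2 <-; have [d3 e3] := T_cact (Cconj z) w d1.
have [d4 e4] := T_minus _ _ d3 d2; split => //.
rewrite e4 e3 -!(cact_real _ S) Cmod2E Re2E.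
by vring S.
Qed.

(** If [T u = z u], then [T^2 u = z^2 u], and [z] is a root of the quadratic polynomial; hence
    [Q_s[T] u = 0]. *)
Lemma resolvent_inj u : dom T u -> minus (cact S z u) (T u) = zero -> u = zero.
Proof.
move=> du e.
have eT : T u = cact S z u.
  have -> : T u = minus (cact S z u) (minus (cact S z u) (T u)) by vring S.
  by rewrite e; vring S.
have [dz ez] := T_cact z u du.
apply: op_Q_inj => //; first by rewrite eT.
rewrite eT ez eT -!(cact_real _ S) Cmod2E Re2E.
by vring S.
Qed.

(** [op_inv] is a definite description, so existence and uniqueness of the preimage must be in hand
    before its value is known. *)
Lemma resolvent_unique u v : dom T u -> minus (cact S z u) (T u) = v -> res_at z v = u.
Proof.
move=> du e.
have ex : exists! x, dom (op_sub (op_IR V s) T) x /\ op_sub (op_IR V s) T x = v.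
  exists u; split.
    by split => //=; rewrite -cact_slice.
  move=> u' [[_ du'] /= e']; rewrite -(cact_slice n V J hJ) -/S in e'.
  have [d3 e3] := T_minus u u' du du'.
  have h : minus u u' = zero.
    apply: resolvent_inj => //; rewrite e3.
    have -> : minus (cact S z (minus u u')) (minus (T u) (T u')) =
      minus (minus (cact S z u) (T u)) (minus (cact S z u') (T u')) by vring S.
    by rewrite e e'; vring S.
  have -> : u = plus (minus u u') u' by vring S.
  by rewrite h plus_zero_l.
have [[_ d1] /= e1] := iota_correct _ ex.
rewrite -(cact_slice n V J hJ) -/S in e1.
rewrite /res_at /resolvent /=.
set x := iota _ in d1 e1 *.
have [d3 e3] := T_minus x u d1 du.
have h : minus x u = zero.
  apply: resolvent_inj => //; rewrite e3.
  have -> : minus (cact S z (minus x u)) (minus (T x) (T u)) =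
    minus (minus (cact S z x) (T x)) (minus (cact S z u) (T u)) by vring S.
  by rewrite e e1; vring S.
have -> : x = plus (minus x u) u by vring S.
by rewrite h plus_zero_l.
Qed.

Lemma resolvent_spec v : dom T (res_at z v) /\
  minus (cact S z (res_at z v)) (T (res_at z v)) = v.
Proof.
have [w [[d1 d2] e]] := op_Q_ex v; have [d3 e3] := res_at_explicit v w d1 d2 e.
by rewrite (resolvent_unique _ v d3 e3).
Qed.

Lemma resolvent_dom v : dom (resolvent T s) v.
Proof.
have [d e] := resolvent_spec v; exists (res_at z v); split => //=.
by rewrite -(cact_slice n V J hJ).
Qed.

End Slice.
End Resolvent.

Section SliceResolvent.
Variables (n : nat) (V : rightHilbertModule n) (T : operator V) (omega : R).
Hypothesis homega : 0 < omega < PI / 2.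
Hypothesis Tbis : bisectorial T omega.

Let Tlin : right_linear T. Proof. by have [[]] := Tbis. Qed.

Section OneSlice.
Variables (J : clifford n) (hJ : imag_unit J).
Let S := slice_structure n V J hJ.

Lemma rho_outside z : outside omega z -> rho_S T (slice J (fst z) (snd z)).
Proof.
move=> hz; have [_ [hsig _]] := Tbis.
have ps : paravector (slice J (fst z) (snd z)) by apply: paravector_slice.
apply: NNPP => nrho.
have := pv_closure_Sc n _ _ homega (hsig _ (conj ps nrho)).
rewrite cnorm_slice // Sc_slice // -surjective_pairing.
by rewrite /outside in hz; lra.
Qed.

Lemma slice_res_bound phi : omega < phi < PI / 2 -> exists K, 0 <= K /\
  forall z (v : V), 0 < Cmod z -> Rabs (fst z) <= cos phi * Cmod z ->
    norm (res_at n V T J z v) <= K / Cmod z * norm v.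
Proof.
move=> hphi; have [_ [_ hb]] := Tbis; have [K [K0 H]] := hb phi hphi.
have hphi' : 0 < phi < PI / 2 by lra.
exists K; split => // z v z0 hz.
have nz : cnorm (slice J (fst z) (snd z)) = Cmod z.
  by rewrite cnorm_slice // -surjective_pairing.
have oz : outside omega z.
  rewrite /outside; have [_] := cos_angle omega homega phi hphi; nra.
have := H (slice J (fst z) (snd z)); rewrite nz; apply.
- exact: paravector_slice.
- by move=> e; rewrite e (cnorm0 n J hJ) in nz; lra.
- by move=> /(double_sector_Sc n _ _ hphi'); rewrite nz Sc_slice //; lra.
- exact: (resolvent_dom n V T Tlin J hJ z (rho_outside z oz)).
Qed.

Lemma slice_pseudo_resolvent : pseudo_resolvent V S omega (res_at n V T J).
Proof.
have spec z (hz : outside omega z) v := resolvent_spec n V T Tlin J hJ z (rho_outside z hz) v.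
have uniq z (hz : outside omega z) u v := resolvent_unique n V T Tlin J hJ z (rho_outside z hz) u v.
split; last exact: slice_res_bound.
- move=> z hz.
  have act c v : res_at n V T J z (cact S c v) = cact S c (res_at n V T J z v).
    have [d e] := spec z hz v; have [d' e'] := T_cact n V T Tlin J hJ c _ d.
    apply: uniq => //; rewrite e' -{3}e; vring S.
  split => //; split.
  + move=> v w; have [d1 e1] := spec z hz v; have [d2 e2] := spec z hz w.
    have [d' e'] := T_plus n V T Tlin _ _ d1 d2.
    apply: uniq => //; rewrite e' -{3}e1 -{3}e2; vring S.
  + by move=> a v; rewrite -!(cact_real _ S) act.
  have [phi [hphi qc]] := outside_angle omega homega z hz.
  have [K [K0 H]] := slice_res_bound phi hphi.
  have z0 := outside_neq0 omega z hz.
  exists (K / Cmod z + 1); split.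
    have : 0 <= K / Cmod z by apply: Rmult_le_pos => //; apply: Rlt_le; apply: Rinv_0_lt_compat.
    lra.
  move=> v; have := H z v z0 (Rlt_le _ _ qc); have := norm_ge_0 v.
  by set x := norm v; set y := norm _; move=> *; rewrite Rmult_plus_distr_r; lra.
- move=> z w v hz hw.
  have [d1 e1] := spec w hw v; set u := res_at n V T J w v in d1 e1 *.
  have [d2 e2] := spec z hz u; set x := res_at n V T J z u in d2 e2 *.
  have [d3 e3] := T_cact n V T Tlin J hJ (w - z)%C x d2.
  have [d4 e4] := T_plus n V T Tlin _ _ d1 d3.
  (* This candidate works because [(z - T) u + (w - z) u = (w - T) u = v]. *)
  have -> : res_at n V T J z v = plus u (cact S (w - z)%C x).
    apply: uniq => //; rewrite e4 e3 -e1.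
    have eT : T x = minus (cact S z x) u by rewrite -e2; vring S.
    by rewrite eT; vring S.
  by vring S.
Qed.

End OneSlice.

(* The contributions of the conjugate points z and z^* combine to an expression in
   w = Q_s[T]^-1 v and T w with real coefficients, which does not mention J. *)
Lemma slice_pair J (hJ : imag_unit J) (h : C -> C) z r (v w : V) :
  0 < r -> outside omega z -> h (Cconj z) = Cconj (h z) ->
  dom T w -> dom T (T w) ->
  plus (minus (T (T w)) (scal (2 * fst z) (T w))) (scal (Cmod z ^ 2) w) = v ->
  minus (scal (/ r) (ray_fun V (slice_structure n V J hJ) h (fun z => res_at n V T J z v) (Cconj z)))
    (scal (/ r) (ray_fun V (slice_structure n V J hJ) h (fun z => res_at n V T J z v) z)) =
  scal (/ r) (plus (scal (-2 * (fst z ^ 2 + snd z ^ 2) * snd (h z)) w)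
    (scal (2 * (fst z * snd (h z) + snd z * fst (h z))) (T w))).
Proof.
move=> r0 hz hc d1 d2 e.
have hz' : outside omega (Cconj z) by rewrite /outside Cmod_conj.
have [d3 e3] := res_at_explicit n V T Tlin J hJ z v w d1 d2 e.
have ec : plus (minus (T (T w)) (scal (2 * fst (Cconj z)) (T w))) (scal (Cmod (Cconj z) ^ 2) w) = v.
  by rewrite Cmod_conj.
have [d4 e4] := res_at_explicit n V T Tlin J hJ (Cconj z) v w d1 d2 ec.
rewrite /ray_fun (resolvent_unique n V T Tlin J hJ z (rho_outside J hJ z hz) _ v d3 e3).
rewrite (resolvent_unique n V T Tlin J hJ _ (rho_outside J hJ _ hz') _ v d4 e4) hc.
rewrite Cconj_conj; move: (h z) (/ r) => k q; case: z {hz hc e hz' d3 e3 ec d4 e4} => x y; case: k => a b.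
vector_eq (slice_structure n V J hJ).
  by rewrite /Cmult /Cplus /Copp /RtoC /Ci /Cconj /=; congr pair; ring.
by rewrite /Cmult /Cplus /Copp /RtoC /Ci /Cconj /=; congr pair; ring.
Qed.

Lemma dir_conj e psi r : (RtoC r * dir e (- psi))%C = Cconj (RtoC r * dir e psi)%C.
Proof. by rewrite !dir_scale /Cconj /= cos_neg sin_neg; congr pair; ring. Qed.

Lemma calc_slice e theta h phi J1 J2 (h1 : imag_unit J1) (h2 : imag_unit J2) v :
  e * e = 1 -> omega < theta < PI / 2 -> sector_fun e theta h ->
  (forall z, cos theta * Cmod z < e * fst z -> h (Cconj z) = Cconj (h z)) ->
  omega < phi < theta ->
  calc V (slice_structure n V J1 h1) (res_at n V T J1) e h phi v =
  calc V (slice_structure n V J2 h2) (res_at n V T J2) e h phi v.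
Proof.
move=> ee ht hh hc hphi.
have hphi' : omega < phi < PI / 2 by lra.
have hcos : cos theta < cos phi by apply: cos_decreasing_1; lra.
have I J (hJ : imag_unit J) :
    is_ray_int (fun r => minus
      (ray_integrand V (slice_structure n V J hJ) h (fun z => res_at n V T J z v) (dir e (- phi)) r)
      (ray_integrand V (slice_structure n V J hJ) h (fun z => res_at n V T J z v) (dir e phi) r))
    (calc V (slice_structure n V J hJ) (res_at n V T J) e h phi v).
  have P := slice_pseudo_resolvent J hJ.
  have [K [K0 hK]] := res_rays_bounded V _ omega _ homega P e ee phi hphi'.
  exact: (is_ray_int_sec V _ e theta h ee hh phi hcos _ _ (hK v)).
apply: (is_ray_int_unique V _ _ _ (I J1 h1)).
refine (is_ray_int_ext V _ _ _ _ (I J2 h2)) => r r0.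
rewrite /ray_integrand dir_conj; set z := (RtoC r * dir e phi)%C.
have [c0 c1] := cos_angle omega homega phi hphi'.
have hz : outside omega z.
  by apply: (outside_dir omega e ee) => //; rewrite Rabs_pos_eq; lra.
have hcz : h (Cconj z) = Cconj (h z).
  by apply: hc; rewrite /z Cmod_scale_dir // Re_scale_dir //; nra.
(* [Q_s[T]] depends on [z] only through [fst z] and [Cmod z], so the preimage [w] found in the slice
   of [J1] also serves in that of [J2]. *)
have [w [[d1 d2] E]] := op_Q_ex n V T J1 h1 z (rho_outside J1 h1 z hz) v.
by rewrite (slice_pair J1 h1 h z r v w) // (slice_pair J2 h2 h z r v w).
Qed.

Lemma slice_scale J (u : C) r :
  slice J (fst (RtoC r * u)%C) (snd (RtoC r * u)%C) = (r *: slice J (fst u) (snd u))%ring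
    :> clifford n.
Proof.
rewrite sliceZ; congr slice; case: u => a b /=.
  by change (r * a - 0 * b = r * a); ring.
by change (r * b + 0 * a = r * b); ring.
Qed.

Lemma slice_mulC J (z w : C) : imag_unit J ->
  (slice J (fst z) (snd z) * slice J (fst w) (snd w))%ring =
  slice J (fst (z * w)%C) (snd (z * w)%C) :> clifford n.
Proof. exact: slice_mul. Qed.

(** Bridge from the integrals with Clifford factors to the complex ones: along the rays all factors
    lie in the plane of [J], where right multiplication is [cact]. *)
Lemma sec_ray_integral e theta h phi J (hJ : imag_unit J) f v :
  e * e = 1 -> omega < theta < PI / 2 -> sector_fun e theta h ->
  (forall z, cos theta * Cmod z < e * fst z ->
     f (slice J (fst z) (snd z)) = slice J (fst (h z)) (snd (h z))) ->
  omega < phi < theta ->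
  minus (ray_integral T f J (slice J (fst (dir e (- phi))) (snd (dir e (- phi)))) v)
    (ray_integral T f J (slice J (fst (dir e phi)) (snd (dir e phi))) v) =
  calc V (slice_structure n V J hJ) (res_at n V T J) e h phi v.
Proof.
move=> ee ht hh hf hphi.
have hphi' : omega < phi < PI / 2 by lra.
have hcos : cos theta < cos phi by apply: cos_decreasing_1; lra.
have hcos' : cos theta < cos (- phi) by rewrite cos_neg.
have P := slice_pseudo_resolvent J hJ.
have [K [K0 hK]] := res_rays_bounded V _ omega _ homega P e ee phi hphi'.
have [b1 b2] := hK v.
rewrite /calc /sec_int.
have main psi : cos theta < cos psi ->
    ray_bounded V (fun z => res_at n V T J z v) (dir e psi) (K * norm v) ->
    ray_integral T f J (slice J (fst (dir e psi)) (snd (dir e psi))) v =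
    ray_int V (slice_structure n V J hJ) h (fun z => res_at n V T J z v) (dir e psi).
  move=> hpsi b; apply: RInt_gen_ray.
  refine (is_ray_int_ext V _ _ _ _ (is_ray_intP V _ e theta h ee hh psi _ _ hpsi b)) => r r0.
  rewrite -slice_scale hf; last first.
    by rewrite Cmod_scale_dir // Re_scale_dir // Rmult_comm; apply: Rmult_lt_compat_l.
  rewrite oppJ_slice -/(fst (0, -1)) -/(snd (0, -1)).
  have -> : slice J 0 (-1) = slice J (fst (- Ci)%C) (snd (- Ci)%C) :> clifford n.
    by congr slice; rewrite /=; ring.
  rewrite !slice_mulC // -(cact_slice n V J hJ) /ray_integrand /ray_fun /res_at.
  have rn : RtoC r <> 0%C by move=> [] e0; lra.
  by vector_eq (slice_structure n V J hJ); rewrite RtoC_inv; [field | lra].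
by rewrite (main _ hcos' b1) (main _ hcos b2).
Qed.

Lemma ray_integral_zero f J u (v : V) :
  (forall r, 0 < r -> f (r *: u)%ring = 0%ring) -> ray_integral T f J u v = zero.
Proof.
move=> hf; apply: RInt_gen_ray.
(* Convergence of the zero integrand is obtained as the image of the integral of [bump] under the
   zero map. *)
have k := is_ray_int_linear R_NormedModule V (fun _ => zero) _ _ is_linear_zero (is_ray_int_bump 1 Rlt_0_1).
refine (is_ray_int_ext V _ _ _ _ k) => r r0; rewrite hf //.
have -> x : (0 * x)%ring = (0%:A)%ring :> clifford n by rewrite GRing.mul0r GRing.scale0r.
by rewrite ract_real scal_zero_l.
Qed.

End SliceResolvent.

(** * Spectral projectors *)

Section Functions.
Variables (n : nat) (theta : R) (f : clifford n -> clifford n).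
Hypothesis htheta : 0 < theta < PI / 2.

Definition in_sector e (z : C) : Prop := cos theta * Cmod z < e * fst z.

Lemma in_sector_open e z : e = 1 \/ e = -1 -> in_sector e z ->
  exists d, 0 < d /\ forall z', Cmod (z' - z) < d -> in_sector e z'.
Proof.
(* Either side of the inequality changes by at most [Cmod (z' - z)], so half the gap is allowed. *)
rewrite /in_sector => he hz; exists ((e * fst z - cos theta * Cmod z) / 2); split; first lra.
move=> z' hz'.
have c1 : 0 < cos theta <= 1 by split; [apply: cos_gt_0; lra | have := COS_bound theta; lra].
have t1 := Cmod_triangle z (z' - z).
have ez : (z + (z' - z) = z')%C by ring.
rewrite ez in t1.
have t2 := re_le_Cmod (z' - z); rewrite /Re /= in t2.
have t3 : - Cmod (z' - z) <= e * (fst z' + - fst z).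
  move/Rabs_le_between: t2 => t2; case: he => ->; lra.
have t4 : cos theta * Cmod z' <= cos theta * Cmod z + Cmod (z' - z).
  apply: Rle_trans (Rmult_le_compat_l _ _ _ (Rlt_le _ _ (proj1 c1)) t1) _.
  by have := Cmod_ge_0 (z' - z); nra.
have : e * (fst z' + - fst z) = e * fst z' - e * fst z by ring.
lra.
Qed.

(** With [p = r^a] this is [(1 + p)^2 <= 2 (1 + p^2)]. *)
Lemma bump_ge a r : 0 < r -> Rpower r a / (1 + Rpower r (2 * a)) <= 2 * bump a r.
Proof.
move=> r0; rewrite /bump /bump_prim.
have -> : Rpower r (2 * a) = Rpower r a * Rpower r a.
  by rewrite -Rpower_plus; congr Rpower; ring.
set p := Rpower r a; have p0 : 0 < p by apply: exp_pos.
have -> : / (1 + p) * (1 - / (1 + p)) = p / ((1 + p) * (1 + p)) by field; lra.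
have -> : 2 * (p / ((1 + p) * (1 + p))) = p / ((1 + p) * (1 + p) / 2) by field; nra.
apply: Rmult_le_compat_l; first lra.
by have := Rle_0_sqr (1 - p); rewrite /Rsqr => sq; apply: Rinv_le_contravar; nra.
Qed.

(** The function [h = alpha + i beta] represents [f] in every slice at once. Continuous partial
    derivatives yield a real differential, the Cauchy-Riemann equations make it complex linear, and
    the parities of [alpha] and [beta] become the symmetry under conjugation. *)
Lemma N_zero_sector_fun J0 : @imag_unit n J0 -> N_zero (double_sector theta) f ->
  exists h : C -> C,
    sector_fun 1 theta h /\ sector_fun (-1) theta h /\
    (forall e z, e = 1 \/ e = -1 -> in_sector e z ->
      h (Cconj z) = Cconj (h z) /\
      forall J, imag_unit J -> f (slice J (fst z) (snd z)) = slice J (fst (h z)) (snd (h z))).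
Proof.
move=> hJ0 [[al [be [ax [ay H]]]] [a [Cf [a0 [Cf0 hb]]]]].
pose h (z : C) : C := (al (fst z) (snd z), be (fst z) (snd z)).
pose h' (z : C) : C := (ax (fst z) (snd z), - ay (fst z) (snd z)).
have inU e z : e = 1 \/ e = -1 -> in_sector e z ->
    forall J, @imag_unit n J -> double_sector theta (slice J (fst z) (snd z)).
  by move=> he hz J hJ; apply: (slice_double_sector n theta e).
have sf e : e = 1 \/ e = -1 -> sector_fun e theta h.
  move=> he; exists h', a, (2 * Cf); split => //; split; first lra.
  move=> z hz.
  have [hval [_ [_ [_ [dy [_ [dy' [cx cy]]]]]]]] := H (fst z) (snd z) (inU e z he hz).
  have cx' := proj1 (continuity_2d_pt_filterlim _ _ _) cx.
  have cy' := proj1 (continuity_2d_pt_filterlim _ _ _) cy.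
  have [d [d0 hd]] := in_sector_open e z he hz.
  have near := Cmod_ball z d d0.
  have ez : z = (fst z, snd z) by case: (z).
  split; [split | split].
  - have nb : locally (fst z, snd z) (fun u : R * R =>
        is_derive (fun t : R => al t (snd u)) (fst u) (ax (fst u) (snd u))).
      rewrite -ez; apply: filter_imp near => u hu.
      by have [_ [_ [_ [dx _]]]] := H (fst u) (snd u) (inU e u he (hd u hu)).
    have k := is_derive_filterdiff al (fst z) (snd z) ax (ay (fst z) (snd z)) nb dy cx'.
    rewrite -ez in k.
    apply: (filterdiff_ext_lin (U := C_R_NormedModule) _ _ _ k) => u.
    by rewrite /h' /Cmult /plus /scal /mult /=; rewrite /mult /=; ring.
  - have nb : locally (fst z, snd z) (fun u : R * R =>
        is_derive (fun t : R => be t (snd u)) (fst u) (- ay (fst u) (snd u))).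
      rewrite -ez; apply: filter_imp near => u hu.
      by have [_ [_ [_ [_ [_ [dx _]]]]]] := H (fst u) (snd u) (inU e u he (hd u hu)).
    have cy'' : continuous (fun u : R * R => - ay (fst u) (snd u)) (fst z, snd z).
      exact: (continuous_opp (V := R_NormedModule) (fun u : R * R => ay (fst u) (snd u)) _ cy').
    have k := is_derive_filterdiff be (fst z) (snd z) (fun x y => - ay x y) (ax (fst z) (snd z)) nb dy' cy''.
    rewrite -ez in k.
    apply: (filterdiff_ext_lin (U := C_R_NormedModule) _ _ _ k) => u.
    by rewrite /h' /Cmult /plus /scal /mult /=; rewrite /mult /=; ring.
  - have cx2 : continuous (T := C_UniformSpace) (U := R_UniformSpace) (fun u : C => ax (fst u) (snd u)) z.
      by rewrite {1}ez.
    have cy2 : continuous (T := C_UniformSpace) (U := R_UniformSpace) (fun u : C => - ay (fst u) (snd u)) z.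
      rewrite {1}ez.
      exact: (continuous_opp (V := R_NormedModule) (fun u : R * R => ay (fst u) (snd u)) _ cy').
    exact: (continuous_pair C_UniformSpace R_UniformSpace R_UniformSpace _ _ _ cx2 cy2).
  - have := hb _ (inU e z he hz J0 hJ0).
    rewrite (hval _ hJ0) !cnorm_slice // -ez => hbd.
    have z0 : 0 < Cmod z.
      have := Cmod_ge_0 z; have := re_le_Cmod z; rewrite /Re => /Rabs_le_between b.
      have c0 : 0 < cos theta by apply: cos_gt_0; lra.
      rewrite /in_sector in hz; case: he hz => -> hz; nra.
    have bg := bump_ge a (Cmod z) z0.
    apply: Rle_trans hbd _.
    have -> : 2 * Cf * bump a (Cmod z) = Cf * (2 * bump a (Cmod z)) by ring.
    by rewrite /Rdiv Rmult_assoc; apply: Rmult_le_compat_l.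
exists h; split; first by apply: sf; left.
split; first by apply: sf; right.
move=> e z he hz; have [hval [ev [od _]]] := H (fst z) (snd z) (inU e z he hz).
by split => //; rewrite /h /Cconj /= ev od.
Qed.

End Functions.

Section Calculus.
Variables (n : nat) (V : rightHilbertModule n) (T : operator V) (omega : R).
Hypothesis homega : 0 < omega < PI / 2.
Hypothesis Tbis : bisectorial T omega.
Variables (J0 : clifford n) (hJ0 : imag_unit J0).

Let S0 := slice_structure n V J0 hJ0.
Let P0 := slice_pseudo_resolvent n V T omega homega Tbis J0 hJ0.

(* The part of f(T) carried by the right (e = 1) or left (e = -1) half of the
   double sector, up to the choice of the angles. *)
Definition half_calculus (e : R) (A : V -> V) : Prop :=
  exists theta h phi, omega < theta < PI / 2 /\ sector_fun e theta h /\
    omega < phi < theta /\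
    forall v, A v = scal (/ (2 * PI)) (calc V S0 (res_at n V T J0) e h phi v).

Lemma half_calculus_linear e A : e * e = 1 -> half_calculus e A -> is_linear A.
Proof.
move=> ee [theta [h [phi [ht [hh [hp E]]]]]].
have [L _] := calc_linear V S0 omega _ homega P0 e ee theta h ht hh phi hp.
apply: (is_linear_ext _ _ (fun v => eq_sym (E v))).
exact: (is_linear_comp _ (fun v : V => scal (/ (2 * PI)) v) L (is_linear_scal_r _ Rmult_comm)).
Qed.

Lemma half_calculus_comm e1 e2 A B v : e1 * e1 = 1 -> e2 * e2 = 1 ->
  half_calculus e1 A -> half_calculus e2 B -> A (B v) = B (A v).
Proof.
move=> ee1 ee2 hA hB.
have LA := half_calculus_linear _ _ ee1 hA; have LB := half_calculus_linear _ _ ee2 hB.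
move: hA hB => [t1 [h1 [p1 [ht1 [hh1 [hp1 E1]]]]]] [t2 [h2 [p2 [ht2 [hh2 [hp2 E2]]]]]].
rewrite [in LHS]E2 [in RHS]E1 (linear_scal _ LA) (linear_scal _ LB) E1 E2.
by rewrite (calc_comm V S0 omega _ homega P0 e1 e2 t1 t2 h1 h2 p1 p2 v ee1 ee2 ht1 ht2 hh1 hh2 hp1 hp2).
Qed.

Lemma half_calculus_ortho A B v : half_calculus 1 A -> half_calculus (-1) B ->
  B (A v) = zero.
Proof.
move=> hA hB; have LB : is_linear B.
  by apply: half_calculus_linear hB; ring.
move: hA hB => [t1 [h1 [p1 [ht1 [hh1 [hp1 E1]]]]]] [t2 [h2 [p2 [ht2 [hh2 [hp2 E2]]]]]].
rewrite E1 (linear_scal _ LB) E2.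
rewrite (calc_ortho V S0 (module_separating n V) omega _ homega P0 t2 t1) //.
by rewrite !scal_zero_r.
Qed.

(** Each indicator is 1 on one half of the double sector and 0 on the other, so it keeps one pair of
    rays and kills the other pair. [A] and [B] are built with one angle and the unit [J0], yet
    describe the contour operators for all [phi] and [J]. *)
Lemma calculus_split theta f : omega < theta < PI / 2 -> N_zero (double_sector theta) f ->
  exists A B, half_calculus 1 A /\ half_calculus (-1) B /\
    forall phi J v, omega < phi < theta -> imag_unit J ->
      contour_op T f J phi v = plus (A v) (B v) /\
      contour_op T (fun s => f s * ind_plus s)%ring J phi v = A v /\
      contour_op T (fun s => f s * ind_minus s)%ring J phi v = B v.
Proof.
move=> ht hf.
have ht' : 0 < theta < PI / 2 by lra.
have [h [h1 [h2 hh]]] := N_zero_sector_fun n theta f ht' J0 hJ0 hf.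
pose phi0 := (omega + theta) / 2.
have hphi0 : omega < phi0 < theta by rewrite /phi0; lra.
have ee1 : 1 * 1 = 1 by ring.
have ee2 : (-1) * (-1) = 1 by ring.
pose A v := scal (/ (2 * PI)) (calc V S0 (res_at n V T J0) 1 h phi0 v).
pose B v := scal (/ (2 * PI)) (calc V S0 (res_at n V T J0) (-1) h phi0 v).
exists A, B; split; first by exists theta, h, phi0.
split; first by exists theta, h, phi0.
move=> phi J v hphi hJ.
have angle e : e * e = 1 -> e = 1 \/ e = -1 -> sector_fun e theta h ->
    calc V (slice_structure n V J hJ) (res_at n V T J) e h phi v =
    calc V S0 (res_at n V T J0) e h phi0 v.
  move=> ee he hs.
  have hc z : cos theta * Cmod z < e * fst z -> h (Cconj z) = Cconj (h z).
    by move=> hz; have [] := hh e z he hz.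
  rewrite (calc_slice n V T omega homega Tbis e theta h phi J J0 hJ hJ0 v ee ht hs hc hphi).
  case: (Rle_lt_dec phi phi0) => hle.
    by apply: (calc_angle V S0 (module_separating n V) omega _ homega P0 e ee theta h ht hs); lra.
  by symmetry; apply: (calc_angle V S0 (module_separating n V) omega _ homega P0 e ee theta h ht hs); lra.
have right_part g : (forall z, cos theta * Cmod z < 1 * fst z ->
      g (slice J (fst z) (snd z)) = slice J (fst (h z)) (snd (h z))) ->
    minus (ray_integral T g J (slice J (cos phi) (- sin phi)) v)
      (ray_integral T g J (slice J (cos phi) (sin phi)) v) =
    calc V S0 (res_at n V T J0) 1 h phi0 v.
  move=> hg; rewrite -(angle 1 ee1 (or_introl eq_refl) h1).
  rewrite -(sec_ray_integral n V T omega homega Tbis 1 theta h phi J hJ g v ee1 ht h1 hg hphi).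
  by rewrite /dir /= !Rmult_1_l cos_neg sin_neg.
have left_part g : (forall z, cos theta * Cmod z < -1 * fst z ->
      g (slice J (fst z) (snd z)) = slice J (fst (h z)) (snd (h z))) ->
    minus (ray_integral T g J (- slice J (cos phi) (- sin phi))%ring v)
      (ray_integral T g J (- slice J (cos phi) (sin phi))%ring v) =
    calc V S0 (res_at n V T J0) (-1) h phi0 v.
  move=> hg; rewrite -(angle (-1) ee2 (or_intror eq_refl) h2).
  rewrite -(sec_ray_integral n V T omega homega Tbis (-1) theta h phi J hJ g v ee2 ht h2 hg hphi).
  rewrite !sliceN /dir /= cos_neg sin_neg.
  have m1 x : -1 * x = - x by ring.
  by rewrite !m1.
have hv e z : e = 1 \/ e = -1 -> cos theta * Cmod z < e * fst z ->
    f (slice J (fst z) (snd z)) = slice J (fst (h z)) (snd (h z)).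
  by move=> he hz; have [_] := hh e z he hz; apply.
have ct : 0 < cos theta by apply: cos_gt_0; lra.
have pos e z : cos theta * Cmod z < e * fst z -> 0 < e * fst z.
  by have := Rmult_le_pos _ _ (Rlt_le _ _ ct) (Cmod_ge_0 z); lra.
have zero_right g x : (forall a b, 0 < a -> g (slice J a b) = 0%ring) ->
    ray_integral T g J (slice J (cos phi) x) v = zero.
  move=> hg; apply: ray_integral_zero => r r0; rewrite sliceZ; apply: hg.
  by apply: Rmult_lt_0_compat => //; apply: cos_gt_0; lra.
have zero_left g x : (forall a b, a < 0 -> g (slice J a b) = 0%ring) ->
    ray_integral T g J (- slice J (cos phi) x)%ring v = zero.
  move=> hg; apply: ray_integral_zero => r r0; rewrite sliceN sliceZ; apply: hg.
  have : 0 < r * cos phi by apply: Rmult_lt_0_compat => //; apply: cos_gt_0; lra.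
  by move=> q; change (r * - cos phi < 0); lra.
have zz : minus (zero : V) zero = zero by apply: minus_eq_zero.
rewrite /contour_op /=; split; [|split].
- rewrite right_part; last by move=> z hz; apply: hv hz; left.
  rewrite left_part; last by move=> z hz; apply: hv hz; right.
  exact: scal_distr_l.
- rewrite right_part; last first.
    move=> z hz; rewrite /ind_plus Sc_slice //; case: Rlt_dec => [?|?] /=; last first.
      by have := pos 1 z hz; lra.
    by rewrite cmulr1; apply: hv hz; left.
  have hz a b : a < 0 -> (f (slice J a b) * ind_plus (slice J a b))%ring = 0%ring.
    by move=> a0; rewrite /ind_plus Sc_slice //; case: Rlt_dec => [?|?] /=; [lra | rewrite cmulr0].
  by rewrite !(zero_left (fun s => f s * ind_plus s)%ring) // zz plus_zero_r.
- rewrite left_part; last first.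
    move=> z hz; rewrite /ind_minus Sc_slice //; case: Rlt_dec => [?|?] /=; last first.
      by have := pos (-1) z hz; lra.
    by rewrite cmulr1; apply: hv hz; right.
  have hz a b : 0 < a -> (f (slice J a b) * ind_minus (slice J a b))%ring = 0%ring.
    by move=> a0; rewrite /ind_minus Sc_slice //; case: Rlt_dec => [?|?] /=; [lra | rewrite cmulr0].
  by rewrite !(zero_right (fun s => f s * ind_minus s)%ring) // zz plus_zero_l.
Qed.

End Calculus.

Lemma op_inv_spec (U : CompleteNormedModule R_AbsRing) (E : operator U) w :
  op_injective E -> dom (op_inv E) w -> dom E (op_inv E w) /\ E (op_inv E w) = w.
Proof.
move=> Ei [v [dv e]]; apply: (iota_correct (fun v : U => dom E v /\ E v = w)).
exists v; split => // v' [dv' e']; apply: Ei => //; by rewrite e e'.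
Qed.

Lemma op_eq_total (U : CompleteNormedModule R_AbsRing) (A B : operator U) :
  (forall v, dom A v) -> (forall v, dom B v) -> (forall v, A v = B v) -> op_eq A B.
Proof. by move=> dA dB AB; split=> v. Qed.

(** * From the regularized equations to the projector identities *)

Section Projectors.
Variables (n : nat) (V : rightHilbertModule n) (T : operator V) (omega : R).
Hypothesis homega : 0 < omega < PI / 2.
Hypothesis Tbis : bisectorial T omega.
Variables (J0 : clifford n) (hJ0 : imag_unit J0).

Let half := half_calculus n V T omega J0 hJ0.
Let indicator (b : bool) : clifford n -> clifford n :=
  if b then @ind_plus n else @ind_minus n.
Let part (b : bool) (A B : V -> V) : V -> V := if b then A else B.
Let jointly_injective (A B : V -> V) : Prop :=
  forall u w, A u = A w -> B u = B w -> u = w.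

Let ee1 : 1 * 1 = 1. Proof. ring. Qed.
Let eem : (-1) * (-1) = 1. Proof. ring. Qed.

Lemma half_right_left A B v : half 1 A -> half (-1) B -> A (B v) = zero.
Proof.
move=> hA hB.
rewrite (half_calculus_comm n V T omega homega Tbis J0 hJ0 1 (-1) A B v ee1 eem hA hB).
exact: (half_calculus_ortho n V T omega homega Tbis J0 hJ0 A B v hA hB).
Qed.

Lemma half_left_right A B v : half 1 A -> half (-1) B -> B (A v) = zero.
Proof. exact: (half_calculus_ortho n V T omega homega Tbis J0 hJ0 A B v). Qed.

Lemma half_comm e A A' v : e * e = 1 -> half e A -> half e A' -> A (A' v) = A' (A v).
Proof. by move=> ee; apply: (half_calculus_comm n V T omega homega Tbis J0 hJ0). Qed.

Lemma half_linear e A : e * e = 1 -> half e A -> is_linear A.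
Proof. by move=> ee; apply: (half_calculus_linear n V T omega homega Tbis J0 hJ0). Qed.

(** With [E = A + B] and [F] one of [A], [B], the definition [P = E^-1 F] becomes an equation for
    [P v]; the last clause recovers the domain, as [v] belongs to it once [F v] is in the range of
    [E]. *)
Lemma calculus_spec b theta P : omega < theta < PI / 2 ->
  is_calculus T omega theta (indicator b) P ->
  exists A B, half 1 A /\ half (-1) B /\
    (forall u w, plus (A u) (B u) = plus (A w) (B w) -> u = w) /\
    (forall v, dom P v -> plus (A (P v)) (B (P v)) = part b A B v) /\
    (forall v u, plus (A u) (B u) = part b A B v -> dom P v).
Proof.
move=> ht [_ [e [E [F [[he [phi [J [hphi [hJ [dE vE]]]]]] [[_ [phi' [J' [hphi' [hJ' [dF vF]]]]]] [Ei [dP vP]]]]]]]].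
have [A [B [hA [hB split]]]] := calculus_split n V T omega homega Tbis J0 hJ0 theta e ht he.
have EE u : dom E u /\ E u = plus (A u) (B u).
  have du : dom E u by apply/dE.
  by split => //; rewrite vE //; have [-> _] := split phi J u hphi hJ.
have FF v : dom F v /\ F v = part b A B v.
  have dv : dom F v by apply/dF.
  split => //; rewrite vF //; have [_ [s1 s2]] := split phi' J' v hphi' hJ'.
  by rewrite /indicator /part; case: (b).
exists A, B; split => //; split => //; split; [|split].
- move=> u w; have [du <-] := EE u; have [dw <-] := EE w; exact: Ei.
- move=> v dv; rewrite (vP v dv).
  have [_ dE'] := proj1 (dP v) dv.
  have [_ e1] := op_inv_spec _ _ _ Ei dE'.
  have [_ e2] := EE (op_inv E (F v)); have [_ e3] := FF v.
  exact: (eq_trans (eq_sym e2) (eq_trans e1 e3)).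
- move=> v u huv; apply/dP; split; first by have [] := FF v.
  by exists u; have [du ->] := EE u; have [_ ->] := FF v.
Qed.

(** The bounded calculus yields an everywhere defined [Q] for the same indicator and angle, but
    possibly with another regularizer. That [Q v] solves the equation of [P v] is checked after
    applying the injective [A' + B']: commutation and orthogonality reduce it to the equation of
    [Q]. *)
Lemma projector_spec b P : bounded_Hinfty_calculus T omega ->
  is_spectral_projector T omega (indicator b) P ->
  (forall v, dom P v) /\
  exists A B, half 1 A /\ half (-1) B /\ jointly_injective A B /\
    forall v, plus (A (P v)) (B (P v)) = part b A B v.
Proof.
move=> Tcalc [theta [ht hP]].
have [C [_ Tc]] := Tcalc theta ht.
have [Q [hQ [[_ [dQ _]] _]]] := Tc _ (proj1 hP).
have [A [B [hA [hB [inj [spec domP]]]]]] := calculus_spec b theta P ht hP.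
have [A' [B' [hA' [hB' [inj' [spec' _]]]]]] := calculus_spec b theta Q ht hQ.
have [LA LB] := (half_linear _ _ ee1 hA, half_linear _ _ eem hB).
have [LA' LB'] := (half_linear _ _ ee1 hA', half_linear _ _ eem hB').
have dP v : dom P v.
  apply: (domP v (Q v)); apply: inj'.
  have e := spec' v (dQ v).
  have eA := f_equal A e; have eB := f_equal B e.
  rewrite (linear_plus A LA) (half_right_left A B') // in eA.
  rewrite (linear_plus B LB) (half_left_right A' B) // in eB.
  rewrite plus_zero_r in eA; rewrite plus_zero_l in eB.
  rewrite !(linear_plus A' LA') !(linear_plus B' LB').
  rewrite (half_right_left A' B) // (half_left_right A B') // plus_zero_r plus_zero_l.
  rewrite (half_comm 1 A' A) // (half_comm (-1) B' B) // eA eB.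
  rewrite /part; case: (b).
    by rewrite (half_comm 1 A A') // (half_left_right A' B) // (half_left_right A B').
  by rewrite (half_comm (-1) B B') // (half_right_left A B') // (half_right_left A' B).
split => //; exists A, B; split => //; split => //; split; last by move=> v; apply: spec.
by move=> u w eA eB; apply: inj; rewrite eA eB.
Qed.

(** Valid for the halves of any regularizer and not only of the one behind [P], which is what lets
    the two projectors be compared. Each equation is verified after applying the jointly injective
    [A1] and [B1]. *)
Lemma projector_parts b P : bounded_Hinfty_calculus T omega ->
  is_spectral_projector T omega (indicator b) P ->
  (forall v, dom P v) /\
  (forall A v, half 1 A -> A (P v) = if b then A v else zero) /\
  (forall B v, half (-1) B -> B (P v) = if b then zero else B v).
Proof.
move=> Tcalc hP; have [dP [A1 [B1 [hA1 [hB1 [inj spec]]]]]] := projector_spec b P Tcalc hP.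
have [LA1 LB1] := (half_linear _ _ ee1 hA1, half_linear _ _ eem hB1).
split => //; split.
- move=> A v hA; have LA := half_linear _ _ ee1 hA.
  have e := f_equal A (spec v).
  rewrite (linear_plus A LA) (half_right_left A B1) // plus_zero_r in e.
  apply: inj; last first.
    by rewrite (half_left_right A B1) //; case: (b); rewrite ?(linear_zero B1) // (half_left_right A B1).
  rewrite (half_comm 1 A1 A) // e /part; case: (b); first exact: (half_comm 1 A A1).
  by rewrite (half_right_left A B1) // (linear_zero A1).
- move=> B v hB; have LB := half_linear _ _ eem hB.
  have e := f_equal B (spec v).
  rewrite (linear_plus B LB) (half_left_right A1 B) // plus_zero_l in e.
  apply: inj.
    by rewrite (half_right_left A1 B) //; case: (b); rewrite ?(linear_zero A1) // (half_right_left A1 B).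
  rewrite (half_comm (-1) B1 B) // e /part; case: (b); last exact: (half_comm (-1) B B1).
  by rewrite (half_left_right A1 B) // (linear_zero B1).
Qed.

(** One pair [A], [B] detects vectors for both projectors: on the images, [P] acts as
    [(a, b) |-> (a, 0)] and [M] as [(a, b) |-> (0, b)]. *)
Lemma projector_identities P M : bounded_Hinfty_calculus T omega ->
  is_spectral_projector T omega (@ind_plus n) P ->
  is_spectral_projector T omega (@ind_minus n) M ->
  (op_eq (op_comp P P) P /\ op_eq (op_comp M M) M) /\
  (op_eq (op_comp P M) (op_zero V) /\ op_eq (op_comp M P) (op_zero V)) /\
  op_eq (op_add P M) (op_id V).
Proof.
move=> Tcalc hP hM.
have [dP [PA PB]] := projector_parts true P Tcalc hP.
have [dM [MA MB]] := projector_parts false M Tcalc hM.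
have [_ [A [B [hA [hB [inj _]]]]]] := projector_spec true P Tcalc hP.
have [LA LB] := (half_linear _ _ ee1 hA, half_linear _ _ eem hB).
have A0 := linear_zero A LA; have B0 := linear_zero B LB.
have {}PA v : A (P v) = A v := PA A v hA.
have {}PB v : B (P v) = zero := PB B v hB.
have {}MA v : A (M v) = zero := MA A v hA.
have {}MB v : B (M v) = B v := MB B v hB.
have PP v : P (P v) = P v by apply: inj; rewrite ?PA ?PB.
have MM v : M (M v) = M v by apply: inj; rewrite ?MA ?MB.
have PM v : P (M v) = zero by apply: inj; rewrite ?PA ?MA ?PB ?A0 ?B0.
have MP v : M (P v) = zero by apply: inj; rewrite ?MA ?MB ?PB ?A0 ?B0.
have sum v : plus (P v) (M v) = v.
  apply: inj; first by rewrite (linear_plus A LA) PA MA plus_zero_r.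
  by rewrite (linear_plus B LB) PB MB plus_zero_l.
by split; [split | split; [split|]]; apply: op_eq_total => // v; split;
  (apply: dP || apply: dM).
Qed.

End Projectors.

Theorem lemma4p2 (n : nat) (hn : (0 < n)%nat) (V : rightHilbertModule n)
    (T : operator V) (omega : R)
    (homega : 0 < omega < PI / 2)
    (Tinj : op_injective T)
    (Tbis : bisectorial T omega)
    (Tcalc : bounded_Hinfty_calculus T omega)
    (Pplus Pminus : operator V)
    (hPplus : is_spectral_projector T omega (@ind_plus n) Pplus)
    (hPminus : is_spectral_projector T omega (@ind_minus n) Pminus) :
  (op_eq (op_comp Pplus Pplus) Pplus /\ op_eq (op_comp Pminus Pminus) Pminus) /\
  (op_eq (op_comp Pplus Pminus) (op_zero V) /\
   op_eq (op_comp Pminus Pplus) (op_zero V)) /\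
  op_eq (op_add Pplus Pminus) (op_id V).
Proof.
(* As [n] is positive there is a generator, hence a unit [J0] that fixes the complex structure. *)
have [J0 hJ0] := imag_unit_ex n hn.
exact: (projector_identities n V T omega homega Tbis J0 hJ0).
Qed.
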